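(* For every $n\ge 3$, there exists a maximal cyclic subgroup $\langle w\rangle$ of $\mathsf{SL}(n,\mathbb Z)$ such that the double $\mathsf{SL}(n,\mathbb Z)\ast_{\langle w\rangle}\mathsf{SL}(n,\mathbb Z)$ is not linear, i.e. admits no faithful homomorphism into $\mathsf{GL}(d,\mathbf{k})$ for any $d\in\mathbb N$ and any field $\mathbf{k}$.
   Context: A cyclic subgroup is maximal if it is not contained in a strictly larger cyclic subgroup. The double $\Gamma\ast_{W}\Gamma$ is the quotient of the free product of two copies of $\Gamma$ by the normal subgroup generated by $i_1(u)i_2(u)^{-1}$, $u\in W$, where $i_1,i_2$ are the inclusions of $\Gamma$ as the two factors. *)

(* Defs.v *)
From HB Require Import structures.
From mathcomp Require Import all_boot all_order all_algebra.
From Stdlib Require Import Relations.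
Set Implicit Arguments. Unset Strict Implicit. Unset Printing Implicit Defensive.
Import Order.TTheory GRing.Theory Num.Theory.
Local Open Scope ring_scope.

Definition SLZ (n : nat) := {M : 'M[int]_n | \det M == 1}.

Lemma SLZ_mul_proof n (a b : SLZ n) : \det (val a *m val b) == 1.
Proof. by rewrite det_mulmx (eqP (valP a)) (eqP (valP b)) mulr1. Qed.

Definition SLZ_mul n (a b : SLZ n) : SLZ n := exist (fun M : 'M[int]_n => \det M == 1) _ (SLZ_mul_proof a b).

Lemma SLZ_one_proof n : \det (1%:M : 'M[int]_n) == 1.
Proof. by rewrite det1. Qed.

Definition SLZ_one n : SLZ n := exist (fun M : 'M[int]_n => \det M == 1) _ (SLZ_one_proof n).

Lemma SLZ_inv_proof n (a : SLZ n) : \det (invmx (val a)) == 1.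
Proof. by rewrite det_inv (eqP (valP a)) invr1. Qed.

Definition SLZ_inv n (a : SLZ n) : SLZ n := exist (fun M : 'M[int]_n => \det M == 1) _ (SLZ_inv_proof a).

Fixpoint SLZ_npow n (a : SLZ n) (m : nat) : SLZ n :=
  match m with 0 => SLZ_one n | m'.+1 => SLZ_mul a (SLZ_npow a m') end.

Definition SLZ_zpow n (a : SLZ n) (k : int) : SLZ n :=
  match k with
  | Posz m => SLZ_npow a m
  | Negz m => SLZ_inv (SLZ_npow a m.+1)
  end.

Definition in_cyclic n (w u : SLZ n) : Prop := exists k : int, u = SLZ_zpow w k.

Definition maximal_cyclic n (w : SLZ n) : Prop :=
  forall v : SLZ n,
    (forall u, in_cyclic w u -> in_cyclic v u) ->
    (forall u, in_cyclic v u -> in_cyclic w u).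

(* The double SL(n,Z) *_<w> SL(n,Z): words in the letters (i, g), with
   i : bool indexing the copy (false = first, true = second) and g in SL(n,Z),
   modulo the congruence generated by the free-product relations
   (i,a)(i,b) = (i,ab), (i,1) = empty, and the amalgamation relations
   (false,u) = (true,u) for u in <w>. *)
Definition dletter n := (bool * SLZ n)%type.
Definition dword n := seq (dletter n).

Inductive dstep n (w : SLZ n) : dword n -> dword n -> Prop :=
| dstep_mul (i : bool) (a b : SLZ n) (x y : dword n) :
    dstep w (x ++ (i, a) :: (i, b) :: y) (x ++ (i, SLZ_mul a b) :: y)
| dstep_one (i : bool) (x y : dword n) :
    dstep w (x ++ (i, SLZ_one n) :: y) (x ++ y)
| dstep_amalg (u : SLZ n) (x y : dword n) :
    in_cyclic w u -> dstep w (x ++ (false, u) :: y) (x ++ (true, u) :: y).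

Definition deq n (w : SLZ n) : dword n -> dword n -> Prop :=
  clos_refl_sym_trans (dword n) (@dstep n w).

Definition faithful_rep n (w : SLZ n) (k : fieldType) (d : nat)
    (phi : dword n -> 'M[k]_d) : Prop :=
  [/\ forall x y, deq w x y -> phi x = phi y,
      phi [::] = 1%:M,
      forall x y, phi (x ++ y) = phi x *m phi y,
      forall x, phi x \in unitmx
    & forall x y, phi x = phi y -> deq w x y].

Definition double_linear n (w : SLZ n) : Prop :=
  exists (k : fieldType) (d : nat) (phi : dword n -> 'M[k]_d), faithful_rep w phi.

(* Main.v *)
(* Let w0 in SL(3, Z) have the eigenvalues 2 cos (2 pi k / 7), k = 1, 2, 3, and let w1, w2 be
   its Galois conjugates; the cyclic subgroup is generated by diag (w0, 1, ..., 1).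

   Every elementary matrix is a commutator that is central in a Heisenberg group, hence has
   eigenvalues of bounded order in every representation. In characteristic p it therefore acts
   with finite order, and no representation is faithful.

   In characteristic 0 the elementary matrices are unipotent up to a power N, and their
   logarithms span a representation of sl3 whose enveloping algebra U contains the images of
   E_ij(N). Mennicke symbols show that SL(3, Z) is torsion modulo the normal closure of the
   E_ij(N), so the image of some w0^m lies in U. It differs from the element of the torus
   prescribed by the weights of sl3 by some c that is central in U and commutes with the whole
   group. Since the Galois action is realized inside SL(3, Z), the same c serves w1 and w2, and
   w0 w1 w2 = 1 gives c^3 = 1. After replacing m by 3 m, the eigenvalues of w0^m are products
   of powers of eigenvalues l0, l1 of w0 with exponents the weights. As l0 and l1 are
   multiplicatively independent, the image of w0 determines the weights, hence the image of a
   power w1^m. So a representation of the double takes the same value on the two copies of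
   w1^m, although w1^m is not in <w0>. *)
Require Import Defs.
From mathcomp Require Import all_boot all_order all_algebra.
From mathcomp Require Import cyclic fieldext.
From mathcomp Require Import zify ring.
From Stdlib Require Import Relations Classical ClassicalEpsilon.
Set Implicit Arguments. Unset Strict Implicit. Unset Printing Implicit Defensive.
Import Order.TTheory GRing.Theory Num.Theory.
Local Open Scope ring_scope.

(** The obstacle is that a representation of SL(3, Z) need not be algebraic or irreducible. What is
    proved is superrigidity along one torus and up to powers: the value at some power of [w0] is the
    algebraic one. The field of 2 cos (2 pi / 7) is totally real and cyclic of degree 3. Hence the
    integer points of the torus of [w0] have rank two, and [w1] is a point independent of [w0]; in
    the basis chosen here the Galois action becomes the signed permutation [P0]. In that basis [w0]
    is also symmetric, so traces of its even powers are sums of squares, and their growth shows that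
    it is not a proper power. Logarithms are algebraic: a power of a unipotent matrix is a
    polynomial in the exponent, with the logarithm as linear coefficient. Galois conjugation of
    relations between eigenvalues passes through integer matrices in Z[w0]. The torsion statement is
    made for any group containing the elementary matrices, and it is applied to the matrices
    compatible with the derived representation, where explicit words put [w0] and [P0]. *)

Notation o0 := (@Ordinal 3 0 isT).
Notation o1 := (@Ordinal 3 1 isT).
Notation o2 := (@Ordinal 3 2 isT).

(** * Matrices of size three by entries, and elementary matrices *)

Lemma I3P (P : 'I_3 -> Prop) : P o0 -> P o1 -> P o2 -> forall i, P i.
Proof.
move=> P0 P1 P2 [[|[|[|//]]] lt_i].
- by rewrite (_ : Ordinal lt_i = o0) //; apply: val_inj.
- by rewrite (_ : Ordinal lt_i = o1) //; apply: val_inj.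
- by rewrite (_ : Ordinal lt_i = o2) //; apply: val_inj.
Qed.

Lemma sum3 (V : nmodType) (F : 'I_3 -> V) : \sum_i F i = F o0 + F o1 + F o2.
Proof.
rewrite big_ord_recl big_ord_recl big_ord_recl big_ord0 addr0 addrA.
by congr (F _ + F _ + F _); apply: val_inj.
Qed.

Definition mx3 (R : Type) (a b c d e f g h i : R) : 'M[R]_3 :=
  \matrix_(r, s) nth a (nth [::] [:: [:: a; b; c]; [:: d; e; f]; [:: g; h; i]] r) s.

Lemma mx3_eta (R : Type) (A : 'M[R]_3) :
  A = mx3 (A o0 o0) (A o0 o1) (A o0 o2) (A o1 o0) (A o1 o1) (A o1 o2)
          (A o2 o0) (A o2 o1) (A o2 o2).
Proof. by apply/matrixP; do 2![apply: I3P]; rewrite mxE. Qed.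

Lemma mx3M (R : nzRingType) (a b c d e f g h i a' b' c' d' e' f' g' h' i' : R) :
  mx3 a b c d e f g h i * mx3 a' b' c' d' e' f' g' h' i' =
  mx3 (a * a' + b * d' + c * g') (a * b' + b * e' + c * h') (a * c' + b * f' + c * i')
      (d * a' + e * d' + f * g') (d * b' + e * e' + f * h') (d * c' + e * f' + f * i')
      (g * a' + h * d' + i * g') (g * b' + h * e' + i * h') (g * c' + h * f' + i * i').
Proof. by apply/matrixP; do 2![apply: I3P]; rewrite !mxE sum3 !mxE. Qed.

Lemma mx3D (R : nmodType) (a b c d e f g h i a' b' c' d' e' f' g' h' i' : R) :
  mx3 a b c d e f g h i + mx3 a' b' c' d' e' f' g' h' i' =
  mx3 (a + a') (b + b') (c + c') (d + d') (e + e') (f + f') (g + g') (h + h') (i + i').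
Proof. by apply/matrixP; do 2![apply: I3P]; rewrite !mxE. Qed.

Lemma mx3N (R : zmodType) (a b c d e f g h i : R) :
  - mx3 a b c d e f g h i = mx3 (-a) (-b) (-c) (-d) (-e) (-f) (-g) (-h) (-i).
Proof. by apply/matrixP; do 2![apply: I3P]; rewrite !mxE. Qed.

Lemma mx3Z (R : pzSemiRingType) (k a b c d e f g h i : R) :
  k *: mx3 a b c d e f g h i =
  mx3 (k * a) (k * b) (k * c) (k * d) (k * e) (k * f) (k * g) (k * h) (k * i).
Proof. by apply/matrixP; do 2![apply: I3P]; rewrite !mxE. Qed.

Lemma mx3_1 (R : pzSemiRingType) : 1%:M = mx3 1 0 0 0 1 0 0 0 1 :> 'M[R]_3.
Proof. by apply/matrixP; do 2![apply: I3P]; rewrite !mxE. Qed.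

Lemma det_mx3 (R : comPzRingType) (a b c d e f g h i : R) :
  \det (mx3 a b c d e f g h i) =
  a * (e * i - f * h) - b * (d * i - f * g) + c * (d * h - e * g).
Proof.
rewrite (expand_det_row _ o0) sum3 /cofactor !(expand_det_row _ ord0).
rewrite !big_ord_recl !big_ord0 /cofactor !det_mx11 !mxE /=.
rewrite !expr0 !expr1 ?expr2.
ring.
Qed.

Definition E (R : pzSemiRingType) (i j : 'I_3) (a : R) : 'M[R]_3 := 1%:M + a *: delta_mx i j.

Lemma mx3_delta (R : pzSemiRingType) (i j : 'I_3) :
  delta_mx i j = mx3 ((i == o0) && (j == o0))%:R ((i == o0) && (j == o1))%:R
    ((i == o0) && (j == o2))%:R ((i == o1) && (j == o0))%:R ((i == o1) && (j == o1))%:R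
    ((i == o1) && (j == o2))%:R ((i == o2) && (j == o0))%:R ((i == o2) && (j == o1))%:R
    ((i == o2) && (j == o2))%:R :> 'M[R]_3.
Proof.
by apply/matrixP; do 2![apply: I3P]; rewrite !mxE ![_ == i]eq_sym ![_ == j]eq_sym.
Qed.

Lemma E_mx3 (R : pzSemiRingType) (i j : 'I_3) (a : R) : i != j ->
  E i j a = let e k l := if (i == k) && (j == l) then a else 0 in
   mx3 1 (e o0 o1) (e o0 o2) (e o1 o0) 1 (e o1 o2) (e o2 o0) (e o2 o1) 1.
Proof.
rewrite /E mx3_1 mx3_delta mx3Z mx3D.
by move: i j; do 2![apply: I3P] => // _ /=; rewrite ?(mulr0, mulr1, add0r, addr0).
Qed.

Lemma det_E (R : comPzRingType) i j (a : R) : i != j -> \det (E i j a) = 1.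
Proof.
move=> ij; rewrite E_mx3 // det_mx3; move: i j ij.
by do 2![apply: I3P] => // _ /=; ring.
Qed.

(** * Torsion modulo the normal closure of elementary matrices *)

Lemma coprimezPn (m n : int) : n != 0 -> ~~ coprimez m n ->
  exists p : nat, [/\ prime p, (p %| m)%Z & (p %| n)%Z].
Proof.
move=> n0 ncop; set g := gcdn `|m| `|n|.
have g1 : (1 < g)%N.
  have : (0 < g)%N by rewrite gcdn_gt0 orbC absz_gt0 n0.
  have : g != 1%N by apply: contraNN ncop => /eqP gE; rewrite /coprimez /gcdz -/g gE.
  lia.
exists (pdiv g); rewrite pdiv_prime //; split=> //; rewrite dvdzE /=.
  exact: dvdn_trans (pdiv_dvd _) (dvdn_gcdl _ _).
exact: dvdn_trans (pdiv_dvd _) (dvdn_gcdr _ _).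
Qed.

(** Take k to be the part of [z] built from the primes that do not divide [y]. A prime factor of [z]
    that divides [y] divides neither k nor [x]; any other one divides k but not [y]. Either way it
    misses [y + k * x]. *)
Lemma coprimez_shift (x y z : int) : z != 0 ->
  (forall p : nat, prime p -> (p %| x)%Z -> (p %| y)%Z -> (p %| z)%Z -> false) ->
  exists k, coprimez (y + k * x) z.
Proof.
move=> z0 copr.
pose pi : nat_pred := [pred p : nat | ~~ (p %| y)%Z].
pose k := ((absz z)`_pi)%N.
have z0' : (0 < absz z)%N by rewrite absz_gt0.
exists k%:Z; apply/negPn/negP=> /(coprimezPn z0) [p [pp pyx pz]].
have pk : (p %| k)%N = ~~ (p %| y)%Z.
  have : (p \in primes k) = (p \in pi) && (p \in primes (absz z)).
    by rewrite primes_part mem_filter.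
  rewrite !mem_primes pp part_gt0 z0' /= => ->.
  by rewrite inE /= (_ : (p %| absz z)%N = true) ?andbT.
have [py|py] := boolP (p %| y)%Z.
  have : (p %| k%:Z * x)%Z by rewrite -(rpredDl _ py).
  rewrite dvdzE abszM /= Euclid_dvdM // => /orP[|px]; first by rewrite pk py.
  by have := copr p pp px py pz.
have kx : (p %| k%:Z * x)%Z by apply: dvdz_mulr; rewrite dvdzE /= pk.
by move: pyx; rewrite (rpredDr _ kx) (negPf py).
Qed.

Lemma mx3_eq (R : Type) (a b c d e f g h i a' b' c' d' e' f' g' h' i' : R) :
  a = a' -> b = b' -> c = c' -> d = d' -> e = e' -> f = f' -> g = g' -> h = h' -> i = i' ->
  mx3 a b c d e f g h i = mx3 a' b' c' d' e' f' g' h' i'.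
Proof. by do 9![move=> ->]. Qed.

Lemma mx3_1r (R : nzRingType) : 1 = mx3 1 0 0 0 1 0 0 0 1 :> 'M[R]_3.
Proof. exact: mx3_1. Qed.

Lemma EE (R : comNzRingType) i j (a b : R) : i != j -> E i j a * E i j b = E i j (a + b).
Proof.
move=> ij; rewrite /E -!mulmxE mulmxDl mul1mx mulmxDr mulmx1 -scalemxAl -scalemxAr.
by rewrite mul_delta_mx_0 1?eq_sym // !scaler0 addr0 scalerDl [_ *: _ + _ *: _]addrC addrA.
Qed.

Lemma E0 (R : comNzRingType) i j : E i j 0 = 1 :> 'M[R]_3.
Proof. by rewrite /E scale0r addr0. Qed.

Lemma mulr1_inv n (A B : 'M[int]_n.+1) : A * B = 1 -> A^-1 = B.
Proof.
move=> AB; have uA : A \is a GRing.unit by have [] := mulmx1_unit AB.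
by apply: (mulrI uA); rewrite AB mulrV.
Qed.

Lemma EV i j (a : int) : i != j -> (E i j a)^-1 = E i j (- a).
Proof. by move=> ij; apply: mulr1_inv; rewrite EE // subrr E0. Qed.

Definition cong (N : nat) (g : 'M[int]_3) := exists h, g = 1 + h *+ N.

Lemma congM N g h : cong N g -> cong N h -> cong N (g * h).
Proof.
move=> [a ->] [b ->]; exists (a + b + a * b *+ N).
by rewrite mulrDl mul1r mulrDr mulr1 !mulrnDl mulrnAl mulrnAr !addrA [1 + _ + _]addrAC.
Qed.

Lemma congJ N g h : g \is a GRing.unit -> cong N h -> cong N (g * h * g^-1).
Proof.
move=> ug [a ->]; exists (g * a * g^-1).
by rewrite mulrDr mulr1 mulrDl mulrV // mulrnAr mulrnAl.
Qed.

Lemma congV N g : g \is a GRing.unit -> cong N g -> cong N g^-1.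
Proof.
move=> ug [a gE]; exists (- (a * g^-1)).
have : g * g^-1 = 1 by rewrite mulrV.
by rewrite {1}gE mulrDl mul1r mulrnAl => <-; rewrite mulNrn addrK.
Qed.

Lemma expr_mod_coprime (a c : int) : a != 0 -> coprimez c a ->
  exists2 j, (0 < j)%N & exists q, c ^+ j = 1 + a * q.
Proof.
(* The factor 2 removes the sign of [c], since Euler's theorem is applied to its absolute value. *)
move=> a0 cop; exists (totient `|a| * 2)%N.
  by rewrite muln_gt0 totient_gt0 absz_gt0 a0.
have /eqP := Euler_exp_totient cop.
set n := totient _; move=> eqm.
have dv : (a %| (`|c| ^ n)%N%:Z - 1)%Z.
  have : ((`|c| ^ n)%N%:Z == 1 %[mod `|a|%N])%Z by rewrite !modz_nat (eqP eqm).
  by rewrite eqz_mod_dvd dvdzE /= -dvdzE.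
have cE : c ^+ (n * 2) = (`|c| ^ n)%N%:Z ^+ 2.
  by rewrite exprM -abszX abszE real_normK // num_real.
have /dvdzP[q qE] := dv; exists (q * (2 + q * a)).
have -> : c ^+ (n * 2) = (1 + q * a) ^+ 2 by rewrite cE -qE addrC subrK.
by ring.
Qed.

(** * Mennicke symbols modulo a normal subgroup *)

Section Mennicke.

Variables (G K : 'M[int]_3 -> Prop) (N : nat).
Hypothesis N1 : (1 < N)%N.
Hypothesis G_det : forall g, G g -> \det g = 1.
Hypothesis GM : forall g h, G g -> G h -> G (g * h).
Hypothesis GV : forall g, G g -> G g^-1.
Hypothesis GE1 : forall i j, i != j -> G (E i j 1).
Hypothesis KG : forall g, K g -> G g.
Hypothesis KM : forall g h, K g -> K h -> K (g * h).
Hypothesis KV : forall g, K g -> K g^-1.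
Hypothesis KJ : forall g k, G g -> K k -> K (g * k * g^-1).
Hypothesis KE1 : forall i j, i != j -> K (E i j N%:Z).

Lemma G_unit g : G g -> g \is a GRing.unit.
Proof. by move=> /G_det dg; rewrite unitmxE dg unitr1. Qed.

Lemma K1 : K 1.
Proof.
have k01 := @KE1 o0 o1 isT; have := KM k01 (KV k01).
by rewrite mulrV // G_unit //; apply: KG.
Qed.

Lemma pow_closed (H : 'M[int]_3 -> Prop) (g : 'M[int]_3) : H 1 ->
  (forall g h, H g -> H h -> H (g * h)) -> H g -> forall n, H (g ^+ n).
Proof. by move=> H1 HM Hg; elim=> [|n IH]; rewrite ?expr0 // exprS; apply: HM. Qed.

Lemma E_closed (H : 'M[int]_3 -> Prop) i j (a b : int) : i != j -> H 1 ->
  (forall g h, H g -> H h -> H (g * h)) -> (forall g, H g -> H g^-1) ->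
  H (E i j a) -> H (E i j (b * a)).
Proof.
move=> ij H1 HM HV Ha.
have Hn (n : nat) : H (E i j (n%:Z * a)).
  elim: n => [|n IH]; first by rewrite mul0r E0.
  by rewrite intS mulrDl mul1r -EE //; apply: HM.
case: b => n; first exact: Hn.
by rewrite NegzE mulNr -EV //; apply: HV; apply: Hn.
Qed.

Lemma KE i j (a : int) : i != j -> K (E i j (N%:Z * a)).
Proof. by move=> ij; rewrite mulrC; apply: E_closed => //; [exact: K1 | exact: KE1]. Qed.

Lemma KEd i j (a : int) : i != j -> (N %| a)%Z -> K (E i j a).
Proof. by move=> ij /dvdzP[q ->]; rewrite mulrC; apply: KE. Qed.

Lemma GE i j (a : int) : i != j -> G (E i j a).
Proof.
by move=> ij; rewrite -[a]mulr1; apply: E_closed => //; [exact: KG K1 | exact: GE1].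
Qed.

Lemma K_swap g k : G g -> K k -> exists2 k', K k' & k * g = g * k'.
Proof.
move=> Gg Kk; exists (g^-1 * k * g).
  by have := KJ (GV Gg) Kk; rewrite invrK.
by rewrite !mulrA divrr ?mul1r // G_unit.
Qed.

Hypothesis Kc : forall g, K g -> cong N g.

Definition blk (a b c d : int) := mx3 a b 0 c d 0 0 0 1.

Definition red g := exists2 k, K k & exists a b c d, g * k = blk a b c d.

Lemma red_step g k : K k -> red (g * k) -> red g.
Proof.
move=> Kk [k' Kk' [a [b [c [d gE]]]]]; exists (k * k'); first exact: KM.
by exists a, b, c, d; rewrite mulrA.
Qed.

Lemma cong_entries g : cong N g -> exists h : 'M[int]_3, forall i j,
  g i j = (i == j)%:R + N%:Z * h i j.
Proof.
by move=> [h ->]; exists h => i j; rewrite !mxE mulmxnE -[N%:Z]natz mulr_natl.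
Qed.

Lemma red_row g : G g -> cong N g ->
  g o2 o0 = 0 -> g o2 o1 = 0 -> g o2 o2 = 1 -> red g.
Proof.
move=> Gg /cong_entries[h hE] g20 g21 g22; have /G_det := Gg.
have := hE o0 o2; have := hE o1 o2; move: g20 g21 g22; rewrite [g]mx3_eta.
rewrite !mxE /=; move: (g o0 o0) (g o0 o1) (g o1 o0) (g o1 o1) => a b c d.
move: (h o0 o2) (h o1 o2) => u v -> -> -> -> ->; rewrite det_mx3 !add0r => dg.
(* The coefficients are minus the adjugate of the upper left block applied to the upper part of the
   last column, whose entries are [N] times [u] and [v]. *)
exists (E o0 o2 (N%:Z * (b * v - d * u)) * E o1 o2 (N%:Z * (c * u - a * v))).
  by apply: KM; apply: KE.
exists a, b, c, d; rewrite !E_mx3 //= !mx3M /blk.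
have dg' : a * d - b * c = 1 by move: dg; lia.
apply: mx3_eq; try ring.
  transitivity (N%:Z * u * (1 - (a * d - b * c))); first by ring.
  by rewrite dg' subrr mulr0.
transitivity (N%:Z * v * (1 - (a * d - b * c))); first by ring.
by rewrite dg' subrr mulr0.
Qed.

Lemma red_N g : G g -> cong N g -> g o2 o0 = N%:Z -> red g.
Proof.
move=> Gg cg g20; have [h hE] := cong_entries cg.
pose z1 := h o2 o2; pose y1 := h o2 o1.
(* Subtracting [z1] times column 0 from column 2 makes the corner 1, which then clears the bottom
   row. As [z1] need not be a multiple of [N], this operation is undone at the end, so that [k] is a
   conjugate of an element of [K]. *)
pose k := E o0 o2 (- z1) * (E o2 o0 (N%:Z * -1) * E o2 o1 (N%:Z * - y1)) * E o0 o2 z1.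
have Kk : K k.
  have zE : (E o0 o2 (- z1))^-1 = E o0 o2 z1 by rewrite EV // opprK.
  rewrite /k -zE; apply: KJ; first exact: GE.
  by apply: KM; apply: KE.
apply: (red_step Kk); apply: red_row.
- by apply: GM => //; apply: KG.
- by apply: congM => //; apply: Kc.
all: rewrite [g]mx3_eta /k !E_mx3 //= !mx3M !mxE /= g20 (hE o2 o1) (hE o2 o2) -/z1 -/y1 /=; ring.
Qed.

Lemma red_coprime g : G g -> cong N g -> coprimez (g o2 o1) (g o2 o2) -> red g.
Proof.
move=> Gg cg /coprimezP[[s t] /= st]; have [h hE] := cong_entries cg.
(* The Bezout coefficients, scaled by [j], change the bottom left entry from [N * h o2 o0] to
   [N]. *)
pose j := 1 - h o2 o0.
pose k := E o1 o0 (N%:Z * (j * s)) * E o2 o0 (N%:Z * (j * t)).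
have Kk : K k by apply: KM; apply: KE.
apply: (red_step Kk); apply: red_N.
- by apply: GM => //; apply: KG.
- by apply: congM => //; apply: Kc.
rewrite [g]mx3_eta /k !E_mx3 //= !mx3M !mxE /=.
transitivity (g o2 o0 + N%:Z * j * (s * g o2 o1 + t * g o2 o2)); first by ring.
rewrite st (hE o2 o0) /= /j; ring.
Qed.

Lemma cong_red g : G g -> cong N g -> red g.
Proof.
move=> Gg cg; have [h hE] := cong_entries cg.
have z0 : g o2 o2 != 0.
  rewrite hE eqxx mulr1n; move: (h o2 o2) => y; apply/eqP => y0.
  have : N%:Z * y = -1 by lia.
  have [y0'|y0'] : 0 <= y \/ y + 1 <= 0 by lia.
    by nia.
  by nia.
have dg := G_det Gg; rewrite [g]mx3_eta det_mx3 in dg.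
(* The bottom row is unimodular, and its last entry is 1 modulo [N], hence prime to [N]. *)
have [] := @coprimez_shift (N%:Z * g o2 o0) (g o2 o1) (g o2 o2) z0.
  move=> p pp; rewrite dvdzE abszM /= Euclid_dvdM // => /orP[pN|px] py pz.
    have : (p %| (1 : int))%Z.
      have -> : 1 = g o2 o2 - N%:Z * h o2 o2 by rewrite hE /=; ring.
      by rewrite rpredB //; apply: dvdz_mulr; rewrite dvdzE.
    by rewrite dvdzE /= dvdn1 => /eqP p1; rewrite p1 in pp.
  have : (p %| (1 : int))%Z.
    rewrite -dg; set a := g o0 o0 * _.
    have -> : a - g o0 o1 * (g o1 o0 * g o2 o2 - g o1 o2 * g o2 o0) +
        g o0 o2 * (g o1 o0 * g o2 o1 - g o1 o1 * g o2 o0) =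
      g o2 o0 * (g o0 o1 * g o1 o2 - g o0 o2 * g o1 o1) +
      g o2 o1 * (g o0 o2 * g o1 o0 - g o0 o0 * g o1 o2) +
      g o2 o2 * (g o0 o0 * g o1 o1 - g o0 o1 * g o1 o0) by rewrite /a; ring.
    by rewrite !rpredD //; apply: dvdz_mulr; rewrite ?dvdzE.
  by rewrite dvdzE /= dvdn1 => /eqP p1; rewrite p1 in pp.
move=> k ck; have Kk : K (E o0 o1 (N%:Z * k)) by apply: KE.
apply: (red_step Kk); apply: red_coprime.
- by apply: GM => //; apply: KG.
- by apply: congM => //; apply: Kc.
rewrite (_ : (g * _) o2 o1 = g o2 o1 + k * (N%:Z * g o2 o0)); last first.
  by rewrite [g]mx3_eta !E_mx3 //= !mx3M !mxE /=; ring.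
rewrite (_ : (g * _) o2 o2 = g o2 o2) //.
by rewrite [g]mx3_eta !E_mx3 //= !mx3M !mxE /=; ring.
Qed.

Definition cent (a h : 'M[int]_3) := exists2 k, K k & a * h = h * a * k.

Lemma centM a h1 h2 : G h1 -> G h2 -> cent a h1 -> cent a h2 -> cent a (h1 * h2).
Proof.
move=> G1 G2 [k1 Kk1 e1] [k2 Kk2 e2].
have [k1' Kk1' e1'] := K_swap G2 Kk1.
exists (k2 * k1'); first exact: KM.
by rewrite mulrA e1 -[_ * k1 * _]mulrA e1' !mulrA -(mulrA h1) e2 !mulrA.
Qed.

Lemma centV a h : G h -> cent a h -> cent a h^-1.
Proof.
move=> Gh [k Kk e]; have uh := G_unit Gh.
have [k' Kk' e'] := K_swap (GV Gh) Kk.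
exists k'^-1; first exact: KV.
have uk' := G_unit (KG Kk').
apply: (mulIr uk'); rewrite mulrVK // -[_ * k']mulrA -e'.
by apply: (mulIr uh); rewrite -!mulrA mulVr // mulr1 e mulrA mulKr.
Qed.

Lemma blk_entries a b c d : G (blk a b c d) -> cong N (blk a b c d) ->
  a * d - b * c = 1 /\ exists a1 b1 c1 d1, [/\ a = 1 + N%:Z * a1, b = N%:Z * b1,
    c = N%:Z * c1 & d = 1 + N%:Z * d1].
Proof.
move=> /G_det dg /cong_entries[h hE]; split.
  by move: dg; rewrite det_mx3; lia.
exists (h o0 o0), (h o0 o1), (h o1 o0), (h o1 o1).
have := (hE o0 o0, hE o0 o1, (hE o1 o0, hE o1 o1)); rewrite !mxE /=.
by move=> [[-> ->] [-> ->]]; rewrite !add0r.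
Qed.

(** For the four elementary matrices outside the block the commutator with the block is an explicit
    element of [K]; the two inside are commutators of these. The quantification over [H] expresses
    that [h] is generated by elementary matrices. *)
Lemma blk_cent a b c d h : G (blk a b c d) -> cong N (blk a b c d) ->
  (forall H : 'M[int]_3 -> Prop, (forall x y, G x -> G y -> H x -> H y -> H (x * y)) ->
    (forall x, G x -> H x -> H x^-1) -> (forall i j, i != j -> H (E i j 1)) -> H h) ->
  cent (blk a b c d) h.
Proof.
move=> Gg cg; have [dg [a1 [b1 [c1 [d1 [aE bE cE dE]]]]]] := blk_entries Gg cg.
apply; [by move=> x y; apply: centM | by move=> x; apply: centV |].
rewrite {Gg cg}aE {}bE {}cE {}dE in dg *; set ab := blk _ _ _ _.
have c02 : cent ab (E o0 o2 1).
  exists (E o0 o2 (N%:Z * - d1) * E o1 o2 (N%:Z * c1)); first by apply: KM; apply: KE.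
  by rewrite /ab /blk !E_mx3 //= !mx3M; apply: mx3_eq; lia.
have c12 : cent ab (E o1 o2 1).
  exists (E o0 o2 (N%:Z * b1) * E o1 o2 (N%:Z * - a1)); first by apply: KM; apply: KE.
  by rewrite /ab /blk !E_mx3 //= !mx3M; apply: mx3_eq; lia.
have c20 : cent ab (E o2 o0 1).
  exists (E o2 o0 (N%:Z * - a1) * E o2 o1 (N%:Z * - b1)); first by apply: KM; apply: KE.
  by rewrite /ab /blk !E_mx3 //= !mx3M; apply: mx3_eq; lia.
have c21 : cent ab (E o2 o1 1).
  exists (E o2 o0 (N%:Z * - c1) * E o2 o1 (N%:Z * - d1)); first by apply: KM; apply: KE.
  by rewrite /ab /blk !E_mx3 //= !mx3M; apply: mx3_eq; lia.
have cm i j : cent ab (E i j 1) -> i != j -> cent ab (E i j (-1)).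
  by move=> cE ij; rewrite -EV //; apply: centV => //; apply: GE.
have c01 : cent ab (E o0 o1 1).
  rewrite (_ : E o0 o1 1 = E o0 o2 1 * E o2 o1 1 * (E o0 o2 (-1) * E o2 o1 (-1))).
    by apply: centM; [apply: GM | apply: GM | apply: centM | apply: centM];
       try apply: GE; try apply: cm.
  by rewrite !E_mx3 //= !mx3M; apply: mx3_eq; ring.
have c10 : cent ab (E o1 o0 1).
  rewrite (_ : E o1 o0 1 = E o1 o2 1 * E o2 o0 1 * (E o1 o2 (-1) * E o2 o0 (-1))).
    by apply: centM; [apply: GM | apply: GM | apply: centM | apply: centM];
       try apply: GE; try apply: cm.
  by rewrite !E_mx3 //= !mx3M; apply: mx3_eq; ring.
by do 2![apply: I3P].
Qed.

(** A representative of a Weyl reflection: it exchanges the coordinates i and j up to a sign. *)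
Definition rot (i j : 'I_3) : 'M[int]_3 := E i j 1 * E j i (-1) * E i j 1.

Lemma G_rot i j : i != j -> G (rot i j).
Proof. by move=> ij; apply: GM; [apply: GM|]; apply: GE => //; rewrite eq_sym. Qed.

Lemma blk_cent_rot a b c d i j : G (blk a b c d) -> cong N (blk a b c d) ->
  i != j -> cent (blk a b c d) (rot i j).
Proof.
move=> Gg cg ij; apply: blk_cent => // H HM HV HE; have ji : j != i by rewrite eq_sym.
rewrite /rot -[E j i _]EV //.
apply: (HM); [by apply: GM; [|apply: GV]; apply: GE | exact: GE | | exact: HE].
apply: (HM); [exact: GE | by apply: GV; apply: GE | exact: HE |].
by apply: HV; [apply: GE | apply: HE].
Qed.

Lemma blk_dvd a b c d : G (blk a b c d) -> cong N (blk a b c d) ->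
  [/\ a * d - b * c = 1, (N %| b)%Z & (N %| c)%Z].
Proof.
move=> Gg cg; have [dg [a1 [b1 [c1 [d1 [_ bE cE _]]]]]] := blk_entries Gg cg.
by split=> //; rewrite ?bE ?cE; apply: dvdz_mulr.
Qed.

(* Multiplicativity of Mennicke symbols. Conjugating the second block into rows and
   columns 0 and 2, its quotient by the first one is, up to elementary factors,
   a block in rows and columns 1 and 2. *)
Lemma blk_mul a b c d b' c' d' :
  G (blk a b c d) -> cong N (blk a b c d) ->
  G (blk a b' c' d') -> cong N (blk a b' c' d') ->
  exists k d'', [/\ K k, G (blk a (- c * b') (b * c') d''),
    cong N (blk a (- c * b') (b * c') d'')
  & blk a b c d * blk a (- c * b') (b * c') d'' = blk a b' c' d' * k].
Proof.
move=> Gg cg Gg' cg'.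
have [dg bN cN] := blk_dvd Gg cg; have [dg' bN' cN'] := blk_dvd Gg' cg'.
pose d'' := d' - d * b' * c'.
pose g'' := mx3 1 0 0 0 a (- c * b') 0 (b * c') d''.
pose ga := blk a (- c * b') (b * c') d''.
pose g13 := mx3 a 0 b' 0 1 0 c' 0 d'.
have ij12 : o1 != o2 by []. have ij01 : o0 != o1 by [].
have [k1 Kk1 rhoE] := blk_cent_rot Gg' cg' ij12.
have g13E : g13 = blk a b' c' d' * k1.
  apply: (mulrI (G_unit (G_rot ij12))); rewrite mulrA -rhoE.
  by rewrite /g13 /blk /rot !E_mx3 //= !mx3M; apply: mx3_eq; ring.
pose k2 := E o1 o0 c * (E o0 o1 b * E o0 o2 (- d * b')) *
  (E o1 o0 (- c * b' * c') * E o2 o0 (- a * c')).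
have Kk2 : K k2.
  by rewrite /k2; apply: KM; [apply: KM|]; [|apply: KM|apply: KM]; apply: KEd => //;
    apply: dvdz_mull.
have g13k2 : g13 * k2 = blk a b c d * g''.
  rewrite /g13 /k2 /blk /g'' /d'' !E_mx3 //= !mx3M.
  have e1 : a * d - b * c - 1 = 0 by rewrite dg subrr.
  have e2 : a * d' - b' * c' - 1 = 0 by rewrite dg' subrr.
  apply: mx3_eq; apply/eqP; rewrite -subr_eq0; apply/eqP.
  - by transitivity (a * c' * b' * (a * d - b * c - 1)); [ring | rewrite e1 mulr0].
  - by ring.
  - by transitivity (- b' * (a * d - b * c - 1)); [ring | rewrite e1 mulr0].
  - by transitivity (c * b' * c' * (a * d - b * c - 1)); [ring | rewrite e1 mulr0].
  - by transitivity (- (a * d - b * c - 1)); [ring | rewrite e1 oppr0].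
  - by ring.
  - transitivity (c' * b' * c' * (a * d - b * c - 1) - c' * (a * d' - b' * c' - 1)).
      by ring.
    by rewrite e1 e2 !mulr0 subr0.
  - by ring.
  - by ring.
have g''E : g'' = (blk a b c d)^-1 * (blk a b' c' d' * k1 * k2).
  by rewrite -g13E g13k2 mulKr // G_unit.
have Gg'' : G g'' by rewrite g''E; apply: GM; [apply: GV | apply: GM; [apply: GM|]];
  rewrite // ; apply: KG.
have cg'' : cong N g''.
  rewrite g''E; apply: congM; first by apply: congV => //; apply: G_unit.
  by apply: congM; [apply: congM => // |]; apply: Kc.
pose C := rot o1 o2 * rot o0 o1.
have GC : G C by apply: GM; apply: G_rot.
have gaC : ga * C = C * g''.
  by rewrite /ga /C /g'' /blk /rot !E_mx3 //= !mx3M; apply: mx3_eq; ring.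
have gaE : ga = C * g'' * C^-1 by rewrite -gaC mulrK // G_unit.
have Gga : G ga by rewrite gaE; apply: GM; [apply: GM|apply: GV].
have cga : cong N ga by rewrite gaE; apply: congJ => //; apply: G_unit.
have [k4 Kk4] : cent ga C by apply: centM; try apply: G_rot => //; apply: blk_cent_rot.
rewrite gaC -mulrA => /(mulrI (G_unit GC)) g''ga.
exists (k1 * k2 * k4^-1), d''; split=> //; first by apply: KM; [apply: KM | apply: KV].
apply: (mulIr (G_unit (KG Kk4))).
rewrite -[LHS]mulrA -/ga -g''ga -g13k2 g13E -[RHS]mulrA mulrVK ?mulrA //.
by apply: G_unit; apply: KG.
Qed.

(** Modulo [a], the inverse of [b] is [- c]. So [blk_mul] divides the upper right entry by [b] at
    the cost of one factor [blk a b c d], and iterating trades [j] such factors for [(- c) ^+ j]. *)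
Lemma blk_iter a b c d j : G (blk a b c d) -> cong N (blk a b c d) ->
  exists k c' d', [/\ K k, G (blk a ((- c) ^+ j * b) c' d'),
    cong N (blk a ((- c) ^+ j * b) c' d')
  & (blk a b c d) ^+ j * blk a ((- c) ^+ j * b) c' d' = blk a b c d * k].
Proof.
move=> Gg cg; elim: j => [|j [k [c' [d' [Kk Gj cj jE]]]]].
  by exists 1, c, d; rewrite expr0 !mul1r mulr1; split=> //; apply: K1.
have [k' [d'' [Kk' Gj' cj' jE']]] := blk_mul Gg cg Gj cj.
exists (k * k'), (b * c'), d''; rewrite exprS -[_ * _ * b]mulrA; split=> //; first exact: KM.
by rewrite exprSr -mulrA jE' mulrA jE mulrA.
Qed.

(** Once [(- c) ^+ j] is 1 modulo [a], the block produced by [blk_iter] has the same [a] and an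
    upper right entry congruent to [b] modulo [a]. It differs from the original block by elementary
    factors in [K], so the two cancel and leave the power [j] of the block in [K]. *)
Lemma blk_torsion a b c d : G (blk a b c d) -> cong N (blk a b c d) ->
  exists2 j, (0 < j)%N & K (blk a b c d ^+ j).
Proof.
move=> Gg cg; have [dg bN cN] := blk_dvd Gg cg.
have a0 : a != 0.
  apply/eqP => a0; have : (N %| (1 : int))%Z.
    by rewrite -dg a0 mul0r sub0r rpredN; apply: dvdz_mulr.
  by rewrite dvdzE dvdn1 /=; lia.
have [j j0 [q jE]] : exists2 j, (0 < j)%N & exists q, (- c) ^+ j = 1 + a * q.
  apply: expr_mod_coprime => //; apply/coprimezP; exists (b, d) => /=.
  by rewrite -dg; ring.
have [k [c' [d' [Kk Gj cj]]]] := blk_iter j Gg cg.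
rewrite jE (_ : (1 + a * q) * b = b + a * (q * b)); last by ring.
move=> jE'; exists j => //.
have [dg' _ cN'] := blk_dvd Gj cj.
rewrite jE (_ : (1 + a * q) * b = b + a * (q * b)) in dg'; last by ring.
have gE : blk a (b + a * (q * b)) c' d' =
    E o1 o0 (c' * (d + c * (q * b)) - d' * c) * (blk a b c d * E o0 o1 (q * b)).
  have e1 : a * (d + c * (q * b)) - (b + a * (q * b)) * c - 1 = 0.
    by rewrite -dg; ring.
  have e2 : a * d' - (b + a * (q * b)) * c' - 1 = 0 by rewrite dg' subrr.
  rewrite /blk !E_mx3 //= !mx3M; apply: mx3_eq; apply/eqP; rewrite -subr_eq0; apply/eqP.
  - by ring.
  - by ring.
  - by ring.
  - transitivity (- c' * (a * (d + c * (q * b)) - (b + a * (q * b)) * c - 1) +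
      c * (a * d' - (b + a * (q * b)) * c' - 1)); first by ring.
    by rewrite e1 e2 !mulr0 addr0.
  - transitivity (- d' * (a * (d + c * (q * b)) - (b + a * (q * b)) * c - 1) +
      (d + c * (q * b)) * (a * d' - (b + a * (q * b)) * c' - 1)); first by ring.
    by rewrite e1 e2 !mulr0 addr0.
  - by ring.
  - by ring.
  - by ring.
  - by ring.
have Kt : K (E o1 o0 (c' * (d + c * (q * b)) - d' * c)).
  by apply: KEd => //; rewrite rpredB //; [apply: dvdz_mulr | apply: dvdz_mull].
have Kq : K (E o0 o1 (q * b)) by apply: KEd => //; apply: dvdz_mull.
have [t Kt' tE] := K_swap Gg Kt.
move: jE'; rewrite gE (mulrA (E o1 o0 _)) tE -(mulrA _ t); set u := t * _; move=> jE'.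
have Ku : K u by apply: KM.
have ub := G_unit Gg; have uu := G_unit (KG Ku).
suff -> : blk a b c d ^+ j = k * u^-1 by apply: KM => //; apply: KV.
apply: (mulIr uu); rewrite mulrVK //; apply: (mulrI ub).
by rewrite -jE' !mulrA -exprS -exprSr.
Qed.

Lemma cong_torsion g : G g -> cong N g -> exists2 j, (0 < j)%N & K (g ^+ j).
Proof.
move=> Gg cg; have [k Kk [a [b [c [d gkE]]]]] := cong_red Gg cg.
have Gb : G (blk a b c d) by rewrite -gkE; apply: GM => //; apply: KG.
have cb : cong N (blk a b c d) by rewrite -gkE; apply: congM => //; apply: Kc.
have [j j0 Kj] := blk_torsion Gb cb; exists j => //.
have gE : g = blk a b c d * k^-1 by rewrite -gkE mulrK // G_unit //; apply: KG.
have [k' Kk' ->] : exists2 k', K k' & g ^+ j = blk a b c d ^+ j * k'.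
  elim: (j) => [|m [k' Kk' mE]]; first by exists 1; [exact: K1 | rewrite mulr1].
  have [t Kt tE] : exists2 t, K t & k^-1 * blk a b c d ^+ m = blk a b c d ^+ m * t.
    apply: K_swap; last exact: KV.
    by apply: (@pow_closed G) => //; apply: KG; apply: K1.
  exists (t * k'); first exact: KM.
  by rewrite exprS mE [in LHS]gE !mulrA -(mulrA _ k^-1) tE exprS !mulrA.
exact: KM.
Qed.
End Mennicke.

Lemma intr_Zp_eq0 (N : nat) (x : int) : (1 < N)%N -> x%:~R = 0 :> 'Z_N -> (N %| x)%Z.
Proof.
move=> N1; rewrite {1}(divz_eq x N) rmorphD rmorphM /=.
have -> : N%:Z%:~R = 0 :> 'Z_N by rewrite -pmulrn; apply/val_inj; rewrite /= val_Zp_nat // modnn.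
rewrite mulr0 add0r => x0; apply/dvdzP; exists (x %/ N)%Z.
have [r rE] : exists r : nat, (x %% N)%Z = r.
  by exists `|(x %% N)%Z|%N; rewrite gez0_abs // modz_ge0 //; lia.
have rN : (r < N)%N by rewrite -ltz_nat -rE; apply: ltz_pmod; lia.
rewrite {1}(divz_eq x N) rE; move: x0; rewrite rE -pmulrn => /(congr1 val) /=.
by rewrite val_Zp_nat // modn_small // => ->; rewrite addr0.
Qed.

Lemma pow_cong (N : nat) (g : 'M[int]_3) : (1 < N)%N -> g \is a GRing.unit ->
  exists2 m, (0 < m)%N & cong N (g ^+ m).
Proof.
move=> N1 ug; pose red (A : 'M[int]_3) : 'M['Z_N]_3 := map_mx (intr : int -> 'Z_N) A.
pose f (i : 'I_(#|{: 'M['Z_N]_3}|.+1)) := red g ^+ i.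
have /injectivePn[i [j ij fij]] : ~~ injectiveb f.
  by apply/injectiveP => /leq_card; rewrite card_ord ltnn.
wlog ltij : i j ij fij / (i < j)%N.
  move=> W; have [|ji|/val_inj e] := ltngtP i j; first exact: W.
    by apply: (W j i) => //; rewrite eq_sym.
  by rewrite e eqxx in ij.
exists (j - i)%N; first by rewrite subn_gt0.
have ur : red g \is a GRing.unit by apply: rmorph_unit.
have /matrixP r1 : red (g ^+ (j - i)) = 1.
  rewrite /red rmorphXn; apply: (mulIr (unitrX i ur)).
  by rewrite mul1r -exprD subnK 1?ltnW // -fij.
exists (\matrix_(k, l) (((g ^+ (j - i) - 1) k l) %/ N)%Z).
apply/matrixP => k l; rewrite [RHS]mxE mulmxnE [in X in _ = _ + X]mxE -mulr_natr natz divzK.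
  by rewrite !mxE addrCA subrr addr0.
apply: intr_Zp_eq0 => //; have := r1 k l; rewrite !mxE rmorphB /= => ->.
by rewrite rmorph_nat subrr.
Qed.

(** Reduction modulo [N] has finite image, so a power of [g] is congruent to 1. Intersecting [K]
    with the congruence subgroup supplies the congruence condition under which the Mennicke symbols
    were treated. *)
Lemma normal_torsion (G K : 'M[int]_3 -> Prop) (N : nat) :
  (1 < N)%N ->
  (forall g, G g -> \det g = 1) ->
  (forall g h, G g -> G h -> G (g * h)) ->
  (forall g, G g -> G g^-1) ->
  (forall i j, i != j -> G (E i j 1)) ->
  (forall g, K g -> G g) ->
  (forall g h, K g -> K h -> K (g * h)) ->
  (forall g, K g -> K g^-1) ->
  (forall g k, G g -> K k -> K (g * k * g^-1)) ->
  (forall i j, i != j -> K (E i j N%:Z)) ->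
  forall g, G g -> exists2 m, (0 < m)%N & K (g ^+ m).
Proof.
move=> N1 G_det GM GV GE1 KG KM KV KJ KE1 g Gg.
have G_unit h : G h -> h \is a GRing.unit by move=> /G_det dg; rewrite unitmxE dg unitr1.
have [m m0 cm] := pow_cong N1 (G_unit g Gg).
have G1 : G 1.
  by rewrite -(mulrV (G_unit _ Gg)); apply: GM => //; apply: GV.
have Gm : G (g ^+ m) by elim: (m) => [|n IH]; rewrite ?expr0 // exprS; apply: GM.
have [||||||j j0 [Kj _]] := @cong_torsion G (fun k => K k /\ cong N k) N N1 G_det GM GV GE1 _ _ _ _ _ _ _ Gm cm.
- by move=> h [/KG].
- by move=> h k [Kh ch] [Kk ck]; split; [apply: KM | apply: congM].
- by move=> h [Kh ch]; split; [apply: KV | apply: congV => //; apply/G_unit/KG].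
- by move=> h k Gh [Kk ck]; split; [apply: KJ | apply: congJ => //; apply: G_unit].
- move=> i l il; split; first exact: KE1.
  by exists (delta_mx i l); rewrite /E -scaler_nat natz.
- by move=> k [].
by exists (m * j)%N; rewrite ?muln_gt0 ?m0 // exprM.
Qed.

(** * Unipotent matrices and their logarithms *)

Lemma irreducible_factor (F : fieldType) (p : {poly F}) : (1 < size p)%N ->
  exists2 q, irreducible_poly q & q %| p.
Proof.
have [n] := ubnP (size p); elim: n => // n IH in p *; rewrite ltnS => pn p1.
have [irr|nirr] := classic (irreducible_poly p); first by exists p.
have [q [q1 qp nqp]] : exists q : {poly F}, [/\ size q != 1, q %| p & ~~ (q %= p)].
  apply: NNPP => no; apply: nirr; split=> // q q1 qp; apply: contraT => nqp.
  by case: no; exists q.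
have p0 : p != 0 by rewrite -size_poly_gt0; lia.
have q0 : q != 0 by apply: contraNneq p0 => q0; rewrite q0 dvd0p in qp.
have sqp : (size q < size p)%N.
  rewrite ltn_neqAle dvdp_leq // andbT; apply: contra nqp => /eqP e.
  by rewrite -dvdp_size_eqp // e.
have [||r irr rq] := IH q; first exact: leq_trans sqp pn.
  by move: q0; rewrite -size_poly_gt0; lia.
by exists r => //; apply: dvdp_trans rq qp.
Qed.

Lemma root_extension (F : fieldType) (p : {poly F}) : (1 < size p)%N ->
  exists (L : fieldType) (iota : {rmorphism F -> L}) (z : L), root (map_poly iota p) z.
Proof.
move=> /irreducible_factor[q irr qp]; have [L _ [z rz _]] := irredp_FAdjoin irr.
exists L, (in_alg L), z; have /dvdpP[r ->] := qp.
by rewrite rmorphM /= rootM rz orbT.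
Qed.

Lemma split_extension (F : fieldType) (p : {poly F}) : p != 0 ->
  exists (L : fieldType) (iota : {rmorphism F -> L}) (rs : seq L) (c : L),
    map_poly iota p = c *: \prod_(z <- rs) ('X - z%:P).
Proof.
have [n] := ubnP (size p); elim: n => // n IH in F p *; rewrite ltnS => pn p0.
have [p1|p1] := leqP (size p) 1.
  exists F, idfun, [::], p`_0; rewrite big_nil -mul_polyC mulr1 map_poly_id //.
  by apply/size1_polyC.
have [L [iota [z]]] := root_extension p1; rewrite root_factor_theorem => /dvdpP[q pq].
have ip0 : map_poly iota p != 0 by rewrite map_poly_eq0.
have q0 : q != 0 by apply: contraNneq ip0 => q0; rewrite pq q0 mul0r.
have sq : (size q < n)%N.
  apply: leq_trans pn; rewrite -(size_map_poly iota p) pq size_Mmonic ?monicXsubC //.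
  by rewrite size_XsubC addn2.
have [L' [iota' [rs [c qE]]]] := IH _ _ sq q0.
exists L', (iota' \o iota), (iota' z :: rs), c.
rewrite map_poly_comp pq rmorphM /= qE big_cons rmorphB /= map_polyX map_polyC /=.
by rewrite mulrC scalerAr.
Qed.

(* A and B act on the z-eigenspace of C, where AB = z BA; compare determinants. *)
Lemma heisenberg_eigenvalue (F : fieldType) n (A B C : 'M[F]_n.+1) (z : F) :
  A \in unitmx -> B \in unitmx -> A * C = C * A -> B * C = C * B -> A * B = C * B * A ->
  eigenvalue C z -> z ^+ (n.+2)`! = 1.
Proof.
move=> uA uB AC BC AB; rewrite /eigenvalue; set V := eigenspace C z => V0.
have [R Rfree RV] : exists2 R : 'M_(\rank V, n.+1), row_free R & (R :=: V)%MS.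
  by exists (row_base V); [exact: row_base_free | exact: eq_row_base].
have RC : R *m C = z *: R.
  by apply/eigenspaceP; rewrite RV submx_refl.
have restr (X : 'M[F]_n.+1) : X \in unitmx -> X * C = C * X ->
    exists2 X' : 'M[F]_(\rank V), X' \in unitmx & R *m X = X' *m R.
  move=> uX XC; have RX : (R *m X <= R)%MS.
    rewrite RV; apply/eigenspaceP; rewrite -mulmxA -[X *m C]/(X * C) XC mulmxA RC.
    by rewrite scalemxAl.
  exists (R *m X *m pinvmx R); last by rewrite mulmxKpV.
  rewrite -row_free_unit /row_free -(mxrankMfree _ Rfree) mulmxKpV //.
  by rewrite mxrankMfree ?row_free_unit // (eqP Rfree).
have [A' uA' RA] := restr A uA AC; have [B' uB' RB] := restr B uB BC.
have AB' : A' *m B' = z *: (B' *m A').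
  apply: (row_free_inj Rfree); rewrite -mulmxA -RB mulmxA -RA -mulmxA.
  rewrite -[A *m B]/(A * B) AB -mulmxE !mulmxA RC -!scalemxAl; congr (_ *: _).
  by rewrite RB -mulmxA RA mulmxA.
have zr : z ^+ (\rank V) = 1.
  have := congr1 determinant AB'; rewrite detZ !det_mulmx [\det B' * _]mulrC.
  rewrite -[LHS]mul1r => /mulIf -> //.
  by rewrite mulf_neq0 // -unitfE -unitmxE.
have /dvdnP[k ->] : (\rank V %| n.+2`!)%N.
  by apply: dvdn_fact; rewrite lt0n mxrank_eq0 V0 (leq_trans (rank_leq_row V)).
by rewrite mulnC exprM zr expr1n.
Qed.

(** Over a splitting field every eigenvalue of [C] is a root of [X^M - 1] with [M = (n.+2)!], so the
    characteristic polynomial divides a power of it and Cayley-Hamilton applies. *)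
Lemma heisenberg_unipotent (F : fieldType) n (A B C : 'M[F]_n.+1) :
  A \in unitmx -> B \in unitmx -> A * C = C * A -> B * C = C * B -> A * B = C * B * A ->
  (C ^+ (n.+2)`! - 1) ^+ n.+1 = 0.
Proof.
move=> uA uB AC BC AB; have p0 : char_poly C != 0 by apply/monic_neq0/char_poly_monic.
have [L [iota [rs [c rsE]]]] := split_extension p0.
pose f (X : 'M[F]_n.+1) : 'M[L]_n.+1 := map_mx iota X.
have fM X Y : f (X * Y) = f X * f Y by rewrite /f rmorphM.
have c0 : c != 0.
  by apply: contraNneq p0 => c0; rewrite -(map_poly_eq0 iota) rsE c0 scale0r.
have rootsE z : z \in rs -> z ^+ (n.+2)`! = 1.
  move=> zrs; apply: (@heisenberg_eigenvalue _ _ (f A) (f B) (f C)).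
  - by rewrite map_unitmx.
  - by rewrite map_unitmx.
  - by rewrite -!fM AC.
  - by rewrite -!fM BC.
  - by rewrite -!fM AB.
  by rewrite eigenvalue_root_char -map_char_poly rsE rootZ // root_prod_XsubC.
pose M := (n.+2)`!; pose q : {poly L} := 'X^M - 1.
have dvq : \prod_(z <- rs) ('X - z%:P) %| q ^+ (size rs).
  elim: rs rootsE {rsE} => [|z rs IH] rootsE; first by rewrite big_nil dvd1p.
  rewrite big_cons exprS dvdp_mul //; last by apply: IH => y yrs; apply: rootsE; rewrite inE yrs orbT.
  by rewrite dvdp_XsubCl /root /q !hornerE rootsE ?subrr ?eqxx // mem_head.
have srs : size rs = n.+1.
  apply: succn_inj; rewrite -(size_prod_XsubC rs id) -(size_scale _ c0) -rsE.
  by rewrite size_map_poly size_char_poly.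
have : horner_mx (f C) (q ^+ n.+1) = 0.
  rewrite -srs; have : char_poly (f C) %| q ^+ size rs.
    by rewrite -map_char_poly rsE dvdpZl.
  by case/dvdpP => r ->; rewrite rmorphM /= Cayley_Hamilton mulr0.
rewrite rmorphXn rmorphB rmorph1 rmorphXn /= horner_mx_X => eq0.
apply: (@map_mx_inj _ _ iota); rewrite map_mx0 -[RHS]eq0.
by rewrite rmorphXn rmorphB rmorph1 rmorphXn.
Qed.

Lemma exprB1_pchar (R : nzRingType) (x : R) p k : p \in [pchar R] ->
  (x - 1) ^+ (p ^ k) = x ^+ (p ^ k) - 1.
Proof.
move=> pR; elim: k => [|k IH]; first by rewrite expn0 !expr1.
rewrite expnSr exprM IH -(pFrobenius_autE pR) pFrobenius_autB_comm ?pFrobenius_aut1 ?pFrobenius_autE.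
  by rewrite exprM.
exact: commr1.
Qed.

(** By Frobenius, raising [C ^+ M - 1] to a power of p is the same as subtracting 1 from that power
    of [C ^+ M]; beyond the nilpotency index the result is 0. *)
Lemma unipotent_pchar (F : fieldType) n (C : 'M[F]_n.+1) M p :
  p \in [pchar F] -> (C ^+ M - 1) ^+ n.+1 = 0 -> exists2 m, (0 < m)%N & C ^+ (M * m) = 1.
Proof.
move=> pF C0; have pr := pcharf_prime pF.
have pM : p \in [pchar 'M[F]_n.+1].
  by rewrite inE pr -scaler_nat pcharf0 // scale0r /=.
exists (p ^ n.+1)%N; first by rewrite expn_gt0 prime_gt0.
have np : (n.+1 <= p ^ n.+1)%N by apply: ltnW; apply: ltn_expl; apply: prime_gt1.
apply/eqP; rewrite exprM -subr_eq0 -(exprB1_pchar _ _ pM) -(subnK np) exprD C0 mulr0.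
exact: eqxx.
Qed.

Inductive subalg (F : fieldType) n (S : 'M[F]_n.+1 -> Prop) : 'M[F]_n.+1 -> Prop :=
| subalg_gen x : S x -> subalg S x
| subalg_scalar a : subalg S a%:M
| subalg_add x y : subalg S x -> subalg S y -> subalg S (x + y)
| subalg_mul x y : subalg S x -> subalg S y -> subalg S (x * y).

Lemma subalg0 (F : fieldType) n (S : 'M[F]_n.+1 -> Prop) : subalg S 0.
Proof. by rewrite -(raddf0 (@scalar_mx F n.+1)); apply: subalg_scalar. Qed.

Lemma subalg1 (F : fieldType) n (S : 'M[F]_n.+1 -> Prop) : subalg S 1.
Proof. exact: subalg_scalar. Qed.

Lemma subalgN (F : fieldType) n (S : 'M[F]_n.+1 -> Prop) X : subalg S X -> subalg S (- X).
Proof.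
move=> SX; rewrite -mulN1r; apply: subalg_mul => //.
by rewrite -[- 1](raddfN (@scalar_mx F n.+1)); apply: subalg_scalar.
Qed.

Lemma subalgX (F : fieldType) n (S : 'M[F]_n.+1 -> Prop) X k : subalg S X -> subalg S (X ^+ k).
Proof.
by move=> SX; elim: k => [|k IH]; [apply: subalg1 | rewrite exprS; apply: subalg_mul].
Qed.

Lemma subalg_horner (F : fieldType) n (S : 'M[F]_n.+1 -> Prop) X p :
  subalg S X -> subalg S (horner_mx X p).
Proof.
move=> SX; elim/poly_ind: p => [|p c IH]; first by rewrite rmorph0; apply: subalg0.
rewrite rmorphD rmorphM /= horner_mx_X horner_mx_C.
by apply: subalg_add; [apply: subalg_mul | apply: subalg_scalar].
Qed.

Lemma subalg_sub (F : fieldType) n (S T : 'M[F]_n.+1 -> Prop) X :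
  (forall x, S x -> subalg T x) -> subalg S X -> subalg T X.
Proof.
move=> ST; elim=> {X} [x /ST // | a | x y _ Tx _ Ty | x y _ Tx _ Ty].
- exact: subalg_scalar.
- exact: subalg_add.
- exact: subalg_mul.
Qed.

(* Inversion of power series: [N] is a polynomial in [X = N + ...]. *)
Lemma nilpotent_inverse (F : fieldType) n m (N : 'M[F]_n.+1) q X : N ^+ m = 0 ->
  X = horner_mx N ('X * (1 + 'X * q)) -> subalg (eq X) N.
Proof.
move=> N0 XE; suff H j k t : (0 < k)%N -> (m <= j + k)%N ->
    subalg (eq X) (N ^+ k * horner_mx N t).
  by have := H m 1%N 1 isT (leq_addr _ _); rewrite rmorph1 mulr1 expr1.
elim: j k t => [|j IH] k t k0; rewrite ?add0n => mk.
  by rewrite -(subnKC mk) exprD N0 !mul0r; apply: subalg0.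
have [w wE] : exists w, X ^+ k = N ^+ k * (1 + N * horner_mx N w).
  have [w wE] : exists w, (1 + 'X * q) ^+ k = 1 + 'X * w.
    elim: (k) => [|i [w wE]]; first by exists 0; rewrite mulr0 addr0.
    by exists (q * (1 + 'X * w) + w); rewrite exprS wE; ring.
  exists w; rewrite XE -rmorphXn exprMn wE rmorphM rmorphXn /= horner_mx_X.
  by rewrite rmorphD rmorph1 rmorphM /= horner_mx_X.
have Nk : subalg (eq X) (N ^+ k).
  rewrite (_ : N ^+ k = X ^+ k - N ^+ k.+1 * horner_mx N w).
    apply: subalg_add; first by apply: subalgX; apply: subalg_gen.
    by apply: subalgN; apply: IH => //; rewrite addnS -addSn.
  by rewrite wE mulrDr mulr1 mulrA -exprSr addrK.
elim/poly_ind: t => [|t c _]; first by rewrite rmorph0 mulr0; apply: subalg0.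
rewrite rmorphD rmorphM /= horner_mx_X horner_mx_C mulrDr; apply: subalg_add.
  have -> : horner_mx N t * N = N * horner_mx N t by apply: comm_horner_mx.
  by rewrite mulrA -exprSr; apply: IH => //; rewrite addnS -addSn.
by apply: subalg_mul => //; apply: subalg_scalar.
Qed.

(** * Powers of a unipotent matrix as polynomials in the exponent *)

Section PolyNat.
Variables (F : fieldType) (n : nat).
Hypothesis ch0 : [pchar F] =i pred0.
Notation M := 'M[F]_n.+1.

Lemma natM_unit k : (0 < k)%N -> k%:R \is a @GRing.unit M.
Proof.
move=> k0; rewrite -scaler_nat scaler_unit ?unitr1 // unitfE.
by rewrite ((pcharf0P F).1 ch0) -lt0n.
Qed.

Lemma natM_comm (x : M) k : GRing.comm x k%:R.
Proof. exact: commr_nat. Qed.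

Lemma comm_poly_nat (p : {poly M}) k : comm_poly p k%:R.
Proof.
by apply: comm_coef_poly => i; apply: natM_comm.
Qed.

Lemma hornerM_nat (p q : {poly M}) k : (p * q).[k%:R] = p.[k%:R] * q.[k%:R].
Proof. exact: hornerM_comm (comm_poly_nat q k). Qed.

(** Over a noncommutative ring a polynomial can have more roots than its degree. The roots used here
    are integers, which commute with everything and have invertible differences in characteristic 0.
    The step [N] serves comparisons known only at multiples of [N]. *)
Lemma poly_nat_eq N (p q : {poly M}) : (0 < N)%N ->
  (forall b : nat, p.[(N * b)%:R] = q.[(N * b)%:R]) -> p = q.
Proof.
move=> N0 e; apply/eqP; rewrite -subr_eq0; apply/negPn/negP => pq0.
set r := p - q in pq0.
pose s k := [seq ((N * b)%:R : M) | b <- iota 0 k].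
have := @max_ring_poly_roots _ r (s (size r)) pq0; rewrite size_map size_iota ltnn => ab.
suff : false by [].
apply: ab.
  by apply/allP => _ /mapP[b _ ->]; rewrite /root /r hornerD hornerN e subrr.
have : forall k m, uniq_roots [seq ((N * b)%:R : M) | b <- iota m k].
  elim=> // k IH m /=; rewrite IH andbT; apply/allP => _ /mapP[b + ->].
  rewrite mem_iota => /andP[mb _]; rewrite /diff_roots natM_comm eqxx /=.
  by rewrite -natrB ?leq_mul2l ?(ltnW mb) ?orbT // -mulnBr natM_unit // muln_gt0 N0 subn_gt0.
exact.
Qed.

Definition powpoly (u : M) (p : {poly M}) := forall b : nat, p.[b%:R] = u ^+ b.

(* For unipotent [u] the linear coefficient of the polynomial b |-> u^b is log u. *)
Definition logof (u X : M) := exists2 p, powpoly u p & p`_1 = X.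

Lemma powpoly_coef0 u p : powpoly u p -> p`_0 = 1.
Proof. by move=> up; rewrite -horner_coef0 -[0]/(0%:R) up expr0. Qed.

Lemma powpoly_inj u p q : powpoly u p -> powpoly u q -> p = q.
Proof. by move=> up uq; apply: (@poly_nat_eq 1) => // b; rewrite mul1n up uq. Qed.

Lemma logof_inj u X Y : logof u X -> logof u Y -> X = Y.
Proof. by move=> [p up <-] [q uq <-]; rewrite (powpoly_inj up uq). Qed.

Lemma coef1M (p q : {poly M}) : (p * q)`_1 = p`_0 * q`_1 + p`_1 * q`_0.
Proof. by rewrite coefM !big_ord_recl big_ord0 addr0. Qed.

Lemma logofM u v X Y : GRing.comm u v -> logof u X -> logof v Y -> logof (u * v) (X + Y).
Proof.
move=> uv [p up pX] [q vq qY]; exists (p * q).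
  by move=> b; rewrite hornerM_nat up vq exprMn_comm.
by rewrite coef1M (powpoly_coef0 up) (powpoly_coef0 vq) mul1r mulr1 pX qY addrC.
Qed.

Lemma logofJ g u X : g \is a GRing.unit -> logof u X -> logof (g * u * g^-1) (g * X * g^-1).
Proof.
move=> ug [p up pX]; exists (g%:P * p * (g^-1)%:P); last by rewrite coefMC coefCM pX.
move=> b; rewrite !hornerM_nat !hornerC up.
elim: b => [|b IH]; first by rewrite !expr0 mulr1 mulrV.
by rewrite !exprS -IH !mulrA mulrVK.
Qed.

(* If conjugation by [u^b] moves [Y] linearly in [b], the velocity is a commutator. *)
Lemma logof_commutator u X Y Z : logof u X ->
  (forall b : nat, u ^+ b * Y = (Y + Z *+ b) * u ^+ b) -> X * Y - Y * X = Z.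
Proof.
move=> [p up <-] e.
have pE : p * Y%:P = (Y%:P + Z%:P * 'X) * p.
  apply: (@poly_nat_eq 1) => // b; rewrite mul1n !hornerM_nat up hornerC e; congr (_ * _).
  by rewrite hornerD hornerM_nat !hornerC hornerX mulr_natr.
have := congr1 (fun q : {poly M} => q`_1) pE; rewrite /= coefMC coef1M => ->.
rewrite !coefD !coefC !coefMX coefC /= (powpoly_coef0 up) !add0r !addr0 mulr1.
by rewrite addrAC subrr add0r.
Qed.

Definition binp r : {poly F} := (r`!%:R)^-1 *: \prod_(j < r) ('X - (j%:R)%:P).

Lemma binp_nat r b : (binp r).[b%:R] = 'C(b, r)%:R.
Proof.
have r0 : r`!%:R != 0 :> F by rewrite ((pcharf0P F).1 ch0) -lt0n fact_gt0.
suff E : (\prod_(j < r) ('X - (j%:R)%:P)).[b%:R] = (b ^_ r)%:R :> F.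
  by rewrite /binp hornerZ E -bin_ffact natrM mulrC mulfK.
elim: r {r0} => [|r IH]; first by rewrite big_ord0 hornerC.
rewrite big_ord_recr hornerM IH !hornerE ffactnSr natrM.
have [br|rb] := ltnP b r; first by rewrite ffact_small // !mul0r.
by rewrite natrB.
Qed.

Lemma sum_bin_nilpotent (N : M) m b : N ^+ m = 0 ->
  (N + 1) ^+ b = \sum_(r < m) N ^+ r *+ 'C(b, r).
Proof.
move=> N0; rewrite exprDn_comm; last exact: commr1.
rewrite (eq_bigr (fun i : 'I_b.+1 => N ^+ (b - i) *+ 'C(b, b - i))); last first.
  by move=> i _; rewrite expr1n mulr1 bin_sub // -ltnS.
rewrite (reindex_inj rev_ord_inj) /=.
rewrite (eq_bigr (fun i : 'I_b.+1 => N ^+ i *+ 'C(b, i))); last first.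
  by move=> i _; rewrite subSS subKn // -ltnS.
pose f r := N ^+ r *+ 'C(b, r).
have tail k : b.+1 = k \/ m = k -> \sum_(r < k) f r = \sum_(r < m + b.+1) f r.
  move=> kE; have le_k : (k <= m + b.+1)%N by case: kE; lia.
  rewrite -!(big_mkord xpredT f) (big_cat_nat (leq0n k) le_k) /=.
  suff -> : \sum_(k <= i < m + b.+1) f i = 0 by rewrite addr0.
  rewrite big_nat_cond big1 // => i /andP[/andP[ki _] _].
  rewrite /f; case: kE => kE; first by rewrite bin_small ?mulr0n // kE.
  by rewrite -(subnKC ki) exprD -kE N0 mul0r mul0rn.
by rewrite (tail b.+1) ?(tail m); [ | right | left].
Qed.

(** With [N = u - 1], the binomial expansion makes [u ^+ b] a polynomial in [b]. Its linear
    coefficient is [N] plus higher powers of [N], so [nilpotent_inverse] recovers [N], hence [u],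
    from the logarithm. *)
Lemma unipotent_log (u : M) m : (u - 1) ^+ m = 0 -> exists2 X, logof u X & subalg (eq X) u.
Proof.
set N := u - 1 => N0.
have uE : u = N + 1 by rewrite subrK.
(* The range [m.+2] guarantees that the terms r = 0 and r = 1 can be split off. *)
pose p : {poly M} := \sum_(r < m.+2) map_poly (@scalar_mx F n.+1) (binp r) * (N ^+ r)%:P.
have up : powpoly u p.
  move=> b; rewrite horner_sum uE (@sum_bin_nilpotent _ m.+2); last by rewrite -addn2 exprD N0 mul0r.
  apply: eq_bigr => r _; rewrite hornerM_nat hornerC.
  rewrite -(rmorph_nat (@scalar_mx F n.+1)) horner_map /= binp_nat.
  by rewrite rmorph_nat mulr_natl.
exists p`_1; first by exists p.
rewrite uE; apply: subalg_add; last exact: subalg1.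
pose c r := (binp r)`_1.
apply: (@nilpotent_inverse _ _ m _ (\sum_(r < m) c r.+2 *: 'X^r)) => //.
rewrite coef_sum !big_ord_recl /=.
rewrite !coefMC !coef_map /=.
have -> : binp 0 = 1 by rewrite /binp big_ord0 fact0 invr1 scale1r.
have -> : binp 1 = 'X by rewrite /binp big_ord_recl big_ord0 factS fact0 invr1 scale1r mulr1 subr0.
rewrite coefC coefX raddf0 /= mul0r add0r expr1 mul1r mulrDr mulr1 rmorphD /= horner_mx_X.
congr (_ + _); rewrite !mulr_sumr rmorph_sum /=; apply: eq_bigr => r _.
rewrite coefMC coef_map /= !rmorphM /= horner_mx_X.
rewrite -mul_polyC rmorphM rmorphXn /= horner_mx_X horner_mx_C /bump /= !add1n !exprS.
have sc (a : F) (x y : M) : a%:M * (x * y) = x * (a%:M * y).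
  by rewrite !mulrA -[x * a%:M]/(x *m a%:M) scalar_mxC.
by rewrite !sc.
Qed.

End PolyNat.

Lemma intr_inj_pchar0 (F : fieldType) (i j : int) : [pchar F] =i pred0 ->
  i%:~R = j%:~R :> F -> i = j.
Proof.
move=> ch0 /eqP; rewrite -subr_eq0 -intrB => e; apply/eqP; rewrite -subr_eq0.
case: (i - j) e => k; first by rewrite -pmulrn ((pcharf0P F).1 ch0).
by rewrite NegzE rmorphN /= oppr_eq0 -pmulrn ((pcharf0P F).1 ch0).
Qed.

(** * Integral weights of sl2-triples *)

Section Sl2.
Variables (F : fieldType) (n : nat).
Hypothesis ch0 : [pchar F] =i pred0.
Notation M := 'M[F]_n.+1.

(** Nonzero powers [e ^+ k] are eigenvectors of the commutator with [h], for the distinct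
    eigenvalues [c *+ k], and the space of matrices has finite dimension. *)
Lemma weight_nilpotent (h e : M) (c : F) : c != 0 -> h * e - e * h = c *: e ->
  exists r, e ^+ r = 0.
Proof.
move=> c0 he.
have hek k : h * e ^+ k - e ^+ k * h = (c *+ k) *: e ^+ k.
  elim: k => [|k IH]; first by rewrite expr0 mulr1 mul1r subrr mulr0n scale0r.
  have -> : h * e ^+ k.+1 = (h * e) * e ^+ k by rewrite exprS mulrA.
  rewrite -[h * e](subrK (e * h)) he mulrDl -mulrA -[h * e ^+ k](subrK (e ^+ k * h)) IH.
  rewrite mulrDr -scalerAl -exprS !mulrA -exprS -scalerAr -exprS addrA addrK.
  by rewrite -scalerDl mulrS.
pose m := (n.+1 * n.+1)%N; exists m; apply/eqP; apply: contraT => em0.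
pose g : 'M[F]_m := lin_mulmx h - lin_mulmxr h.
have rootg k : (k <= m)%N -> root (char_poly g) (c *+ k).
  move=> km; rewrite -eigenvalue_root_char; apply/eigenvalueP; exists (mxvec (e ^+ k)).
    by rewrite mulmxBr !mul_vec_lin /= -linearB /= -linearZ /= -hek.
  rewrite mxvec_eq0; apply: contraNneq em0 => ek0.
  by rewrite -(subnKC km) exprD ek0 mul0r.
have := @max_poly_roots _ (char_poly g) [seq c *+ k | k <- iota 0 m.+1].
rewrite size_map size_iota size_char_poly ltnn => ab; suff : false by [].
apply: ab.
- exact/monic_neq0/char_poly_monic.
- by apply/allP => _ /mapP[k + ->]; rewrite mem_iota => /andP[_ km]; apply: rootg.
- rewrite map_inj_uniq ?iota_uniq // => i j /eqP.
  wlog ij : i j / (i <= j)%N.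
    by move=> W; have [/W|/ltnW/W H] := leqP i j => //; rewrite eq_sym => /H.
  rewrite -subr_eq0 -opprB oppr_eq0 -mulrnBr // -mulr_natr mulf_eq0 (negPf c0) /= ((pcharf0P F).1 ch0).
  by lia.
Qed.

Section Comm.
Variables (P : comNzRingType) (ev : {rmorphism P -> M}) (h u : P).
Let L (i : nat) : P := u + i.+1%:R * (h - i%:R).
Let V (j : nat) : P := u - j%:R * (h + j.+1%:R).

(* If u = f e and [h, e] = 2 e, then the products of the [L i] and of the [V j] are the powers
   e^r f^r and f^r e^r. The zeros of [L i] and [V j] meet only over h = i - j. *)
Lemma LV_killed (K : seq int) (I J : seq nat) (y : M) :
  (forall i j, i \in I -> j \in J -> i%:Z - j%:Z \in K) ->
  uniq I -> uniq J -> (0 < size I)%N -> (0 < size J)%N ->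
  ev (\prod_(i <- I) L i) * y = 0 -> ev (\prod_(j <- J) V j) * y = 0 ->
  ev (\prod_(k <- K) (h - k%:~R)) * y = 0.
Proof.
set G := \prod_(k <- K) _.
have [m] := ubnP (size I + size J); elim: m => // m IH in I J y *.
rewrite ltnS => sIJ KIJ uI uJ I0 J0 LI VJ.
have evC a b : ev a * ev b = ev b * ev a by rewrite -!rmorphM mulrC.
have LG i : i \in I -> ev (L i) * (ev G * y) = 0.
  move=> iI; rewrite mulrA evC -mulrA.
  have IE : \prod_(i <- I) L i = (\prod_(k <- rem i I) L k) * L i.
    by rewrite (perm_big _ (perm_to_rem iI)) big_cons mulrC.
  rewrite IE rmorphM -mulrA in LI.
  have [s0|s0] := posnP (size (rem i I)).
    by move: LI; rewrite (size0nil s0) big_nil rmorph1 mul1r => ->; rewrite mulr0.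
  apply: (IH (rem i I) J) => //; rewrite ?rem_uniq //.
  - by rewrite size_rem //; apply: leq_trans sIJ; rewrite -addSn prednK.
  - by move=> k j /mem_rem; apply: KIJ.
  - by rewrite mulrA evC -mulrA VJ mulr0.
have VG j : j \in J -> ev (V j) * (ev G * y) = 0.
  move=> jJ; rewrite mulrA evC -mulrA.
  have JE : \prod_(i <- J) V i = (\prod_(k <- rem j J) V k) * V j.
    by rewrite (perm_big _ (perm_to_rem jJ)) big_cons mulrC.
  rewrite JE rmorphM -mulrA in VJ.
  have [s0|s0] := posnP (size (rem j J)).
    by move: VJ; rewrite (size0nil s0) big_nil rmorph1 mul1r => ->; rewrite mulr0.
  apply: (IH I (rem j J)) => //; rewrite ?rem_uniq //.
  - by rewrite size_rem //; apply: leq_trans sIJ; rewrite -addnS prednK.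
  - by move=> i k iI /mem_rem; apply: KIJ.
  - by rewrite mulrA evC -mulrA LI mulr0.
have hE z i j : ev (L i) * z = 0 -> ev (V j) * z = 0 -> ev (h - (i%:Z - j%:Z)%:~R) * z = 0.
  move=> Lz Vz; apply: (mulrI (natM_unit n ch0 (ltn0Sn (i + j)))).
  rewrite mulr0 mulrA -(rmorph_nat ev) -rmorphM.
  have -> : (i + j).+1%:R * (h - (i%:Z - j%:Z)%:~R) = L i - V j.
    have id (a b : P) : (a + b + 1) * (h - (a - b)) =
        (u + (a + 1) * (h - a)) - (u - b * (h + (b + 1))) by ring.
    by rewrite /L /V -!natr1 natrD intrB; apply: id.
  by rewrite rmorphB mulrBl Lz Vz subrr.
have two i j i' j' : i \in I -> j \in J -> i' \in I -> j' \in J ->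
    i%:Z - j%:Z != i'%:Z - j'%:Z -> ev G * y = 0.
  move=> iI jJ i'I j'J; set k := i%:Z - _; set k' := i'%:Z - _ => kk'.
  have e1 := hE _ _ _ (LG i iI) (VG j jJ); have e2 := hE _ _ _ (LG i' i'I) (VG j' j'J).
  have : ev ((k' - k)%:~R) * (ev G * y) = 0.
    rewrite (_ : (k' - k)%:~R = (h - k%:~R) - (h - k'%:~R)); last first.
      by have id (a b : P) : a - b = (h - b) - (h - a) by [ring]; rewrite intrB; apply: id.
    by rewrite rmorphB mulrBl e1 e2 subrr.
  rewrite rmorph_int => e3.
  have uk : (k' - k)%:~R \is a @GRing.unit M.
    have : k' - k != 0 by rewrite subr_eq0 eq_sym.
    case: (k' - k) => a a0; first by rewrite -pmulrn natM_unit // lt0n.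
    by rewrite NegzE rmorphN /= -pmulrn unitrN natM_unit.
  by apply: (mulrI uk); rewrite e3 mulr0.
case: I J => [|i [|i' I]] // [|j [|j' J]] // in IH sIJ KIJ uI uJ I0 J0 LI VJ LG VG two *.
- rewrite /G (perm_big _ (perm_to_rem (KIJ i j (mem_head _ _) (mem_head _ _)))) big_cons.
  rewrite [X in ev X]mulrC rmorphM -mulrA hE ?mulr0 //; first by move: LI; rewrite big_seq1.
  by move: VJ; rewrite big_seq1.
- apply: (two i j i j'); rewrite ?inE ?eqxx ?orbT //.
  by move: uJ => /= /andP[]; rewrite inE; lia.
- apply: (two i j i' j); rewrite ?inE ?eqxx ?orbT //.
  by move: uI => /= /andP[]; rewrite inE; lia.
- apply: (two i j i' j); rewrite ?inE ?eqxx ?orbT //.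
  by move: uI => /= /andP[]; rewrite inE; lia.
Qed.
End Comm.

(** The product [u = f * e] commutes with [h], and both [e ^+ k * f ^+ k] and [f ^+ k * e ^+ k] are
    products of linear expressions in [u] and [h]. For large k both vanish, and [LV_killed]
    eliminates [u], leaving a polynomial in [h] with simple integral roots. *)
Lemma sl2_weights (h e f : M) :
  h * e - e * h = 2 *: e -> h * f - f * h = (- 2) *: f -> e * f - f * e = h ->
  exists K : seq int, horner_mx h (\prod_(k <- K) ('X - (k%:~R)%:P)) = 0 /\ uniq K.
Proof.
move=> he hf ef.
have [r [er fr]] : exists r, e ^+ r.+1 = 0 /\ f ^+ r.+1 = 0.
  have two0 : 2 != 0 :> F by rewrite ((pcharf0P F).1 ch0).
  have [r er] := weight_nilpotent two0 he.
  have [s fs] : exists s, f ^+ s = 0 by apply: weight_nilpotent hf; rewrite oppr_eq0.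
  by exists (r + s)%N; rewrite -addSn {1}addSnnS !exprD er fs mul0r mulr0.
have [u uE] : exists u, u = f * e by exists (f * e).
have heE : h * e = e * (h + 2%:R).
  by rewrite -[h * e](subrK (e * h)) he mulrDr addrC mulr_natr scaler_nat.
have hfE : h * f = f * (h - 2%:R).
  by rewrite -[h * f](subrK (f * h)) hf mulrBr addrC mulr_natr scaleNr scaler_nat.
have efE : e * f = u + h by rewrite -ef uE addrC subrK.
have uh : GRing.comm u h.
  rewrite /GRing.comm uE mulrA hfE -!mulrA; congr (f * _).
  by rewrite mulrBl heE mulrDr [e * 2%:R]natM_comm addrK.
have uf : u * f = f * (u + h) by rewrite uE -mulrA efE uE.
have ue : u * e = e * (u - (h + 2%:R)).
  rewrite {1}uE (_ : f * e = e * f - h); last by rewrite -[h in RHS]ef opprB addrC subrK.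
  by rewrite mulrBl heE -mulrA -uE -mulrBr.
(* Evaluation of polynomials in two variables at [h] and [u], so that the identities below are
   checked in a commutative ring. *)
pose ev0 : {rmorphism {poly F} -> M} := horner_mx h.
have cfu : commr_rmorph ev0 u.
  by move=> p; apply/commr_sym; apply: comm_horner_mx; apply: commr_sym.
pose ev : {rmorphism {poly {poly F}} -> M} := horner_morph cfu.
pose H : {poly {poly F}} := 'X%:P; pose U : {poly {poly F}} := 'X.
have evH : ev H = h by rewrite /ev /= horner_morphC; apply: horner_mx_X.
have evU : ev U = u by rewrite /ev /= horner_morphX.
pose L (i : nat) := U + i.+1%:R * (H - i%:R).
pose V (j : nat) := U - j%:R * (H + j.+1%:R).
have evL i : ev (L i) = u + i.+1%:R * (h - i%:R).
  by rewrite /L rmorphD rmorphM rmorphB !rmorph_nat evU evH.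
have evV j : ev (V j) = u - j%:R * (h + j.+1%:R).
  by rewrite /V rmorphB rmorphM rmorphD !rmorph_nat evU evH.
have natC (x : M) k : k%:R * x = x * k%:R by rewrite natM_comm.
have Lf k : ev (L k) * f = f * ev (L k.+1).
  have -> : ev (L k) * f = f * ev (U + H + k.+1%:R * (H - 2%:R - k%:R)).
    rewrite evL !rmorphD rmorphM !rmorphB !rmorph_nat evU evH mulrDl uf -(mulrA _ _ f).
    by rewrite [(h - k%:R) * f]mulrBl hfE (natC f) -mulrBr (mulrA _ f) (natC f) -(mulrA f) -mulrDr.
  by congr (f * ev _); rewrite /L -[k.+2]addn1 -[k.+1]addn1 !natrD; ring.
have Ve k : ev (V k) * e = e * ev (V k.+1).
  have -> : ev (V k) * e = e * ev (U - (H + 2%:R) - k%:R * (H + 2%:R + k.+1%:R)).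
    rewrite evV !rmorphB rmorphM !(rmorph_nat, rmorphD) evU evH mulrBl ue -(mulrA _ _ e).
    by rewrite [(h + k.+1%:R) * e]mulrDl heE (natC e) -mulrDr (mulrA _ e) (natC e) -(mulrA e) -mulrBr.
  by congr (e * ev _); rewrite /V -[k.+2]addn1 -[k.+1]addn1 !natrD; ring.
have ef_pow k : e * f ^+ k.+1 = f ^+ k * ev (L k).
  elim: k => [|k IH]; first by rewrite expr1 expr0 mul1r evL mul1r subr0.
  by rewrite exprSr mulrA IH -mulrA Lf mulrA -exprSr.
have fe_pow k : f * e ^+ k.+1 = e ^+ k * ev (V k).
  elim: k => [|k IH]; first by rewrite expr1 expr0 mul1r evV mul0r subr0.
  by rewrite exprSr mulrA IH -mulrA Ve mulrA -exprSr.
have prodL k : e ^+ k * f ^+ k = ev (\prod_(0 <= i < k) L i).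
  elim: k => [|k IH]; first by rewrite big_geq // rmorph1 !expr0 mulr1.
  by rewrite big_nat_recr //= rmorphM -IH exprSr -!mulrA ef_pow.
have prodV k : f ^+ k * e ^+ k = ev (\prod_(0 <= i < k) V i).
  elim: k => [|k IH]; first by rewrite big_geq // rmorph1 !expr0 mulr1.
  by rewrite big_nat_recr //= rmorphM -IH exprSr -!mulrA fe_pow.
pose K := [seq k%:Z - r%:Z | k <- iota 0 (r + r).+1].
exists K; split; last by rewrite map_inj_uniq ?iota_uniq // => i j; lia.
have := @LV_killed _ ev H U K (index_iota 0 r.+1) (index_iota 0 r.+1) 1.
rewrite !mulr1 -/L -/V -prodL -prodV er fr !mul0r => H0.
rewrite -[RHS]H0 ?size_iota ?iota_uniq //; last first.
  move=> i j; rewrite !mem_index_iota => ir jr; apply/mapP.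
  by exists (i + r - j)%N; [rewrite mem_iota; lia | lia].
rewrite !rmorph_prod; apply: eq_bigr => k _ /=.
rewrite -[horner_morph _ _]/(ev _) (rmorphB ev) (rmorph_int ev) evH rmorphB /=.
congr (_ - _); first exact: horner_mx_X.
by rewrite -[LHS]/(horner_mx h _) [LHS]horner_mx_C -scalemx1 scaler_int.
Qed.

Lemma sl2_diagonalizable (h e f : M) :
  h * e - e * h = 2 *: e -> h * f - f * h = (- 2) *: f -> e * f - f * e = h ->
  diagonalizable h /\ forall a, eigenvalue h a -> exists k : int, a = k%:~R.
Proof.
move=> he hf ef; have [K [K0 uK]] := sl2_weights he hf ef.
have mp : mxminpoly h %| \prod_(k <- K) ('X - (k%:~R)%:P) by rewrite mxminpoly_min // K0.
split.
  apply/diagonalizableP; exists [seq k%:~R | k <- K]; last by rewrite big_map.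
  by rewrite map_inj_uniq // => i j; apply: intr_inj_pchar0.
move=> a; rewrite eigenvalue_root_min => /(root_dvdp mp).
rewrite -(big_map (fun k => k%:~R) xpredT (fun x : F => 'X - x%:P)) root_prod_XsubC.
by case/mapP => k _ ->; exists k.
Qed.
End Sl2.

(** * The derived representation of sl3 *)

Section Lie.
Variable R : nzRingType.
Implicit Types a b c : R.
Definition lie a b := a * b - b * a.

Lemma lieC a b : lie a b = - lie b a. Proof. by rewrite /lie opprB. Qed.
Lemma lieDl a b c : lie (a + b) c = lie a c + lie b c.
Proof. by rewrite /lie mulrDl mulrDr opprD addrACA. Qed.
Lemma lieDr a b c : lie a (b + c) = lie a b + lie a c.
Proof. by rewrite /lie mulrDl mulrDr opprD addrACA. Qed.
Lemma lieNl a b : lie (- a) b = - lie a b.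
Proof. by rewrite /lie mulNr mulrN opprD. Qed.
Lemma lieNr a b : lie a (- b) = - lie a b.
Proof. by rewrite /lie mulNr mulrN opprD. Qed.
Lemma lie0l b : lie 0 b = 0. Proof. by rewrite /lie mul0r mulr0 subrr. Qed.
Lemma lie0r b : lie b 0 = 0. Proof. by rewrite /lie mul0r mulr0 subrr. Qed.
Lemma lieMr a b c : lie a (b * c) = lie a b * c + b * lie a c.
Proof. by rewrite /lie mulrBl mulrBr !mulrA addrA subrK. Qed.
Lemma jacobi a b c : lie a (lie b c) = lie (lie a b) c + lie b (lie a c).
Proof.
rewrite {2}/lie lieDr lieNr !lieMr opprD /lie.
set p := a * b - b * a; set q := a * c - c * a.
by rewrite [- (q * b) - _]addrC addrACA.
Qed.
End Lie.

Lemma lieZl (F : fieldType) n (k : F) (a b : 'M[F]_n.+1) : lie (k *: a) b = k *: lie a b.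
Proof. by rewrite /lie -scalerAl -scalerAr scalerBr. Qed.
Lemma lieZr (F : fieldType) n (k : F) (a b : 'M[F]_n.+1) : lie a (k *: b) = k *: lie a b.
Proof. by rewrite /lie -scalerAl -scalerAr scalerBr. Qed.

Section Gl3.
Variables (F : fieldType) (n : nat).
Hypothesis ch0 : [pchar F] =i pred0.
Notation M := 'M[F]_n.+1.
Variable x : 'I_3 -> 'I_3 -> M.
Hypothesis x_comp : forall i j k, i != j -> j != k -> i != k -> lie (x i j) (x j k) = x i k.
Hypothesis x_row : forall i j k, i != j -> j != k -> i != k -> lie (x i j) (x i k) = 0.
Hypothesis x_col : forall i j k, i != j -> j != k -> i != k -> lie (x i k) (x j k) = 0.

Let three0 : 3 != 0 :> F. Proof. by rewrite ((pcharf0P F).1 ch0). Qed.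

Let h i j := lie (x i j) (x j i).

Let hC i j : h j i = - h i j. Proof. exact: lieC. Qed.

Let sym3 (i j k : 'I_3) : i != j -> j != k -> i != k -> [/\ j != i, k != j & k != i].
Proof. by rewrite ![_ == i]eq_sym [k == _]eq_sym => -> -> ->. Qed.

Let hD i j k : i != j -> j != k -> i != k -> h i j + h j k = h i k.
Proof.
move=> ij jk ik; have [ji kj ki] := sym3 ij jk ik; have := jacobi (x i j) (x j k) (x k i).
rewrite (x_comp jk ki ji) (x_comp ij jk ik) [lie (x i j) (x k i)]lieC (x_comp ki ij kj).
by rewrite lieNr -/(h i j) -/(h i k) -/(h j k) => ->; rewrite subrK.
Qed.

Let h_row i j k : i != j -> j != k -> i != k -> lie (h i j) (x i k) = x i k.
Proof.
move=> ij jk ik; have [ji kj ki] := sym3 ij jk ik; have := jacobi (x i j) (x j i) (x i k).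
by rewrite (x_row ij jk ik) lie0r addr0 (x_comp ji ik jk) (x_comp ij jk ik) -/(h i j) => <-.
Qed.

Let h_col i j k : i != j -> j != k -> i != k -> lie (h i j) (x k i) = - x k i.
Proof.
move=> ij jk ik; have [ji kj ki] := sym3 ij jk ik; have := jacobi (x i j) (x j i) (x k i).
rewrite (x_col jk ki ji) lie0r [lie (x i j) (x k i)]lieC (x_comp ki ij kj) lieNr.
rewrite [lie (x j i) _]lieC opprK (x_comp kj ji ki) -/(h i j).
by move/esym/eqP; rewrite addr_eq0 => /eqP.
Qed.

Let h_self i j k : i != j -> j != k -> i != k -> lie (h i j) (x i j) = x i j + x i j.
Proof.
move=> ij jk ik; have [ji kj ki] := sym3 ij jk ik.
have hkj : lie (h i j) (x k j) = x k j by rewrite hC lieNl (h_col ji ik jk) opprK.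
by rewrite -[X in lie _ X](x_comp ik kj ij) jacobi h_row // hkj x_comp.
Qed.

Let h_h i j k : i != j -> j != k -> i != k -> lie (h i j) (h i k) = 0.
Proof.
by move=> ij jk ik; rewrite {2}/h jacobi h_row // h_col // lieNr subrr.
Qed.

(** The image of the traceless part of [delta_mx i i], which is a third of the sum of its
    differences with the other diagonal units. With this choice the extension to gl3 kills the
    identity. *)
Definition xd i : M := 3^-1 *: \sum_(j | j != i) h i j.

Lemma xdE i j k : i != j -> j != k -> i != k -> xd i = 3^-1 *: (h i j + h i k).
Proof.
move=> ij jk ik; rewrite /xd (bigD1 j) 1?eq_sym //=; congr (_ *: (_ + _)).
rewrite (bigD1 k) /= ?[k == _]eq_sym ?ik // big1 ?addr0 // => l.
by move: i j k l ij jk ik; do 4![apply: I3P].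
Qed.

Let third (a : M) : 3^-1 *: (a + a + a) = a.
Proof. by rewrite -mulr2n -mulrSr -scaler_nat scalerA mulVf ?scale1r. Qed.

Lemma xdB i j k : i != j -> j != k -> i != k -> xd i - xd j = h i j.
Proof.
move=> ij jk ik; have [ji kj ki] := sym3 ij jk ik.
rewrite (xdE ij jk ik) (xdE ji ik jk) -scalerBr -(hD ij jk ik) (hC i j).
have id (a b : M) : 3^-1 *: (a + (a + b) - (- a + b)) = a.
  by rewrite opprD opprK -!addrA [b + _]addrCA subrr addr0 !addrA third.
exact: id.
Qed.

Lemma xd_sum : xd o0 + xd o1 + xd o2 = 0.
Proof.
rewrite (@xdE o0 o1 o2) // (@xdE o1 o2 o0) // (@xdE o2 o0 o1) // -!scalerDr.
rewrite (hC o2 o0) (hC o0 o1) (hC o1 o2).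
have id (a b c : M) : a - c + (b - a) + (c - b) = 0.
  by rewrite (addrC (a - c)) (addrA (b - a)) subrK addrA subrK subrr.
by rewrite id scaler0.
Qed.

Definition gen i j := if i == j then xd i else x i j.

Lemma third_index (i j : 'I_3) : i != j -> exists2 k, j != k & i != k.
Proof.
by move: i j; do 2![apply: I3P] => // _; [exists o2|exists o1|exists o2|exists o0|exists o1|exists o0].
Qed.

Lemma lie_xd_row i j : i != j -> lie (xd i) (x i j) = x i j.
Proof.
move=> ij; have [k jk ik] := third_index ij; have [ji kj ki] := sym3 ij jk ik.
by rewrite (xdE ij jk ik) lieZl lieDl (h_self ij jk ik) (h_row ik kj ij) third.
Qed.

Lemma lie_xd_col i j : i != j -> lie (xd j) (x i j) = - x i j.
Proof.
move=> ij; have [k jk ik] := third_index ij; have [ji kj ki] := sym3 ij jk ik.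
rewrite (xdE ji ik jk) lieZl lieDl (h_col jk ki ji) hC lieNl (h_self ij jk ik).
by rewrite -opprD scalerN third.
Qed.

Lemma lie_xd_other i j k : i != j -> j != k -> i != k -> lie (xd k) (x i j) = 0.
Proof.
move=> ij jk ik; have [ji kj ki] := sym3 ij jk ik.
rewrite (xdE ki ij kj) lieZl lieDl hC lieNl (h_row ik kj ij) hC lieNl (h_col jk ki ji).
by rewrite opprK addNr scaler0.
Qed.

Lemma lie_xd_xd i j : lie (xd i) (xd j) = 0.
Proof.
have [->|ij] := eqVneq i j; first by rewrite /lie subrr.
have [k jk ik] := third_index ij; have [ji kj ki] := sym3 ij jk ik.
have hij : lie (h i j) (h j k) = 0 by rewrite (hC j i) lieNl (h_h ji ik jk) oppr0.
have hik : lie (h i k) (h j k) = 0.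
  by rewrite (hC k i) (hC k j) lieNl lieNr (h_h ki ij kj) !oppr0.
rewrite (xdE ij jk ik) (xdE jk ki ji) lieZl lieZr.
have four (a b c d : M) : lie (a + b) (c + d) = lie a c + lie a d + (lie b c + lie b d).
  by rewrite lieDl !lieDr.
rewrite four hij hik (hC i j) !lieNr (h_h ik kj ij) [lie (h i j) (h i j)]subrr.
by rewrite !(oppr0, addr0) !scaler0.
Qed.

Lemma lie_gen i j k l :
  lie (gen i j) (gen k l) = gen i l *+ (j == k) - gen k j *+ (i == l).
Proof.
have diag_off a b c : b != c ->
    lie (xd a) (x b c) = x a c *+ (a == b) - x b a *+ (a == c).
  move=> bc; have [->|ab] := eqVneq a b.
    by rewrite (negPf bc) subr0 lie_xd_row.
  have [->|ac] := eqVneq a c; first by rewrite sub0r lie_xd_col.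
  by rewrite subr0 lie_xd_other // eq_sym.
rewrite /gen; have [<-|ij] := eqVneq i j; have [<-|kl] := eqVneq k l.
- rewrite lie_xd_xd; have [->|ik] := eqVneq i k; first by rewrite subrr.
  by rewrite subr0.
- rewrite diag_off //; have [->|ik] := eqVneq i k; first by rewrite (negPf kl).
  by [].
- rewrite lieC diag_off // opprB [k == i]eq_sym [k == j]eq_sym.
  by case: (eqVneq i k) => ik; case: (eqVneq j k) => jk //; move: ij; rewrite ik jk eqxx.
have [jk|jk] := eqVneq j k; have [il|il] := eqVneq i l.
- have [m jm im] := third_index ij.
  by rewrite !mulr1n -jk -il (xdB ij jm im).
- by rewrite -jk in kl *; rewrite subr0 x_comp.
- by rewrite -il in kl *; rewrite sub0r lieC x_comp // eq_sym.
rewrite subr0; have [ik|ik] := eqVneq i k.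
  rewrite -ik in kl *; have [<-|jl] := eqVneq j l; first by rewrite /lie subrr.
  exact: x_row.
have jl : j = l by move: i j k l ij kl jk il ik; do 4![apply: I3P].
by rewrite -jl in kl *; apply: x_col => //; rewrite eq_sym.
Qed.
End Gl3.

Lemma mx_delta_ind (F : pzRingType) m n (P : 'M[F]_(m, n) -> Prop) :
  (forall A B, P A -> P B -> P (A + B)) -> (forall a A, P A -> P (a *: A)) ->
  (forall i j, P (delta_mx i j)) -> P 0 -> forall A, P A.
Proof.
move=> PD PZ Pd P0 A; rewrite (matrix_sum_delta A).
by do 2![apply: (big_ind P) => // ? _]; apply: PZ.
Qed.

Section LinearExtension.
Variables (F : fieldType) (n : nat).
Notation M := 'M[F]_n.+1.
Variable y : 'I_3 -> 'I_3 -> M.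

Definition ext (A : 'M[F]_3) : M := \sum_i \sum_j A i j *: y i j.

Lemma extD A B : ext (A + B) = ext A + ext B.
Proof.
rewrite /ext -big_split; apply: eq_bigr => i _; rewrite -big_split; apply: eq_bigr => j _.
by rewrite mxE scalerDl.
Qed.

Lemma extZ a A : ext (a *: A) = a *: ext A.
Proof.
rewrite /ext scaler_sumr; apply: eq_bigr => i _; rewrite scaler_sumr; apply: eq_bigr => j _.
by rewrite mxE scalerA.
Qed.

Lemma extN A : ext (- A) = - ext A.
Proof. by rewrite -scaleN1r extZ scaleN1r. Qed.

Lemma extB A B : ext (A - B) = ext A - ext B.
Proof. by rewrite extD extN. Qed.

Lemma ext0 : ext 0 = 0.
Proof. by rewrite -(scale0r 0) extZ scale0r. Qed.

Lemma ext_delta i j : ext (delta_mx i j) = y i j.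
Proof.
rewrite /ext (bigD1 i) //= (bigD1 j) //= mxE !eqxx scale1r !big1 ?addr0 // => k ki.
  by apply: big1 => l _; rewrite mxE (negPf ki) scale0r.
by rewrite mxE (negPf ki) andbF scale0r.
Qed.

Hypothesis lie_y : forall i j k l,
  lie (y i j) (y k l) = y i l *+ (j == k) - y k j *+ (i == l).
Hypothesis y_sum : y o0 o0 + y o1 o1 + y o2 o2 = 0.

Lemma ext1 : ext 1 = 0.
Proof.
have -> : 1 = delta_mx o0 o0 + delta_mx o1 o1 + delta_mx o2 o2 :> 'M[F]_3.
  by rewrite mx3_1r !mx3_delta !mx3D; apply: mx3_eq; rewrite /= ?(addr0, add0r).
by rewrite !extD !ext_delta.
Qed.

Lemma lie_ext A B : lie (ext A) (ext B) = ext (lie A B).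
Proof.
elim/mx_delta_ind: A => [A A' IH IH' | a A IH | i j |].
- by rewrite [ext (A + A')]extD !lieDl IH IH' -extD.
- by rewrite extZ !lieZl IH extZ.
- elim/mx_delta_ind: B => [B B' IH IH' | b B IH | k l |].
  + by rewrite [ext (_ + B')]extD !lieDr IH IH' -extD.
  + by rewrite extZ !lieZr IH extZ.
  + rewrite !ext_delta lie_y /lie -!mulmxE !mul_delta_mx_cond extB.
    rewrite [l == i]eq_sym; case: (j == k); case: (i == l);
    by rewrite ?mulr1n ?mulr0n ?ext_delta ?ext0.
  + by rewrite ext0 !lie0r ext0.
- by rewrite ext0 !lie0l ext0.
Qed.
End LinearExtension.

(** * Logarithms of the images of elementary matrices *)

Section Rep.
Variables (F : fieldType) (n : nat).
Hypothesis ch0 : [pchar F] =i pred0.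
Notation M := 'M[F]_n.+1.
Variable phi : 'M[int]_3 -> M.
Hypothesis phi1 : phi 1 = 1.
Hypothesis phiM : forall g h, \det g = 1 -> \det h = 1 -> phi (g * h) = phi g * phi h.

Lemma phi_unit g : \det g = 1 -> phi g \is a GRing.unit.
Proof.
move=> dg; have ug : g \is a GRing.unit by rewrite unitmxE dg unitr1.
have dg' : \det g^-1 = 1 by rewrite det_inv dg invr1.
by apply/unitrP; exists (phi g^-1); rewrite -!phiM // ?mulVr ?mulrV.
Qed.

(** A multiple of the orders of all eigenvalues of the images of elementary matrices, by
    [heisenberg_eigenvalue]. The factorial of [n.+2] is greater than 1 even in dimension one, as a
    congruence modulus has to be. *)
Definition N := (n.+2)`!.
Definition g i j := phi (E i j 1).

Lemma phiEX i j (k : nat) : i != j -> phi (E i j k%:Z) = g i j ^+ k.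
Proof.
move=> ij; elim: k => [|k IH]; first by rewrite E0.
by rewrite intS -EE // phiM ?det_E // IH exprS.
Qed.

Lemma E_comp i j k (a b : int) : i != j -> j != k -> i != k ->
  E i j a * E j k b = E j k b * E i k (a * b) * E i j a.
Proof.
move: i j k; do 3![apply: I3P] => // _ _ _.
all: by rewrite !E_mx3 //= !mx3M; apply: mx3_eq; ring.
Qed.

Lemma E_row i j k (a b : int) : i != j -> j != k -> i != k ->
  E i j a * E i k b = E i k b * E i j a.
Proof.
move: i j k; do 3![apply: I3P] => // _ _ _.
all: by rewrite !E_mx3 //= !mx3M; apply: mx3_eq; ring.
Qed.

Lemma E_col i j k (a b : int) : i != j -> j != k -> i != k ->
  E i k a * E j k b = E j k b * E i k a.
Proof.
move: i j k; do 3![apply: I3P] => // _ _ _.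
all: by rewrite !E_mx3 //= !mx3M; apply: mx3_eq; ring.
Qed.

Lemma third3 (i j : 'I_3) : i != j -> exists k, [/\ j != k, i != k, j != i, k != j & k != i].
Proof.
move=> ij; have [k jk ik] := third_index ij; exists k.
by rewrite ![k == _]eq_sym [j == i]eq_sym.
Qed.

Lemma E_unipotent i j : i != j -> (g i j ^+ N - 1) ^+ n.+1 = 0.
Proof.
move=> ij; have [k [jk ik ji kj ki]] := third3 ij.
apply: (@heisenberg_unipotent _ _ (g i k) (g k j)).
- by apply: phi_unit; apply: det_E.
- by apply: phi_unit; apply: det_E.
- by rewrite /g -!phiM ?det_E // E_row.
- by rewrite /g -!phiM ?det_E // E_col.
rewrite /g -!phiM ?det_mulmx ?det_E ?mulr1 //.
by rewrite (E_comp 1 1 ik kj ij) mulr1 E_col.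
Qed.

Lemma exists_log : exists X : 'I_3 -> 'I_3 -> M, forall i j, i != j ->
  logof (phi (E i j N%:Z)) (X i j) /\ subalg (eq (X i j)) (phi (E i j N%:Z)).
Proof.
have H ij : exists Y : M, ij.1 != ij.2 ->
    logof (phi (E ij.1 ij.2 N%:Z)) Y /\ subalg (eq Y) (phi (E ij.1 ij.2 N%:Z)).
  case: ij => i j /=; have [->|ij] := eqVneq i j; first by exists 0.
  have [Y] : exists2 Y, logof (phi (E i j N%:Z)) Y & subalg (eq Y) (phi (E i j N%:Z)).
    rewrite phiEX //; apply: (@unipotent_log _ _ ch0 _ n.+1).
    exact: E_unipotent.
  by move=> *; exists Y.
have [X HX] := fin_all_exists H.
by exists (fun i j => X (i, j)) => i j ij; apply: (HX (i, j)).
Qed.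

Section Logs.
Variable X : 'I_3 -> 'I_3 -> M.
Hypothesis XP : forall i j, i != j ->
  logof (phi (E i j N%:Z)) (X i j) /\ subalg (eq (X i j)) (phi (E i j N%:Z)).

Lemma log_conj (c u u' Y Y' : M) : c \is a GRing.unit -> logof u Y -> logof u' Y' ->
  c * u = u' * c -> c * Y = Y' * c.
Proof.
move=> uc uY u'Y' cu; have := logofJ uc uY; rewrite cu mulrK // => /(logof_inj ch0 u'Y') ->.
by rewrite mulrVK.
Qed.

(** Conjugation by [E i j 1] takes [E j k N] to the product of the commuting matrices [E j k N] and
    [E i k N], and the logarithm of such a product is the sum of the logarithms. *)
Lemma conj_comp i j k : i != j -> j != k -> i != k ->
  g i j * X j k = (X j k + X i k) * g i j.
Proof.
move=> ij jk ik; have [Xjk _] := XP jk; have [Xik _] := XP ik.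
have XX : logof (phi (E j k N%:Z) * phi (E i k N%:Z)) (X j k + X i k).
  by apply: logofM => //; rewrite /GRing.comm -!phiM ?det_E // E_col // eq_sym.
apply: (log_conj _ Xjk XX); first by apply: phi_unit; apply: det_E.
by rewrite /g -!phiM ?det_mulmx ?det_E ?mulr1 // (E_comp 1 _ ij jk ik) mul1r.
Qed.

Lemma conj_comm i j k l : i != j -> k != l -> j != k -> i != l ->
  g i j * X k l = X k l * g i j.
Proof.
move=> ij kl jk il; have [Xkl _] := XP kl.
apply: (log_conj _ Xkl Xkl); first by apply: phi_unit; apply: det_E.
rewrite /g -!phiM ?det_E //; congr (phi _).
have [ik|ik] := eqVneq i k; last first.
  have -> : l = j by clear -ij kl jk il ik; move: i j k l ij kl jk il ik; do 4![apply: I3P].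
  by rewrite E_col // eq_sym.
rewrite -ik in kl *; have [->|lj] := eqVneq l j; first by rewrite !EE // addrC.
by rewrite E_row // eq_sym.
Qed.

Lemma conj_comp' i j k : i != j -> j != k -> i != k ->
  g i j * X k i = (X k i - X k j) * g i j.
Proof.
move=> ij jk ik; have ki : k != i by rewrite eq_sym. have kj : k != j by rewrite eq_sym.
have [Xki _] := XP ki; have [Xkj _] := XP kj.
have XX : logof (phi (E k i N%:Z) * phi (E k j N%:Z)) (X k i + X k j).
  by apply: logofM => //; rewrite /GRing.comm -!phiM ?det_E // E_row.
have ug : g i j \is a GRing.unit by apply: phi_unit; apply: det_E.
have : (g i j)^-1 * X k i = (X k i + X k j) * (g i j)^-1.
  apply: (log_conj _ Xki XX); first by rewrite unitrV.
  apply: (mulrI ug); rewrite mulVKr //; apply: (mulIr ug).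
  rewrite -!mulrA mulVr // mulr1 /g -!phiM ?det_mulmx ?det_E ?mulr1 //.
  by rewrite (E_comp _ 1 ki ij kj) mulr1 [E k i _ * E k j _]E_row // mulrA.
move/(congr1 (fun Z => g i j * Z * g i j)); rewrite mulVKr // mulrDl mulrDr mulrDl.
by rewrite -!mulrA mulVr // !mulr1 mulrBl => ->; rewrite (@conj_comm i j k j) // addrK.
Qed.

Lemma conj_comp_X i j k c : i != j -> j != k -> i != k ->
  g i j ^+ c * X j k = (X j k + X i k *+ c) * g i j ^+ c.
Proof.
move=> ij jk ik; elim: c => [|c IH]; first by rewrite expr0 mulr0n addr0 mulr1 mul1r.
have cX : g i j ^+ c * X i k = X i k * g i j ^+ c.
  by apply/esym/commrX/esym; apply: conj_comm => //; rewrite eq_sym.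
by rewrite exprSr -mulrA conj_comp // mulrA mulrDr IH cX -mulrDl -addrA -mulrSr mulrA.
Qed.

(** The matrix [phi (E i j N)] is the power [N] of [g i j], and each factor [g i j] moves [X j k] by
    [X i k], so the velocity is [X i k *+ N]. Dividing all logarithms by [N] then gives the
    structure constants of sl3. *)
Lemma lie_X_comp i j k : i != j -> j != k -> i != k -> lie (X i j) (X j k) = X i k *+ N.
Proof.
move=> ij jk ik; have [Xij _] := XP ij; apply: (logof_commutator ch0 Xij) => b.
by rewrite phiEX // -exprM conj_comp_X // mulrnA.
Qed.

Lemma lie_X_comm i j k l : i != j -> k != l -> j != k -> i != l -> lie (X i j) (X k l) = 0.
Proof.
move=> ij kl jk il; have [Xij _] := XP ij; apply: (logof_commutator ch0 Xij) => b.
rewrite phiEX // -exprM mul0rn addr0.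
by apply/esym/commrX/esym; apply: conj_comm.
Qed.

Let N0 : N%:R != 0 :> F. Proof. by rewrite ((pcharf0P F).1 ch0) -lt0n fact_gt0. Qed.

Definition x i j := N%:R^-1 *: X i j.

Lemma lie_x_comp i j k : i != j -> j != k -> i != k -> lie (x i j) (x j k) = x i k.
Proof.
move=> ij jk ik; rewrite /x lieZl lieZr lie_X_comp //; congr (_ *: _).
by rewrite -scaler_nat scalerA mulVf // scale1r.
Qed.

Lemma lie_x_comm i j k l : i != j -> k != l -> j != k -> i != l -> lie (x i j) (x k l) = 0.
Proof. by move=> *; rewrite /x lieZl lieZr lie_X_comm // !scaler0. Qed.

End Logs.
End Rep.

Lemma delta_row_conj (F : comNzRingType) (k l j : 'I_3) : k != l -> l != j -> k != j ->
  E k l 1 * delta_mx l j * E k l (-1) = delta_mx l j + delta_mx k j :> 'M[F]_3.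
Proof.
move: k l j; do 3![apply: I3P] => // _ _ _.
all: by rewrite !E_mx3 //= !mx3_delta /= !mx3M mx3D; apply: mx3_eq; ring.
Qed.

Lemma delta_col_conj (F : comNzRingType) (k l i : 'I_3) : k != l -> l != i -> k != i ->
  E k l 1 * delta_mx i k * E k l (-1) = delta_mx i k - delta_mx i l :> 'M[F]_3.
Proof.
move: k l i; do 3![apply: I3P] => // _ _ _.
all: by rewrite !E_mx3 //= !mx3_delta /= !mx3M mx3N mx3D; apply: mx3_eq; ring.
Qed.

Lemma delta_comm_conj (F : comNzRingType) (k l i j : 'I_3) : k != l -> l != i -> k != j ->
  E k l 1 * delta_mx i j * E k l (-1) = delta_mx i j :> 'M[F]_3.
Proof.
move=> kl li kj; have -> : E k l 1 * delta_mx i j = delta_mx i j * E k l 1 :> 'M[F]_3.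
  rewrite /E -!mulmxE mulmxDl mulmxDr mul1mx mulmx1 -scalemxAl -scalemxAr.
  by rewrite !mul_delta_mx_0 // eq_sym.
by rewrite -mulrA EE // subrr E0 mulr1.
Qed.

Lemma lie_delta (F : comNzRingType) (i j k : 'I_3) : i != k ->
  lie (delta_mx i j) (delta_mx j k) = delta_mx i k :> 'M[F]_3.
Proof.
by move=> ik; rewrite /lie -!mulmxE mul_delta_mx mul_delta_mx_0 1?eq_sym // subr0.
Qed.

Lemma lie_delta_diag (F : comNzRingType) (i j : 'I_3) :
  lie (delta_mx i j) (delta_mx j i) = delta_mx i i - delta_mx j j :> 'M[F]_3.
Proof. by rewrite /lie -!mulmxE !mul_delta_mx. Qed.

Lemma delta_sum3 (F : comNzRingType) (i j k : 'I_3) : i != j -> j != k -> i != k ->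
  delta_mx i i + delta_mx j j + delta_mx k k = 1 :> 'M[F]_3.
Proof.
move: i j k; do 3![apply: I3P] => // _ _ _.
all: by rewrite !mx3_delta /= !mx3D mx3_1r; apply: mx3_eq; ring.
Qed.

(** The compatibility with conjugation passes to sums, multiples and brackets. It is checked on the
    matrix units whose conjugate by a one-parameter group [E k l c] is at most linear in c;
    [delta_mx l k], where it is quadratic, is reached as a bracket. *)
Theorem lie_rep (F : fieldType) n (phi : 'M[int]_3 -> 'M[F]_n.+1) :
  [pchar F] =i pred0 -> phi 1 = 1 ->
  (forall g h, \det g = 1 -> \det h = 1 -> phi (g * h) = phi g * phi h) ->
  exists y : 'I_3 -> 'I_3 -> 'M[F]_n.+1,
  [/\ forall i j k l, lie (y i j) (y k l) = y i l *+ (j == k) - y k j *+ (i == l),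
      forall k l A, k != l -> phi (E k l 1) * ext y A =
        ext y (E k l 1 * A * E k l (-1)) * phi (E k l 1)
    & forall k l, k != l ->
        subalg (fun z => exists A, z = ext y A) (phi (E k l (N n)%:Z))].
Proof.
move=> ch0 phi1 phiM.
have [X XP] := exists_log ch0 phi1 phiM.
have xc i j k := @lie_x_comp F n ch0 phi phi1 phiM X XP i j k.
have xr i j k : i != j -> j != k -> i != k -> lie (x X i j) (x X i k) = 0.
  by move=> ij jk ik; apply: (lie_x_comm ch0 phi1 phiM XP); rewrite // eq_sym.
have xl i j k : i != j -> j != k -> i != k -> lie (x X i k) (x X j k) = 0.
  by move=> ij jk ik; apply: (lie_x_comm ch0 phi1 phiM XP); rewrite // eq_sym.
pose y := gen (x X).
have lie_y := lie_gen ch0 xc xr xl.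
have y_sum : y o0 o0 + y o1 o1 + y o2 o2 = 0 by apply: xd_sum.
have yE i j : i != j -> y i j = x X i j by rewrite /y /gen => /negPf ->.
exists y; split=> //; last first.
  move=> k l kl; have [_] := XP k l kl; apply: subalg_sub => _ <-.
  apply: subalg_gen; exists ((N n)%:R *: delta_mx k l).
  rewrite extZ ext_delta yE // /x scalerA mulfV ?scale1r //.
  by rewrite ((pcharf0P F).1 ch0) -lt0n fact_gt0.
move=> k l A kl.
set c := phi _; have [e eE] : exists e, e = E k l 1 :> 'M[F]_3 by exists (E k l 1).
have [e' e'E] : exists e', e' = E k l (-1) :> 'M[F]_3 by exists (E k l (-1)).
have [e'e ee'] : e' * e = 1 /\ e * e' = 1 by rewrite eE e'E !EE // addNr subrr E0.
rewrite -eE -e'E; pose co B : 'M[F]_3 := e * B * e'.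
pose P B := c * ext y B = ext y (co B) * c.
have PD B C : P B -> P C -> P (B + C).
  by move=> PB PC; rewrite /P /co mulrDr mulrDl !extD mulrDr mulrDl PB PC.
have PZ a B : P B -> P (a *: B).
  by move=> PB; rewrite /P /co -scalerAr -scalerAl !extZ -scalerAr -scalerAl PB.
have PL B C : P B -> P C -> P (lie B C).
  move=> PB PC; have coM U V : co (U * V) = co U * co V.
    by rewrite /co !mulrA -[_ * e' * e]mulrA e'e mulr1.
  have -> : P (lie B C) <-> c * ext y (lie B C) = ext y (lie (co B) (co C)) * c.
    by rewrite /P /lie -!coM /co mulrBr mulrBl.
  rewrite -!lie_ext // /lie mulrBr mulrBl !mulrA PB PC -!mulrA PC PB.
  by [].
have P1 : P 1 by rewrite /P /co mulr1 ee' ext1 // mulr0 mul0r.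
suff Pd i j : P (delta_mx i j).
  by elim/mx_delta_ind: A => //; rewrite /P /co mulr0 mul0r ext0 mulr0 mul0r.
have Poff a b : a != b -> ~~ ((a == l) && (b == k)) -> P (delta_mx a b).
  move=> ab; rewrite /P /co eE e'E ext_delta yE // /x -scalerAr.
  have [al|al] := eqVneq a l => /= [bk|_].
    rewrite {}al in ab *; rewrite eq_sym in bk.
    rewrite delta_row_conj // extD !ext_delta !yE // /x -scalerDr -scalerAl.
    by congr (_ *: _); apply: (conj_comp ch0 phi1 phiM XP).
  have [bk|bk] := eqVneq b k.
    rewrite {}bk in ab *; have [ka la] : k != a /\ l != a by rewrite ![_ == a]eq_sym.
    rewrite delta_col_conj // extB !ext_delta !yE // /x -scalerBr -scalerAl.
    by congr (_ *: _); apply: (conj_comp' ch0 phi1 phiM XP) => //; rewrite eq_sym.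
  have [la kb] : l != a /\ k != b by rewrite eq_sym [k == b]eq_sym.
  rewrite delta_comm_conj // ext_delta yE // /x -scalerAl.
  by congr (_ *: _); apply: (conj_comm ch0 phi1 phiM XP); rewrite // eq_sym.
have Poff' a b : a != b -> P (delta_mx a b).
  move=> ab; have [/andP[/eqP-> /eqP->]|/Poff] := boolP ((a == l) && (b == k)); last exact.
  have [m lm km] := third_index kl.
  have [mk ml lk] : [/\ m != k, m != l & l != k] by rewrite ![_ == l]eq_sym [m == k]eq_sym [l == k]eq_sym.
  rewrite -(@lie_delta _ l m k) //.
  by apply: PL; apply: Poff => //; rewrite ?(negPf mk) ?(negPf ml) ?andbF.
have [ij|ij] := boolP (i == j); last exact: Poff'.
rewrite -(eqP ij) {j ij}; have [j ij _] : exists2 j, i != j & true.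
  by move: (i); apply: I3P; [exists o1|exists o0|exists o0].
have [m jm im] := third_index ij.
have Pd a b : a != b -> P (delta_mx a a - delta_mx b b).
  by move=> ab; rewrite -lie_delta_diag; apply: PL; apply: Poff'; rewrite // eq_sym.
have three0 : 3 != 0 :> F by rewrite ((pcharf0P F).1 ch0).
(* Differences of diagonal units are brackets, and the identity is sent to 0; together they give
   each diagonal unit after division by 3. *)
have -> : delta_mx i i = 3^-1 *: (1 + ((delta_mx i i - delta_mx j j) + (delta_mx i i - delta_mx m m))) :> 'M[F]_3.
  rewrite -(delta_sum3 F ij jm im); set a := delta_mx i i; set b := delta_mx j j; set d := delta_mx m m.
  have -> : a + b + d + (a - b + (a - d)) = a + a + a.
    by rewrite addrACA [X in X + _]addrACA subrr addr0 [d + _]addrC subrK.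
  by rewrite -mulr2n -mulrSr -scaler_nat scalerA mulVf // scale1r.
by apply: (PZ); apply: (PD) => //; apply: (PD); apply: (Pd).
Qed.

(** By Cayley-Hamilton the inverse is a polynomial in [X]: the constant term of the characteristic
    polynomial is the determinant up to sign. *)
Lemma subalgV (F : fieldType) n (S : 'M[F]_n.+1 -> Prop) X :
  X \is a GRing.unit -> subalg S X -> subalg S X^-1.
Proof.
move=> uX SX; have := Cayley_Hamilton X; have := char_poly_det X.
elim/poly_ind: (char_poly X) => [|p c _].
  move/eqP; rewrite coef0 eq_sym mulf_eq0 signr_eq0 /= => /eqP d0.
  by rewrite unitmxE d0 unitr0 in uX.
rewrite coefD coefMX coefC /= add0r => cE.
rewrite rmorphD rmorphM /= horner_mx_X horner_mx_C => /eqP; rewrite addr_eq0 => /eqP pX.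
have c0 : c != 0 by rewrite cE mulf_neq0 ?signr_eq0 // -unitfE -unitmxE.
have -> : X^-1 = (- c^-1)%:M * horner_mx X p.
  apply: (mulIr uX); rewrite mulVr // -mulrA pX.
  rewrite mulrN -[_ * _]scalar_mxM -raddfN /= -mulNr opprK.
  by rewrite mulVf.
by apply: subalg_mul; [apply: subalg_scalar | apply: subalg_horner].
Qed.

(** * Compatibility of the group with the derived representation *)

Section Equivariance.
Variables (F : fieldType) (n : nat).
Hypothesis ch0 : [pchar F] =i pred0.
Notation M := 'M[F]_n.+1.
Variable phi : 'M[int]_3 -> M.
Hypothesis phi1 : phi 1 = 1.
Hypothesis phiM : forall g h, \det g = 1 -> \det h = 1 -> phi (g * h) = phi g * phi h.
Variable y : 'I_3 -> 'I_3 -> M.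
Hypothesis phiD : forall k l A, k != l -> phi (E k l 1) * ext y A =
        ext y (E k l 1 * A * E k l (-1)) * phi (E k l 1).
Hypothesis phiR : forall k l, k != l ->
        subalg (fun z => exists A, z = ext y A) (phi (E k l (N n)%:Z)).

Notation D := (ext y).
Notation Ralg := (subalg (fun z => exists A, z = D A)).
Notation iota A := (map_mx (intr : int -> F) A : 'M[F]_3).

Lemma phiV g : \det g = 1 -> phi g^-1 = (phi g)^-1.
Proof.
move=> dg; have ug : g \is a GRing.unit by rewrite unitmxE dg unitr1.
have up := phi_unit phi1 phiM dg.
by apply: (mulrI up); rewrite mulrV // -phiM ?mulrV // det_inv dg invr1.
Qed.

Lemma phiX g k : \det g = 1 -> phi (g ^+ k) = phi g ^+ k.
Proof.
move=> dg; have dgk j : \det (g ^+ j) = 1.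
  by elim: j => [|j IH]; rewrite ?expr0 ?det1 // exprS det_mulmx dg IH mulr1.
by elim: k => [|k IH]; rewrite ?expr0 // !exprS phiM // IH.
Qed.

(** The determinant is part of the condition because [phi] is known to be multiplicative only at
    determinant 1. *)
Definition equivariant g := \det g = 1 /\
  forall A, phi g * D A = D (iota g * A * (iota g)^-1) * phi g.

Lemma iota_unit g : \det g = 1 -> iota g \is a GRing.unit.
Proof. by move=> dg; rewrite unitmxE det_map_mx dg rmorph1 unitr1. Qed.

Lemma equivM g h : equivariant g -> equivariant h -> equivariant (g * h).
Proof.
move=> [dg Hg] [dh Hh]; split; first by rewrite det_mulmx dg dh mulr1.
move=> A; have [ug uh] := (iota_unit dg, iota_unit dh).
rewrite phiM // -mulrA Hh mulrA Hg rmorphM /= -!mulrA; congr (D _ * _).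
by rewrite invrM // !mulrA.
Qed.

Lemma equivV g : equivariant g -> equivariant g^-1.
Proof.
move=> [dg Hg]; split; first by rewrite det_inv dg invr1.
move=> A; have ug := iota_unit dg; have up := phi_unit phi1 phiM dg.
rewrite phiV //; apply: (mulrI up); rewrite mulVKr // [RHS]mulrA Hg -[RHS]mulrA mulrV // mulr1.
have -> : iota g^-1 = (iota g)^-1.
  have ug0 : g \is a GRing.unit by rewrite unitmxE dg unitr1.
  have e : iota g * iota g^-1 = 1 by rewrite -rmorphM (mulrV ug0) rmorph1.
  by apply: (mulrI ug); rewrite e mulrV.
by rewrite invrK !mulrA mulrV // mul1r mulrK.
Qed.

Lemma iotaE i j a : iota (E i j a) = E i j a%:~R.
Proof.
rewrite /E map_mxD map_mx1; congr (_ + _); apply/matrixP => k l.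
by rewrite !mxE /= intrM; case: (_ && _).
Qed.

Lemma equivE i j : i != j -> equivariant (E i j 1).
Proof.
move=> ij; split; first exact: det_E.
move=> A; rewrite phiD // iotaE; congr (D (_ * _) * _).
apply: (@mulrI _ (E i j 1)); first by rewrite unitmxE det_E ?unitr1.
by rewrite EE // subrr E0 mulrV // unitmxE det_E ?unitr1.
Qed.

Lemma RalgJ g X : equivariant g -> Ralg X -> Ralg (phi g * X * (phi g)^-1).
Proof.
move=> [dg Hg]; have up := phi_unit phi1 phiM dg.
elim=> {X} [x [A ->] | a | X Z _ IX _ IZ | X Z _ IX _ IZ].
- by rewrite Hg mulrK //; apply: subalg_gen; exists (iota g * A * (iota g)^-1).
- have -> : phi g * a%:M * (phi g)^-1 = a%:M.
    by rewrite -[phi g * _]/(phi g *m _) scalar_mxC -[_ *m _]/(_ * _) mulrK.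
  exact: subalg_scalar.
- by rewrite mulrDr mulrDl; apply: subalg_add.
- have -> : phi g * (X * Z) * (phi g)^-1 =
      (phi g * X * (phi g)^-1) * (phi g * Z * (phi g)^-1).
    by rewrite !mulrA mulrVK.
  exact: subalg_mul.
Qed.

(** The torsion statement is applied with [K] the equivariant matrices whose image lies in the
    enveloping algebra. This [K] is normal by [RalgJ], and stable under inverses by [subalgV]. *)
Lemma equiv_torsion g : equivariant g -> exists2 m, (0 < m)%N & Ralg (phi (g ^+ m)).
Proof.
move=> Eg; have N1 : (1 < N n)%N.
  by rewrite /N factS; move: (fact_gt0 n.+1); nia.
have [] := @normal_torsion equivariant (fun k => equivariant k /\ Ralg (phi k)) (N n) N1 _ _ _ _ _ _ _ _ _ g Eg.
- by move=> h [].
- exact: equivM.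
- exact: equivV.
- exact: equivE.
- by move=> h [].
- move=> h k [Eh Rh] [Ek Rk]; split; first exact: equivM.
  by rewrite phiM //; [apply: subalg_mul | case: Eh | case: Ek].
- move=> h [Eh Rh]; split; first exact: equivV.
  by have [dh _] := Eh; rewrite phiV //; apply: subalgV => //; apply: phi_unit.
- move=> h k Eh [Ek Rk]; have [dh _] := Eh; have [dk _] := Ek; split.
    by apply: equivM; [apply: equivM | apply: equivV].
  rewrite phiM ?phiM ?phiV ?det_mulmx ?det_inv ?dh ?dk ?mulr1 ?invr1 //.
  exact: RalgJ.
- move=> i j ij; split; last exact: phiR.
  rewrite -[(N n)%:Z]mulr1; apply: E_closed => //.
  + by rewrite -(E0 _ i j) -(subrr 1) -EE // -EV //; apply: equivM; [|apply: equivV]; apply: equivE.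
  + exact: equivM.
  + exact: equivV.
  + exact: equivE.
by move=> m m0 [_ Rm]; exists m.
Qed.

Definition central z := Ralg z /\ forall A, z * D A = D A * z.

Lemma central_Ralg z X : central z -> Ralg X -> z * X = X * z.
Proof.
move=> [_ zD]; elim=> {X} [x [A ->] | a | X Z _ IX _ IZ | X Z _ IX _ IZ].
- exact: zD.
- by rewrite -[z * _]/(z *m _) scalar_mxC.
- by rewrite mulrDr mulrDl IX IZ.
- by rewrite mulrA IX -mulrA IZ mulrA.
Qed.

(* Conjugation by [E i j c] is polynomial in [c] on the enveloping algebra, so an element
   commuting with [E i j N] and all its powers commutes with [E i j 1]. *)
Lemma conj_poly i j X : i != j -> Ralg X ->
  exists q : {poly M}, forall c : nat, phi (E i j 1) ^+ c * X = q.[c%:R] * phi (E i j 1) ^+ c.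
Proof.
move=> ij; set g := phi _; elim=> {X} [x [A ->] | a | X Z _ [p pX] _ [q qZ] | X Z _ [p pX] _ [q qZ]].
- pose d : 'M[F]_3 := delta_mx i j.
  exists ((D A)%:P + (D (d * A - A * d))%:P * 'X + (- D (d * A * d))%:P * 'X^2) => c.
  have -> : g ^+ c * D A = D (E i j c%:R * A * E i j (- c%:R)) * g ^+ c.
    elim: c => [|c IH]; first by rewrite expr0 oppr0 E0 mul1r !mulr1 mul1r.
    rewrite exprS -mulrA IH mulrA phiD // -mulrA -exprS; congr (D _ * _).
    by rewrite !mulrA EE // -!mulrA EE // -opprD nat1r natr1.
  congr (_ * _); rewrite !hornerD !hornerM_nat !hornerC !hornerX.
  have -> : E i j c%:R * A * E i j (- c%:R) =
      A + c%:R *: (d * A - A * d) + (c * c)%:R *: (- (d * A * d)).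
    rewrite /E -/d -[1%:M]/(1 : 'M[F]_3) mulrDl mul1r mulrDr mulr1.
    rewrite -!scalerAl -!scalerAr mulrDl -scalerAl natrM -scalerA.
    by rewrite !scaleNr !scalerN !scalerBr scalerDr opprD; rewrite !addrA.
  rewrite [D (A + _ + _)]extD [D (A + _)]extD !extZ extN -natrM.
  by rewrite !mulr_natr !scaler_nat.
- by exists (a%:M)%:P => c; rewrite hornerC -[_ * a%:M]/(_ *m _) scalar_mxC.
- by exists (p + q) => c; rewrite hornerD mulrDr mulrDl pX qZ.
- by exists (p * q) => c; rewrite hornerM_nat // mulrA pX -mulrA qZ mulrA.
Qed.

Lemma central_comm i j z : i != j -> central z -> phi (E i j 1) * z = z * phi (E i j 1).
Proof.
move=> ij cz; have [Rz _] := cz; have [q qP] := conj_poly ij Rz.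
have ug : phi (E i j 1) \is a GRing.unit by apply: phi_unit => //; apply: det_E.
have qz : q = z%:P.
  apply: (poly_nat_eq ch0 (fact_gt0 n.+2)) => b; rewrite hornerC.
  apply: (mulIr (unitrX ((N n) * b) ug)); rewrite -qP exprM.
  have -> : phi (E i j 1) ^+ N n = phi (E i j (N n)%:Z) by rewrite (phiEX phi1 phiM).
  apply/esym; apply: central_Ralg => //; apply: subalgX; exact: phiR.
by have := qP 1%N; rewrite qz hornerC expr1.
Qed.

End Equivariance.

(** * Matrices diagonal in a common basis *)

Section Diag.
Variables (F : fieldType) (n : nat).
Notation M := 'M[F]_n.+1.
Variable V : M.
Hypothesis uV : V \is a GRing.unit.
Implicit Types f : 'I_n.+1 -> F.

Definition dg f : M := V^-1 * diag_mx (\row_i f i) * V.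

Lemma dgM f f' : dg f * dg f' = dg (fun i => f i * f' i).
Proof.
rewrite /dg !mulrA mulrK // -[_ * diag_mx _ * diag_mx _]mulrA; congr (_ * _ * _).
by rewrite -mulmxE mulmx_diag; congr diag_mx; apply/rowP => i; rewrite !mxE.
Qed.

Lemma eq_dg f f' : f =1 f' -> dg f = dg f'.
Proof. by move=> e; rewrite /dg; congr (_ * diag_mx _ * _); apply/rowP => i; rewrite !mxE. Qed.

Lemma dgD f f' : dg f + dg f' = dg (fun i => f i + f' i).
Proof.
rewrite /dg -mulrDl -mulrDr -raddfD; congr (_ * diag_mx _ * _).
by apply/rowP => i; rewrite !mxE.
Qed.

Lemma dgZ a f : a *: dg f = dg (fun i => a * f i).
Proof.
rewrite /dg scalerAl scalerAr -linearZ; congr (_ * diag_mx _ * _).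
by apply/rowP => i; rewrite !mxE.
Qed.

Lemma dgC a : dg (fun=> a) = a%:M.
Proof.
rewrite /dg; have -> : diag_mx (\row__ a) = a%:M :> M.
  by rewrite -diag_const_mx; congr diag_mx; apply/rowP => i; rewrite !mxE.
by rewrite -[V^-1 * _]/(V^-1 *m _) scalar_mxC -[a%:M *m V^-1]/(a%:M * V^-1) mulrVK.
Qed.

Lemma dg1 : dg (fun=> 1) = 1. Proof. exact: dgC. Qed.

Lemma dgX f k : dg f ^+ k = dg (fun i => f i ^+ k).
Proof.
elim: k => [|k IH]; first by rewrite expr0 -dg1; apply: eq_dg.
by rewrite exprS IH dgM; apply: eq_dg => i; rewrite exprS.
Qed.

Lemma dg_horner f (p : {poly F}) : horner_mx (dg f) p = dg (fun i => p.[f i]).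
Proof.
elim/poly_ind: p => [|p c IH].
  rewrite rmorph0; transitivity (0%:M : M); first by rewrite raddf0.
  by rewrite -dgC; apply: eq_dg => i; rewrite horner0.
rewrite rmorphD rmorphM /= horner_mx_X horner_mx_C IH -(dgC c) dgM dgD.
by apply: eq_dg => i; rewrite hornerMXaddC.
Qed.

(** In the basis [V] the equation says that every nonzero entry of [Y] links equal eigenvalues.
    Identities between torus elements thus become identities between weights at one pair of
    indices. *)
Lemma dg_intertwine f f' (Y : M) :
  dg f * Y = Y * dg f' <-> forall k l, (V * Y * V^-1) k l != 0 -> f k = f' l.
Proof.
set Y' := V * Y * V^-1.
have -> : dg f * Y = Y * dg f' <->
    diag_mx (\row_i f i) * Y' = Y' * diag_mx (\row_i f' i).
  rewrite /dg /Y'; split=> e.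
    apply: (mulIr uV); apply: (mulrI (_ : V^-1 \is a GRing.unit)); first by rewrite unitrV.
    by rewrite -!mulrA mulVr // mulr1 !mulrA in e *; rewrite mulVr // mul1r.
  apply: (mulIr (_ : V^-1 \is a GRing.unit)); first by rewrite unitrV.
  apply: (mulrI uV).
  by rewrite !mulrA mulrV // mul1r mulrK // -!mulrA; rewrite -!mulrA in e.
clearbody Y'; split=> [e k l nz | e].
  apply: (mulfI nz); rewrite [LHS]mulrC.
  have := congr1 (fun Z : M => Z k l) e; rewrite /= -!mulmxE mul_diag_mx mul_mx_diag.
  by rewrite [LHS]mxE [RHS]mxE !mxE.
rewrite -!mulmxE mul_diag_mx mul_mx_diag; apply/matrixP => k l; rewrite !mxE mulrC.
by have [->|/e ->] := eqVneq (Y' k l) 0; rewrite ?mul0r.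
Qed.
End Diag.

(** Lagrange interpolation at integers. It turns a function of the weights, such as a power with the
    weight as exponent, into a polynomial in the weight operator. *)
Lemma int_interpolation (F : fieldType) (ks : seq int) (f : int -> F) :
  [pchar F] =i pred0 -> exists p : {poly F}, forall k, k \in ks -> p.[k%:~R] = f k.
Proof.
move=> ch0; elim: ks => [|k ks [p pE]]; first by exists 0.
have [kks|kks] := boolP (k \in ks).
  by exists p => l; rewrite inE => /orP[/eqP->|]; apply: pE.
pose q : {poly F} := \prod_(l <- ks) ('X - (l%:~R)%:P).
have qk : q.[k%:~R] != 0.
  rewrite horner_prod prodf_seq_neq0; apply/allP => l lks /=.
  rewrite hornerXsubC subr_eq0; apply: contra kks => /eqP /(intr_inj_pchar0 ch0) -> //.
have ql l : l \in ks -> q.[l%:~R] = 0.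
  move=> lks; apply/rootP; rewrite /q -(big_map (fun k => k%:~R) xpredT (fun x : F => 'X - x%:P)).
  by rewrite root_prod_XsubC; apply: map_f.
exists (p + ((f k - p.[k%:~R]) / q.[k%:~R]) *: q) => l.
rewrite inE hornerD hornerZ => /orP[/eqP->|lks]; first by rewrite divfK // addrC subrK.
by rewrite (ql _ lks) mulr0 addr0 pE.
Qed.

Lemma codiag_int (F : fieldType) n (A B : 'M[F]_n.+1) :
  A * B = B * A -> diagonalizable A -> diagonalizable B ->
  (forall a, eigenvalue A a -> exists k : int, a = k%:~R) ->
  (forall a, eigenvalue B a -> exists k : int, a = k%:~R) ->
  exists2 V : 'M[F]_n.+1, V \is a GRing.unit &
    exists a b : 'I_n.+1 -> int, A = dg V (fun i => (a i)%:~R) /\ B = dg V (fun i => (b i)%:~R).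
Proof.
move=> AB dA dB eA eB.
have [] : codiagonalizable [:: A; B].
  apply/codiagonalizableP; split.
    by move=> f g; rewrite !inE => /orP[]/eqP-> /orP[]/eqP->; rewrite /comm_mx.
  by move=> f; rewrite !inE => /orP[]/eqP->.
move=> V uV /= /and3P[/(similar_diagLR uV)[d Ad] /(similar_diagLR uV)[d' Bd] _].
exists V => //.
have key (C : 'M[F]_n.+1) (c : 'rV_n.+1) : C = conjmx (invmx V) (diag_mx c) ->
    (forall a, eigenvalue C a -> exists k : int, a = k%:~R) ->
    exists a : 'I_n.+1 -> int, C = dg V (fun i => (a i)%:~R).
  move=> CE eC; have {}CE : C = V^-1 * diag_mx c * V.
    by rewrite CE conjVmx.
  have H i : exists k : int, c 0 i = k%:~R.
    apply: eC; apply/eigenvalueP; exists (row i V).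
      rewrite -row_mul CE -[_ *m _]/(V * _) !mulrA mulrV // mul1r -mulmxE row_mul.
      by rewrite row_diag_mx -scalemxAl -rowE.
    apply/eqP => rV0; have : delta_mx 0 i = row i V *m V^-1 :> 'rV_n.+1.
      by rewrite rowE -mulmxA [V *m V^-1]mulrV // mulmx1.
    by rewrite rV0 mul0mx => /matrixP/(_ 0 i)/eqP; rewrite !mxE !eqxx oner_eq0.
  have [a aE] := fin_all_exists H; exists a; rewrite CE /dg; congr (_ * diag_mx _ * _).
  by apply/rowP => i; rewrite mxE -aE.
have [a aE] := key _ _ Ad eA; have [b bE] := key _ _ Bd eB.
by exists a, b.
Qed.

(** * The torus of 2 cos (2 pi / 7) *)

(* The eigenvalues of [w0] are 2 cos (2 pi / 7) and its conjugates; [w1] and [w2] are the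
   images of [w0] under the Galois group, which is realized by conjugation by [P0]. *)
Definition w0 : 'M[int]_3 := mx3 0 (-1) 0 (-1) 0 (-1) 0 (-1) (-1).
Definition w1 : 'M[int]_3 := mx3 (-1) 0 1 0 0 1 1 1 0.
Definition w2 : 'M[int]_3 := mx3 0 1 (-1) 1 (-1) 0 (-1) 0 0.
Definition P0 : 'M[int]_3 := mx3 0 0 (-1) (-1) 0 0 0 1 0.

Ltac mx3_ring := rewrite ?mx3_1r ?(mx3M, mx3D) ?mx3N ?(mx3M, mx3D); apply: mx3_eq; ring.

Lemma Pw0 : P0 * w0 = w1 * P0. Proof. by rewrite /P0 /w0 /w1; mx3_ring. Qed.
Lemma Pw1 : P0 * w1 = w2 * P0. Proof. by rewrite /P0 /w2 /w1; mx3_ring. Qed.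
Lemma w1E : w1 = w0 * w0 - 2%:R.
Proof. by rewrite /w0 /w1 -[2%:R]/(1 + 1); mx3_ring. Qed.
Lemma w012 : w0 * w1 * w2 = 1. Proof. by rewrite /w0 /w1 /w2; mx3_ring. Qed.
Lemma w01C : w0 * w1 = w1 * w0. Proof. by rewrite /w0 /w1 /w2; mx3_ring. Qed.
Lemma w02C : w0 * w2 = w2 * w0. Proof. by rewrite /w0 /w1 /w2; mx3_ring. Qed.
Lemma w12C : w1 * w2 = w2 * w1. Proof. by rewrite /w0 /w1 /w2; mx3_ring. Qed.
Lemma det_w0 : \det w0 = 1. Proof. by rewrite /w0 det_mx3; ring. Qed.
Lemma det_w1 : \det w1 = 1. Proof. by rewrite /w1 det_mx3; ring. Qed.
Lemma det_w2 : \det w2 = 1. Proof. by rewrite /w2 det_mx3; ring. Qed.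
Lemma det_P0 : \det P0 = 1. Proof. by rewrite /P0 det_mx3; ring. Qed.

Lemma w0_word (H : 'M[int]_3 -> Prop) : (forall g h, H g -> H h -> H (g * h)) ->
  (forall i j, i != j -> H (E i j 1)) -> (forall i j, i != j -> H (E i j (-1))) -> H w0.
Proof.
move=> HM H1 HN.
have -> : w0 = mx3 (-1) 1 2 (-1) 1 1 (-1) 0 1 * mx3 1 0 2 (-1) 1 0 1 (-1) 1.
  by rewrite /w0; mx3_ring.
have -> : mx3 (-1) 1 2 (-1) 1 1 (-1) 0 1 =
    E o0 o1 1 * E o0 o2 1 * E o1 o2 1 * E o2 o0 (-1) :> 'M[int]_3.
  by rewrite !E_mx3 //=; mx3_ring.
have -> : mx3 1 0 2 (-1) 1 0 1 (-1) 1 =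
    E o2 o1 (-1) * E o0 o2 1 * E o0 o2 1 * E o1 o0 (-1) :> 'M[int]_3.
  by rewrite !E_mx3 //=; mx3_ring.
by apply: (HM); do 3![apply: (HM); last by [apply: (H1) | apply: (HN)]];
  first [apply: (H1) | apply: (HN)].
Qed.

Lemma P0_word (H : 'M[int]_3 -> Prop) : (forall g h, H g -> H h -> H (g * h)) ->
  (forall i j, i != j -> H (E i j 1)) -> (forall i j, i != j -> H (E i j (-1))) -> H P0.
Proof.
move=> HM H1 HN.
have -> : P0 = E o0 o1 1 * E o0 o2 (-1) * E o1 o0 (-1) * E o2 o1 1 * E o0 o1 1 * E o1 o2 (-1).
  by rewrite /P0 !E_mx3 //=; mx3_ring.
by do 5![apply: (HM); last by [apply: (H1) | apply: (HN)]]; apply: (H1).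
Qed.

Section Roots.
Variable F : fieldType.
Hypothesis ch0 : [pchar F] =i pred0.
(** The minimal polynomial of 2 cos (2 pi / 7), and the characteristic polynomial of [w0]. The map
    [l ^+ 2 - 2] doubles the angle and permutes the roots cyclically. *)
Definition chi (l : F) := l ^+ 3 + l ^+ 2 - 2%:R * l - 1.

Lemma chi_next l : chi l = 0 -> chi (l ^+ 2 - 2%:R) = 0.
Proof.
move=> l0; have -> : chi (l ^+ 2 - 2%:R) = chi l * (l ^+ 3 - l ^+ 2 - 2%:R * l + 1).
  by rewrite /chi; ring.
by rewrite l0 mul0r.
Qed.

(** The right side is the third root, since the roots add up to -1. *)
Lemma chi_third l : chi l = 0 -> (l ^+ 2 - 2%:R) ^+ 2 - 2%:R = 1 - l - l ^+ 2.
Proof.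
move=> l0; apply/eqP; rewrite -subr_eq0; apply/eqP.
by transitivity (chi l * (l - 1)); [rewrite /chi; ring | rewrite l0 mul0r].
Qed.

Lemma chi_prod l : chi l = 0 -> l * (l ^+ 2 - 2%:R) * (1 - l - l ^+ 2) = 1.
Proof.
move=> l0; apply/eqP; rewrite -subr_eq0; apply/eqP.
by transitivity (chi l * (1 - l ^+ 2)); [rewrite /chi; ring | rewrite l0 mul0r].
Qed.

Lemma chi_cycle l : chi l = 0 -> (1 - l - l ^+ 2) ^+ 2 - 2%:R = l.
Proof.
move=> l0; apply/eqP; rewrite -subr_eq0; apply/eqP.
by transitivity (chi l * (l + 1)); [rewrite /chi; ring | rewrite l0 mul0r].
Qed.

(** The fixed points of the doubling map are 2 and -1, where [chi] takes the values 7 and 1. *)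
Lemma chi_next_neq l : chi l = 0 -> l ^+ 2 - 2%:R != l.
Proof.
move=> l0; apply/eqP => e.
have : (l - 2%:R) * (l + 1) = 0.
  by transitivity (l ^+ 2 - 2%:R - l); [ring | rewrite e subrr].
move/eqP; rewrite mulf_eq0 subr_eq0 addr_eq0 => /orP[] /eqP lE; move: l0; rewrite lE.
  have -> : chi 2%:R = 7%:R by rewrite /chi; ring.
  by move/eqP; rewrite ((pcharf0P F).1 ch0).
have -> : chi (-1) = 1 by rewrite /chi; ring.
by move/eqP; rewrite oner_eq0.
Qed.
End Roots.

Section Torus.
Variables (F : fieldType) (n : nat).
Hypothesis ch0 : [pchar F] =i pred0.
Notation M := 'M[F]_n.+1.
Variable phi : 'M[int]_3 -> M.
Hypothesis phi1 : phi 1 = 1.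
Hypothesis phiM : forall g h, \det g = 1 -> \det h = 1 -> phi (g * h) = phi g * phi h.
Variable l : F.
Hypothesis chil : chi l = 0.

Definition lam (i : 'I_3) : F := nth 0 [:: l; l ^+ 2 - 2%:R; 1 - l - l ^+ 2] i.
Definition nxt (i : 'I_3) : 'I_3 := nth o0 [:: o1; o2; o0] i.

Lemma chi_lam i : chi (lam i) = 0.
Proof.
move: i; apply: I3P; rewrite /lam //=; first exact: chi_next.
by rewrite -chi_third //; do 2!apply: chi_next.
Qed.

Lemma lam_nxt i : lam (nxt i) = lam i ^+ 2 - 2%:R.
Proof. by move: i; apply: I3P; rewrite /lam /nxt //= ?chi_third ?chi_cycle. Qed.

Lemma lam_prod : lam o0 * lam o1 * lam o2 = 1. Proof. exact: chi_prod. Qed.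

Lemma lam_inj : injective lam.
Proof.
have H i : lam (nxt i) != lam i by rewrite lam_nxt; apply: chi_next_neq => //; apply: chi_lam.
have [[H0 H1] H2] := (H o0, H o1, H o2).
move=> i j; elim/I3P: i; elim/I3P: j => // /eqP; rewrite ?(negPf H0) ?(negPf H1) ?(negPf H2) //.
all: by rewrite eq_sym ?(negPf H0) ?(negPf H1) ?(negPf H2).
Qed.

Lemma lam_neq0 i : lam i != 0.
Proof.
apply/eqP => l0; have := chi_lam i; rewrite l0 (_ : chi 0 = - 1); last by rewrite /chi; ring.
by move/eqP; rewrite oppr_eq0 oner_eq0.
Qed.

(** Row i is the basis 1, -x, x^2 - 1 of Z[x] at x = [lam i], and [w0] is multiplication by x in it,
    so the rows are left eigenvectors. In this basis Galois conjugation followed by multiplication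
    by x only changes order and signs, which gives [P0]. *)
Definition Q : 'M[F]_3 := \matrix_(i, j) nth 0 [:: 1; - lam i; lam i ^+ 2 - 1] j.

Notation iota A := (map_mx (intr : int -> F) A : 'M[F]_3).

Lemma Q_unit : Q \is a GRing.unit.
Proof.
rewrite unitmxE unitfE.
have -> : \det Q = - ((lam o1 - lam o0) * (lam o2 - lam o1) * (lam o2 - lam o0)).
  by rewrite [Q]mx3_eta det_mx3 !mxE /=; ring.
by rewrite oppr_eq0 !mulf_neq0 // subr_eq0; apply/eqP => /lam_inj.
Qed.

Definition dl (f : 'I_3 -> F) : 'M[F]_3 := diag_mx (\row_i f i).

Lemma Qw0 : Q * iota w0 = dl lam * Q.
Proof.
apply/matrixP => i j; rewrite -!mulmxE mul_diag_mx [LHS]mxE [RHS]mxE sum3 !mxE.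
have e : lam i ^+ 3 = 2%:R * lam i + 1 - lam i ^+ 2.
  apply/eqP; rewrite -subr_eq0 -[X in _ == X](chi_lam i) /chi; apply/eqP; ring.
move: j; apply: I3P; rewrite /= ?rmorphN ?rmorph1 ?rmorph0.
- by ring.
- by ring.
- transitivity (lam i ^+ 3 - lam i); last by ring.
  by rewrite e; ring.
Qed.

Lemma Qw1 : Q * iota w1 = dl (fun i => lam (nxt i)) * Q.
Proof.
rewrite w1E rmorphB rmorphM /= rmorph_nat mulrBr mulrA Qw0 -mulrA Qw0 mulrA.
rewrite [Q * 2%:R](commr_nat Q 2) -mulrBl; congr (_ * _).
rewrite -(rmorph_nat (@scalar_mx F 3)) /dl -!mulmxE mulmx_diag.
apply/matrixP => i j; rewrite !mxE lam_nxt -mulrnBl.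
by congr (_ *+ _); rewrite expr2.
Qed.

(* Galois conjugation: P permutes the eigenlines of w cyclically. *)
Lemma P_perm i : Q * iota P0 * Q^-1 * delta_mx (nxt i) (nxt i) =
  delta_mx i i * (Q * iota P0 * Q^-1).
Proof.
have uQ := Q_unit; set Z := Q * iota P0 * Q^-1.
have ZL : Z * dl lam = dl (fun i => lam (nxt i)) * Z.
  have e : iota P0 * iota w0 = iota w1 * iota P0 by rewrite -!rmorphM Pw0.
  have w0Q : iota w0 * Q^-1 = Q^-1 * dl lam.
    by apply: (mulrI uQ); rewrite [LHS]mulrA Qw0 mulrK // mulVKr.
  by rewrite /Z -!mulrA -w0Q (mulrA (iota P0)) e -!mulrA !mulrA Qw1.
have nz k j : Z k j != 0 -> j = nxt k.
  move=> Zkj; apply/lam_inj/(mulfI Zkj).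
  have := congr1 (fun Y : 'M[F]_3 => Y k j) ZL.
  rewrite /= -!mulmxE /dl mul_diag_mx mul_mx_diag [LHS]mxE [RHS]mxE !mxE => ->.
  by rewrite mulrC.
clearbody Z; apply/matrixP => k j; rewrite -!mulmxE !mxE.
rewrite (bigD1 (nxt i)) //= big1 ?addr0 => [|p pi]; last by rewrite mxE (negPf pi) mulr0.
rewrite (bigD1 i) //= big1 ?addr0 => [|p pi]; last by rewrite mxE (negPf pi) andbF mul0r.
rewrite !mxE !eqxx /= andbT.
have Z0 k' j' : j' != nxt k' -> Z k' j' = 0.
  by move=> ne; apply/eqP; apply: contraNT ne => /nz ->.
have nxt_inj : injective nxt by move=> p q; elim/I3P: p; elim/I3P: q.
have [->|jn] := eqVneq j (nxt i); have [->|ki] := eqVneq k i; rewrite ?mulr1 ?mul1r ?mulr0 ?mul0r //.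
  by apply: Z0; rewrite (inj_eq nxt_inj) eq_sym.
by rewrite Z0.
Qed.
End Torus.

Lemma lie_conj (F : fieldType) n (V A B : 'M[F]_n.+1) : V \is a GRing.unit ->
  lie (V^-1 * A * V) (V^-1 * B * V) = V^-1 * lie A B * V.
Proof. by move=> uV; rewrite /lie mulrBr mulrBl !mulrA !mulrK. Qed.

Lemma lie_delta_weight (F : fieldType) (p i j : 'I_3) :
  lie (delta_mx p p) (delta_mx i j) =
  ((p == i)%:Z - (p == j)%:Z)%:~R *: delta_mx i j :> 'M[F]_3.
Proof.
rewrite /lie -!mulmxE !mul_delta_mx_cond [j == p]eq_sym.
by case: (eqVneq p i) => [<-|pi]; case: (eqVneq p j) => [<-|pj];
  rewrite ?eqxx ?mulr1n ?mulr0n ?subrr ?scale0r ?subr0 ?scale1r ?sub0r ?scaleN1r.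
Qed.

(** * The value of a representation at powers of w0 *)

Section TorusRep.
Variables (F : fieldType) (n : nat).
Hypothesis ch0 : [pchar F] =i pred0.
Notation M := 'M[F]_n.+1.
Variable phi : 'M[int]_3 -> M.
Hypothesis phi1 : phi 1 = 1.
Hypothesis phiM : forall g h, \det g = 1 -> \det h = 1 -> phi (g * h) = phi g * phi h.
Variable l : F.
Hypothesis chil : chi l = 0.
Variable y : 'I_3 -> 'I_3 -> M.
Hypothesis lie_y : forall i j k l, lie (y i j) (y k l) = y i l *+ (j == k) - y k j *+ (i == l).
Hypothesis phiD : forall k l A, k != l -> phi (E k l 1) * ext y A =
        ext y (E k l 1 * A * E k l (-1)) * phi (E k l 1).
Hypothesis phiR : forall k l, k != l ->
        subalg (fun z => exists A, z = ext y A) (phi (E k l (N n)%:Z)).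

Notation D := (ext y).
Notation Ralg := (subalg (fun z => exists A, z = D A)).
Notation iota A := (map_mx (intr : int -> F) A : 'M[F]_3).
Notation Q := (Q l).
Notation lam := (lam l).
Let uQ : Q \is a GRing.unit := Q_unit ch0 chil.

(** The derived representation on the matrix units of the eigenbasis of [w0]: root vectors for i
    different from j, and torus elements for i equal to j. *)
Definition ty i j : M := D (Q^-1 * delta_mx i j * Q).

Lemma lie_ty p i j : lie (ty p p) (ty i j) = ((p == i)%:Z - (p == j)%:Z)%:~R *: ty i j.
Proof.
rewrite /ty lie_ext // lie_conj // lie_delta_weight -scalerAr -scalerAl extZ.
by [].
Qed.

Lemma ext_ty A : D A = ext ty (Q * A * Q^-1).
Proof.
have H B : D (Q^-1 * B * Q) = ext ty B.
  elim/mx_delta_ind: B => [B C IB IC|a B IB|i j|].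
  - by rewrite mulrDr mulrDl !extD IB IC.
  - by rewrite -scalerAr -scalerAl !extZ IB.
  - by rewrite ext_delta.
  - by rewrite mulr0 mul0r !ext0.
by rewrite -H !mulrA mulVr // mul1r mulrVK.
Qed.

Lemma Ralg_ty i j : Ralg (ty i j).
Proof. by apply: subalg_gen; exists (Q^-1 * delta_mx i j * Q). Qed.

Lemma ty_comm z : (forall i j, z * ty i j = ty i j * z) -> forall A, z * D A = D A * z.
Proof.
move=> zty A; rewrite ext_ty; elim/mx_delta_ind: (Q * A * Q^-1) => [B C IB IC|a B IB|i j|].
- by rewrite extD mulrDr mulrDl IB IC.
- by rewrite extZ -scalerAr -scalerAl IB.
- by rewrite ext_delta.
- by rewrite ext0 mulr0 mul0r.
Qed.

Let h i := ty i i.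

Lemma weights i j : i != j -> diagonalizable (h i - h j) /\
  forall a, eigenvalue (h i - h j) a -> exists k : int, a = k%:~R.
Proof.
move=> ij; have ji : j != i by rewrite eq_sym.
apply: (sl2_diagonalizable ch0 (e := ty i j) (f := ty j i)).
- rewrite -[LHS]/(lie _ _) lieDl lieNl !lie_ty !eqxx (negPf ij) (negPf ji).
  by rewrite -scalerBl -intrB.
- rewrite -[LHS]/(lie _ _) lieDl lieNl !lie_ty !eqxx (negPf ij) (negPf ji).
  by rewrite -scalerBl -intrB.
by rewrite -[LHS]/(lie _ _) /ty lie_ext // lie_conj // lie_delta_diag mulrBr mulrBl extB.
Qed.

Lemma h_comm i j : h i * h j = h j * h i.
Proof.
apply/eqP; rewrite -subr_eq0 -[_ - _]/(lie _ _) /h lie_ty.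
by rewrite subrr scale0r.
Qed.

Lemma exists_weights : exists2 V : M, V \is a GRing.unit &
  exists a b : 'I_n.+1 -> int, h o0 - h o2 = dg V (fun i => (a i)%:~R) /\
    h o1 - h o2 = dg V (fun i => (b i)%:~R).
Proof.
have [d02 e02] := @weights o0 o2 isT; have [d12 e12] := @weights o1 o2 isT.
apply: codiag_int => //.
have /eqP : lie (h o0 - h o2) (h o1 - h o2) = 0.
  have H i j : lie (h i) (h j) = 0 by rewrite /lie h_comm subrr.
  by rewrite lieDl lieNl !lieDr !lieNr !H !(oppr0, addr0).
by rewrite subr_eq0 => /eqP.
Qed.

Variables (V : M) (a b : 'I_n.+1 -> int).
Hypothesis uV : V \is a GRing.unit.
Hypothesis aE : h o0 - h o2 = dg V (fun i => (a i)%:~R).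
Hypothesis bE : h o1 - h o2 = dg V (fun i => (b i)%:~R).

(** The operator by which diag (s, t, 1 / (s t)) acts when the weights are [a] and [b]: the coroots
    [h o0 - h o2] and [h o1 - h o2] belong to the one-parameter groups diag (s, 1, 1 / s) and diag
    (1, t, 1 / t). *)
Definition rho s t : M := dg V (fun i => s ^ a i * t ^ b i).

Lemma rhoM s t s' t' : rho s t * rho s' t' = rho (s * s') (t * t').
Proof. by rewrite /rho dgM //; apply: eq_dg => i; rewrite mulrACA -!expfzMl. Qed.

Lemma rho1 : rho 1 1 = 1.
Proof. by rewrite -(dg1 uV); apply: eq_dg => i; rewrite !exp1rz mulr1. Qed.

Lemma rho_Ralg s t : Ralg (rho s t).
Proof.
have RD i j : Ralg (h i - h j).
  by apply: subalg_add; [apply: Ralg_ty | apply: subalgN; apply: Ralg_ty].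
have H (X : M) (c : 'I_n.+1 -> int) u : X = dg V (fun i => (c i)%:~R) -> Ralg X ->
    Ralg (dg V (fun i => u ^ c i)).
  move=> XE RX; have [p pE] := int_interpolation (codom c) (fun k => u ^ k) ch0.
  rewrite (_ : dg V _ = horner_mx X p); first exact: subalg_horner.
  by rewrite XE dg_horner //; apply: eq_dg => i; rewrite pE // codom_f.
by rewrite /rho -(dgM uV (fun i => s ^ a i)); apply: subalg_mul; [apply: H aE _ | apply: H bE _].
Qed.

Lemma dg_shift (X Y : M) (c : 'I_n.+1 -> int) (m : int) :
  X = dg V (fun i => (c i)%:~R) -> lie X Y = m%:~R *: Y ->
  forall p q, (V * Y * V^-1) p q != 0 -> c p = c q + m.
Proof.
move=> XE XY p q nz; apply: (intr_inj_pchar0 ch0).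
have /(dg_intertwine uV) H : dg V (fun i => (c i)%:~R) * Y = Y * dg V (fun i => (c i + m)%:~R).
  rewrite -XE -[X * Y](subrK (Y * X)) -/(lie X Y) XY.
  rewrite [X in Y * X]XE -mul_scalar_mx -scalar_mxC -[Y *m _]/(Y * _) -mulrDr -(dgC uV) dgD.
  by congr (_ * _); apply: eq_dg => i; rewrite addrC intrD.
exact: H.
Qed.

Let e0 (i : 'I_3) : int := (o0 == i)%:Z - (o2 == i)%:Z.
Let e1 (i : 'I_3) : int := (o1 == i)%:Z - (o2 == i)%:Z.
Definition zz (s t : F) i := s ^ e0 i * t ^ e1 i.

Lemma rho_ty s t i j : s != 0 -> t != 0 ->
  rho s t * ty i j = (zz s t i / zz s t j) *: (ty i j * rho s t).
Proof.
move=> s0 t0.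
have la : lie (h o0 - h o2) (ty i j) = (e0 i - e0 j)%:~R *: ty i j.
  rewrite lieDl lieNl !lie_ty -scalerBl -intrB; congr (_%:~R *: _).
  by rewrite /e0; lia.
have lb : lie (h o1 - h o2) (ty i j) = (e1 i - e1 j)%:~R *: ty i j.
  rewrite lieDl lieNl !lie_ty -scalerBl -intrB; congr (_%:~R *: _).
  by rewrite /e1; lia.
rewrite scalerAr /rho dgZ; apply/(dg_intertwine uV) => p q nz.
rewrite (dg_shift aE la nz) (dg_shift bE lb nz) /zz.
have D3 (u : F) (m1 m2 m3 : int) : u != 0 -> u ^ (m1 + (m2 - m3)) = u ^ m1 * (u ^ m2 / u ^ m3).
  by move=> u0; rewrite !expfzDr // invr_expz.
rewrite !D3 // invfM.
move: (s ^ a q) (s ^ e0 i) (s ^ e0 j)^-1 (t ^ b q) (t ^ e1 i) (t ^ e1 j)^-1 => *.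
by ring.
Qed.

(** An operator that permutes the [h i] cyclically also permutes the three torus parameters [s], [t]
    and [(s * t)^-1] cyclically. *)
Lemma rho_P Y : Y * (h o0 - h o2) = (h o2 - h o1) * Y -> Y * (h o1 - h o2) = (h o0 - h o1) * Y ->
  forall s t, s != 0 -> t != 0 -> rho t (s * t)^-1 * Y = Y * rho s t.
Proof.
move=> Ya Yb s t s0 t0.
have h21 : h o2 - h o1 = dg V (fun i => (- b i)%:~R).
  rewrite -opprB bE -scaleN1r dgZ; apply: eq_dg => i.
  by rewrite mulN1r rmorphN.
have h01 : h o0 - h o1 = dg V (fun i => (a i - b i)%:~R).
  rewrite -(subrK (h o2) (h o0)) -addrA h21 aE dgD; apply: eq_dg => i.
  by rewrite intrD.
rewrite aE h21 in Ya; rewrite bE h01 in Yb.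
apply/(dg_intertwine uV) => p q nz.
have /(intr_inj_pchar0 ch0) aq := (dg_intertwine uV _ _ _).1 (esym Ya) p q nz.
have /(intr_inj_pchar0 ch0) bq := (dg_intertwine uV _ _ _).1 (esym Yb) p q nz.
rewrite -aq -bq exprz_inv -!invr_expz expfzMl expfzDr // -!invr_expz.
rewrite invfM; move: (s ^ b q)^-1 (t ^ b q)^-1 (t ^ a q) => *.
exact: mulrCA.
Qed.

Let eqE1 i j : i != j -> equivariant phi y (E i j 1).
Proof. exact: equivE. Qed.

Let eqEN i j : i != j -> equivariant phi y (E i j (-1)).
Proof. by move=> ij; rewrite -EV //; apply: equivV => //; apply: eqE1. Qed.

Lemma equiv_w0 : equivariant phi y w0.
Proof. by apply: w0_word; [apply: equivM | apply: eqE1 | apply: eqEN]. Qed.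

Lemma equiv_P0 : equivariant phi y P0.
Proof. by apply: P0_word; [apply: equivM | apply: eqE1 | apply: eqEN]. Qed.

Lemma dl_conj_delta (f : 'I_3 -> F) i j : f j != 0 ->
  dl f * delta_mx i j = (f i / f j) *: (delta_mx i j * dl f).
Proof.
move=> fj; rewrite /dl -!mulmxE mul_diag_mx mul_mx_diag; apply/matrixP => p q.
rewrite !mxE; case: (eqVneq p i) => [->|_]; case: (eqVneq q j) => [->|_] //=;
  by rewrite ?(mulr0, mul0r, mulr1, mul1r) // divfK.
Qed.

Lemma phi_w0_ty i j : phi w0 * ty i j = (lam i / lam j) *: (ty i j * phi w0).
Proof.
have [dw Hw] := equiv_w0; have uw := iota_unit F dw.
have e : iota w0 * (Q^-1 * delta_mx i j * Q) = (lam i / lam j) *: (Q^-1 * delta_mx i j * Q) * iota w0.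
  apply: (mulrI uQ).
  rewrite !mulrA Qw0 // mulrK // dl_conj_delta ?lam_neq0 // -!scalerAl -!scalerAr -!scalerAl.
  by rewrite !mulrA mulrV // mul1r -!mulrA Qw0.
by rewrite Hw e mulrK // extZ -scalerAl.
Qed.

Lemma phi_P0_h i : phi P0 * h (nxt i) = h i * phi P0.
Proof.
have [dP HP] := equiv_P0; have uP := iota_unit F dP.
rewrite /h /ty HP; congr (D _ * _).
apply: (mulIr uP); rewrite mulrVK //; apply: (mulrI uQ); apply: (mulIr (_ : Q^-1 \is a GRing.unit)).
  by rewrite unitrV.
have := P_perm ch0 chil i; rewrite !mulrA !mulrK // => ->.
by rewrite mulrV // mul1r.
Qed.

Lemma phi_w0X_ty m i j : phi w0 ^+ m * ty i j = (lam i ^+ m / lam j ^+ m) *: (ty i j * phi w0 ^+ m).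
Proof.
elim: m => [|m IH]; first by rewrite !expr0 divr1 scale1r mulr1 mul1r.
rewrite exprSr -mulrA phi_w0_ty -scalerAr [phi w0 ^+ m * (_ * _)]mulrA IH -scalerAl scalerA -(mulrA (ty i j)) -exprSr.
by congr (_ *: _); rewrite -!exprVn -!exprMn -?exprS.
Qed.

Lemma zz_lam m : zz (lam o0 ^+ m) (lam o1 ^+ m) =1 (fun i => lam i ^+ m).
Proof.
have l2 : lam o2 ^+ m = (lam o0 ^+ m * lam o1 ^+ m)^-1.
  rewrite -exprMn -exprVn; congr (_ ^+ _).
  have := lam_prod chil; move/(canRL (mulKf _)) => -> //; last by rewrite mulf_neq0 ?lam_neq0.
  by rewrite mulr1.
rewrite /zz /e0 /e1; apply: I3P; rewrite /= ?l2 ?subr0 ?sub0r ?expr1z ?expr0z ?mulr1 ?mul1r //.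
by rewrite -!invr_expz !expr1z invfM.
Qed.

(* The discrepancy between [w0 ^+ m] and the torus element with the same eigenvalues. *)
Definition cc m := phi w0 ^+ m * rho (lam o0 ^+ m)^-1 (lam o1 ^+ m)^-1.

Let lamX_neq0 m i : lam i ^+ m != 0.
Proof. by rewrite expf_neq0 // lam_neq0. Qed.

(** Moving the two factors of [cc m] past [ty i j] produces reciprocal ratios of eigenvalues, which
    cancel. *)
Lemma cc_central m : Ralg (phi w0 ^+ m) -> central y (cc m).
Proof.
move=> Rw; split; first by apply: subalg_mul => //; apply: rho_Ralg.
apply: ty_comm => i j; rewrite /cc -mulrA rho_ty ?invr_eq0 //.
have zzV s t k : zz s^-1 t^-1 k = (zz s t k)^-1 by rewrite /zz invfM -!expfV.
rewrite !zzV !zz_lam -scalerAr (mulrA (phi w0 ^+ m) (ty i j)) phi_w0X_ty -scalerAl scalerA mulrA.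
by rewrite mulrACA mulVf // invrK mulfV // mulr1 scale1r.
Qed.

Lemma w0X_rho : exists2 m, (0 < m)%N &
  phi w0 ^+ m = rho (lam o0 ^+ m) (lam o1 ^+ m) /\
  phi w1 ^+ m = rho (lam o1 ^+ m) (lam o2 ^+ m).
Proof.
have [m m0] := equiv_torsion phi1 phiM phiD phiR equiv_w0; rewrite (phiX phi1 phiM _ det_w0) => Rw.
set s := lam o0 ^+ m; set t := lam o1 ^+ m; set u := lam o2 ^+ m.
have [c cen cE] : exists2 c, central y c & phi w0 ^+ m = c * rho s t.
  exists (cc m); first exact: cc_central.
  by rewrite /cc -mulrA rhoM !mulVf // rho1 mulr1.
have uP := phi_unit phi1 phiM det_P0.
have cP : phi P0 * c = c * phi P0.
  (* By [central_comm], [c] commutes with the images of elementary matrices, and [P0] is a word in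
     them. The determinant travels along the word to keep [phi] multiplicative. *)
  suff [] : \det P0 = 1 /\ phi P0 * c = c * phi P0 by [].
  apply: (P0_word (H := fun g => \det g = 1 /\ phi g * c = c * phi g)).
  - move=> g k [dg gc] [dk kc]; split; first by rewrite det_mulmx dg dk mulr1.
    by rewrite phiM // -mulrA kc mulrA gc mulrA.
  - by move=> i j ij; split; [apply: det_E | apply: (central_comm ch0 phi1 phiM phiD phiR)].
  - move=> i j ij; split; first exact: det_E.
    have uE : phi (E i j 1) \is a GRing.unit by apply: phi_unit => //; apply: det_E.
    rewrite -EV // (phiV phi1 phiM) ?det_E //; apply: (mulrI uE); apply: (mulIr uE).
    by rewrite mulVKr // -!mulrA mulVr // mulr1 (central_comm ch0 phi1 phiM phiD phiR).
have cR s' t' : c * rho s' t' = rho s' t' * c by apply: (central_Ralg cen); apply: rho_Ralg.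
have rhoP s' t' : s' != 0 -> t' != 0 -> rho t' (s' * t')^-1 * phi P0 = phi P0 * rho s' t'.
  apply: rho_P.
    by rewrite mulrBr mulrBl -(phi_P0_h o2) -(phi_P0_h o1).
  by rewrite mulrBr mulrBl -(phi_P0_h o0) -(phi_P0_h o1).
have uE : u = (s * t)^-1.
  by have := zz_lam m o2; rewrite /zz /e0 /e1 /= !sub0r -!invr_expz !expr1z invfM /u => <-.
have sE : s = (t * u)^-1 by rewrite uE invfM invrK [s * t]mulrC mulKf // /t.
(* Conjugation by [phi P0] passes to the next Galois conjugate, shifts the torus parameters and
   fixes [c]. *)
have step g g' s' t' : \det g = 1 -> \det g' = 1 -> P0 * g = g' * P0 -> s' != 0 -> t' != 0 ->
    phi g ^+ m = c * rho s' t' -> phi g' ^+ m = c * rho t' (s' * t')^-1.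
  move=> dg dg' Pg s0 t0 gE; apply: (mulIr uP).
  have Pgm : phi P0 * phi g ^+ m = phi g' ^+ m * phi P0.
    elim: (m) => [|k IH]; first by rewrite !expr0 mulr1 mul1r.
    by rewrite exprSr mulrA IH -mulrA -phiM ?det_P0 // Pg phiM ?det_P0 // mulrA -exprSr.
  by rewrite -Pgm gE mulrA cP -(mulrA c) -(rhoP _ _ s0 t0) (mulrA c).
have c1E : phi w1 ^+ m = c * rho t u.
  by rewrite uE; apply: (step w0 w1) cE; rewrite ?det_w0 ?det_w1 ?Pw0 ?lamX_neq0.
have c2E : phi w2 ^+ m = c * rho u s.
  by rewrite sE; apply: (step w1 w2) c1E; rewrite ?det_w2 ?det_w1 ?Pw1 ?lamX_neq0.
have stu : s * t * u = 1 by rewrite uE mulfV // mulf_neq0 //; apply: lamX_neq0.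
(* The Galois conjugation carries [c] to itself, and [w0 * w1 * w2 = 1]. *)
have c3 : c ^+ 3 = 1.
  have : phi w0 ^+ m * phi w1 ^+ m * phi w2 ^+ m = 1.
    have C01 : phi w0 * phi w1 = phi w1 * phi w0.
      by rewrite -!phiM ?det_w0 ?det_w1 // w01C.
    have C012 : phi w0 * phi w1 * phi w2 = phi w2 * (phi w0 * phi w1).
      rewrite -!phiM ?det_mulmx ?det_w0 ?det_w1 ?det_w2 ?mulr1 //; congr phi.
      by rewrite -[LHS]mulrA w12C [LHS]mulrA w02C -mulrA.
    rewrite -(exprMn_comm _ C01) -(exprMn_comm _ C012) -!phiM ?det_mulmx ?det_w0 ?det_w1 ?det_w2 ?mulr1 //.
    by rewrite w012 phi1 expr1n.
  have C3 (x1 x2 x3 : M) : c * x1 = x1 * c -> c * x2 = x2 * c ->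
      c * x1 * (c * x2) * (c * x3) = c ^+ 3 * (x1 * x2 * x3).
    by move=> cx1 cx2; rewrite !exprS expr0 mulr1 !mulrA -(mulrA c x1 c) -cx1 !mulrA
      -(mulrA _ x2 c) -cx2 !mulrA -(mulrA _ x1 c) -cx1 !mulrA.
  rewrite cE c1E c2E C3 ?cR // !rhoM stu.
  by rewrite (_ : t * u * s = 1) ?rho1 ?mulr1 // mulrC mulrA.
have X3 s' t' : (c * rho s' t') ^+ 3 = rho (s' ^+ 3) (t' ^+ 3).
  rewrite exprMn_comm ?c3 ?mul1r; last exact: cR.
  by rewrite !exprS !expr0 !mulr1 !rhoM.
by exists (m * 3)%N; rewrite ?muln_gt0 ?m0 // !exprM cE c1E !X3.
Qed.
End TorusRep.

(** * Multiplicative independence and rigidity *)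

(* The ring generated by [w0]; its norm form is odd unless p, q and r are all even, because
   the characteristic polynomial of [w0] is irreducible modulo 2. *)
Definition zw (p q r : int) : 'M[int]_3 :=
  mx3 (p + r) (- q) r (- q) (p + 2 * r) (r - q) r (r - q) (p - q + 2 * r).

Lemma zwE p q r : zw p q r = p%:M + q *: w0 + r *: (w0 * w0).
Proof.
rewrite -scalemx1 /zw /w0 mx3_1 mx3M !mx3Z !mx3D; apply: mx3_eq; ring.
Qed.

Lemma comm_w0 (A : 'M[int]_3) : A * w0 = w0 * A -> exists p q r, A = zw p q r.
Proof.
(* A matrix commuting with [w0] is determined by its first row; the coefficients are read off from
   the first row of [zw]. *)
move=> AC; exists (A o0 o0 - A o0 o2), (- A o0 o1), (A o0 o2).
move: AC; rewrite [A]mx3_eta /w0 !mx3M /zw !mxE /= => /matrixP AC.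
have := (AC o0 o0, AC o0 o1, AC o0 o2, (AC o1 o0, AC o1 o1, AC o1 o2), (AC o2 o0, AC o2 o1, AC o2 o2)).
rewrite !mxE /= => -[[[[e1 e2] e3] [[e4 e5] e6]] [[e7 e8] e9]].
by apply: mx3_eq; lia.
Qed.

Lemma tr_mx3 (a b c d e f g h i : int) : \tr (mx3 a b c d e f g h i) = a + e + i.
Proof. by rewrite /mxtrace sum3 !mxE. Qed.

Lemma zw_norm_even p q r : \det (zw p q r) = 0 ->
  exists p' q' r', [/\ p = 2 * p', q = 2 * q' & r = 2 * r'].
Proof.
have par (x : int) : exists y, x = 2 * y \/ x = 2 * y + 1.
  by exists (x %/ 2)%Z; lia.
have [p' pE] := par p; have [q' qE] := par q; have [r' rE] := par r.
rewrite /zw det_mx3 => d0; exists p', q', r'.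
by case: pE d0 => ->; case: qE => ->; case: rE => -> => d0; split=> //; exfalso; lia.
Qed.

(** Infinite descent: the coordinates of a zero of the norm form are even, and halving them gives a
    smaller zero. *)
Lemma zw_det0 p q r : \det (zw p q r) = 0 -> [/\ p = 0, q = 0 & r = 0].
Proof.
have [n] := ubnP (`|p| + `|q| + `|r|)%N; elim: n => // n IH in p q r *; rewrite ltnS => le_n d0.
have [p' [q' [r' [pE qE rE]]]] := zw_norm_even d0.
have [z|nz] := boolP [&& p == 0, q == 0 & r == 0].
  by case/and3P: z => /eqP-> /eqP-> /eqP->.
have d0' : \det (zw p' q' r') = 0.
  move: d0; rewrite pE qE rE.
  have -> : zw (2 * p') (2 * q') (2 * r') = 2 *: zw p' q' r'.
    by rewrite /zw mx3Z; apply: mx3_eq; ring.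
  by rewrite detZ => /eqP; rewrite mulf_eq0 => /orP[|/eqP].
have [|p0 q0 r0] := IH p' q' r' _ d0'; last by rewrite pE qE rE p0 q0 r0 mulr0.
by move: le_n nz; rewrite pE qE rE; lia.
Qed.

(** * Trace growth for symmetric integer matrices *)

Section Growth.
Variable v : 'M[int]_3.
Hypothesis vT : v^T = v.
Let T k := \tr (v ^+ k).

Lemma expr_sym k : (v ^+ k)^T = v ^+ k.
Proof.
elim: k => [|k IH]; first by rewrite expr0 tr_scalar_mx.
by rewrite {1}exprS -mulmxE trmx_mul IH vT mulmxE -exprSr.
Qed.

Lemma tr_sq_ge0 (A : 'M[int]_3) : A^T = A -> 0 <= \tr (A * A).
Proof.
move=> AT; rewrite -{2}AT /mxtrace sumr_ge0 // => i _; rewrite -mulmxE mxE sumr_ge0 // => j _.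
by rewrite mxE -expr2 sqr_ge0.
Qed.

(* Cauchy-Schwarz for the Frobenius inner product of v^k and v^(k+2). *)
Lemma trace_log_convex k : 0 < T (2 * k) -> T (2 * k.+1) ^+ 2 <= T (2 * k) * T (2 * k.+2).
Proof.
set x := T (2 * k.+1); set y := T (2 * k); set z := T (2 * k.+2) => y0.
have : 0 <= \tr ((x *: v ^+ k - y *: v ^+ k.+2) * (x *: v ^+ k - y *: v ^+ k.+2)).
  by apply: tr_sq_ge0; rewrite linearB !linearZ /= !expr_sym.
rewrite mulrBl !mulrBr -!scalerAl -!scalerAr !scalerA -!exprD.
have -> : (k + k = 2 * k)%N by lia.
have -> : (k + k.+2 = 2 * k.+1)%N by lia.
have -> : (k.+2 + k = 2 * k.+1)%N by lia.
have -> : (k.+2 + k.+2 = 2 * k.+2)%N by lia.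
rewrite !raddfB /= !mxtraceZ -/(T _) -/(T (2 * k.+1)) -/(T (2 * k.+2)) -/x -/y -/z.
rewrite [X in 0 <= X](_ : _ = y * (y * z - x ^+ 2)); last by ring.
by rewrite pmulr_rge0 // subr_ge0.
Qed.

(** By log convexity the ratio of consecutive even traces never drops below the first ratio, which
    is at least 4 / 3 because [T 0] is 3. *)
Lemma trace_growth k : 4 <= T 2 -> 3 <= T (2 * k) /\ 4 * T (2 * k) <= 3 * T (2 * k.+1).
Proof.
move=> T2; elim: k => [|k [IH1 IH2]].
  have T0 : T 0 = 3 by rewrite /T expr0 mxtrace1.
  by rewrite muln0 muln1 T0; split=> //; lia.
split; first by lia.
have y0 : 0 < T (2 * k) by lia.
have := trace_log_convex y0.
move: (T (2 * k)) (T (2 * k.+1)) (T (2 * k.+2)) IH1 IH2 y0 => y x z IH1 IH2 y0 conv.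
rewrite -(ler_pM2l y0).
have : x * (4 * y) <= x * (3 * x) by rewrite ler_wpM2l //; lia.
by move: conv; rewrite expr2; lia.
Qed.

(** Two steps of ratio 4 / 3 from 3 give 16 / 3. Integrality rounds this up to 6, just above the
    trace 5 of [w0 ^+ 2]. *)
Lemma trace_growth2 k : 4 <= T 2 -> (2 <= k)%N -> 6 <= T (2 * k).
Proof.
move=> T2; elim: k => // -[|[|k]] IH // _.
  by have [_] := trace_growth 1 T2; rewrite muln1; lia.
by have [_] := trace_growth k.+2 T2; have := IH isT; lia.
Qed.
End Growth.

Lemma w0T : w0^T = w0.
Proof. by apply/matrixP; do 2![apply: I3P]; rewrite !mxE. Qed.

Lemma tr_w0_sq : \tr (w0 ^+ 2) = 5.
Proof. by rewrite expr2 /w0 mx3M tr_mx3. Qed.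

Lemma w0X_neq1 k : (0 < k)%N -> w0 ^+ k != 1.
Proof.
move=> k0; apply/eqP => wk1.
have T2 : 4 <= \tr (w0 ^+ 2) by rewrite tr_w0_sq.
have := trace_growth2 w0T T2 (_ : 2 <= k.+1)%N; rewrite ltnS k0 => /(_ isT).
have -> : (2 * k.+1 = 2 + k * 2)%N by lia.
by rewrite exprD exprM wk1 expr1n mulr1 tr_w0_sq.
Qed.

(** A root [v] lies in Z[w0] and is therefore symmetric. Either its even traces exceed 5 from
    exponent 4 on, or the trace of [v ^+ 2] is below 4; this trace is the sum of the squares of the
    entries, and the bound forces [v] to be scalar. *)
Lemma w0_root (v : 'M[int]_3) k : v * w0 = w0 * v -> v ^+ k = w0 -> k = 1%N.
Proof.
move=> vC vk; have [p [q [r vE]]] := comm_w0 vC.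
have vT : v^T = v by rewrite vE /zw; apply/matrixP; do 2![apply: I3P]; rewrite !mxE.
have [k2|] := leqP 2 k; last first.
  by case: k vk => [|[|//]] //; rewrite expr0 mx3_1r => /matrixP/(_ o0 o0); rewrite !mxE.
have [T2|T2] := leP 4 (\tr (v ^+ 2)).
  have := trace_growth2 vT T2 k2; rewrite mulnC exprM vk tr_w0_sq; lia.
exfalso; have [q0 r0] : q = 0 /\ r = 0.
  move: T2; rewrite vE expr2 /zw mx3M tr_mx3 => T2.
  have H : (p + r) ^+ 2 + (p + 2 * r) ^+ 2 + (p - q + 2 * r) ^+ 2 + 2 * (q ^+ 2 + r ^+ 2 + (r - q) ^+ 2) < 4.
    by apply: le_lt_trans T2; rewrite le_eqVlt; apply/orP; left; apply/eqP; ring.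
  have {T2 H} H : q ^+ 2 + r ^+ 2 + (r - q) ^+ 2 < 2.
    move: (sqr_ge0 (p + r)) (sqr_ge0 (p + 2 * r)) (sqr_ge0 (p - q + 2 * r)) H.
    move: ((p + r) ^+ 2) ((p + 2 * r) ^+ 2) ((p - q + 2 * r) ^+ 2).
    by move: (q ^+ 2) (r ^+ 2) ((r - q) ^+ 2); lia.
  have sq (x : int) : x ^+ 2 < 2 -> x = -1 \/ x = 0 \/ x = 1.
    by rewrite expr2 => x2; have : -1 <= x <= 1 by [nia]; lia.
  have := (sqr_ge0 q, sqr_ge0 r, sqr_ge0 (r - q)) => -[[q2 r2] rq2].
  have /sq qE : q ^+ 2 < 2.
    by move: q2 r2 rq2 H; move: (q ^+ 2) (r ^+ 2) ((r - q) ^+ 2); lia.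
  have /sq rE : r ^+ 2 < 2.
    by move: q2 r2 rq2 H; move: (q ^+ 2) (r ^+ 2) ((r - q) ^+ 2); lia.
  by move: H; case: qE => [|[]] -> ; case: rE => [|[]] ->.
move: vk; rewrite vE q0 r0 zwE !scale0r !addr0 -[p%:M]scalemx1 exprZn expr1n scalemx1.
by move=> /matrixP/(_ o0 o1); rewrite !mxE.
Qed.

(** * Multiplicative independence of the eigenvalues *)

Section Independence.
Variables (F : fieldType).
Hypothesis ch0 : [pchar F] =i pred0.
Variable l : F.
Hypothesis chil : chi l = 0.
Notation Q := (Q l).
Notation lam := (lam l).
Notation iota A := (map_mx (intr : int -> F) A : 'M[F]_3).
Let uQ : Q \is a GRing.unit := Q_unit ch0 chil.

Let qd (A : 'M[int]_3) f := Q * iota A = dl f * Q.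

Let dlM (f g : 'I_3 -> F) : dl f * dl g = dl (fun i => f i * g i).
Proof. by rewrite /dl -mulmxE mulmx_diag; congr diag_mx; apply/rowP => i; rewrite !mxE. Qed.

Let qdM A B f g : qd A f -> qd B g -> qd (A * B) (fun i => f i * g i).
Proof. by rewrite /qd => Af Bg; rewrite rmorphM mulrA Af -mulrA Bg mulrA dlM. Qed.

Let qdD A B f g : qd A f -> qd B g -> qd (A + B) (fun i => f i + g i).
Proof.
rewrite /qd => Af Bg; rewrite rmorphD mulrDr Af Bg -mulrDl; congr (_ * _).
by rewrite /dl -raddfD; congr diag_mx; apply/rowP => i; rewrite !mxE.
Qed.

Let qdN A f : qd A f -> qd (- A) (fun i => - f i).
Proof.
rewrite /qd => Af; rewrite rmorphN mulrN Af -mulNr; congr (_ * _).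
by rewrite /dl -raddfN; congr diag_mx; apply/rowP => i; rewrite !mxE.
Qed.

Let qdZ (k : int) : qd k%:M (fun=> k%:~R).
Proof.
rewrite /qd map_scalar_mx /= -[Q * _]/(Q *m _) scalar_mxC; congr (_ *m _).
by rewrite /dl -diag_const_mx; congr diag_mx; apply/rowP => i; rewrite !mxE.
Qed.

Let qd_inj A f g : qd A f -> qd A g -> f =1 g.
Proof.
rewrite /qd => -> /(mulIr uQ) /matrixP e i; have := e i i.
by rewrite !mxE eqxx !mulr1n.
Qed.

Let qdX A f k : qd A f -> qd (A ^+ k) (fun i => f i ^+ k).
Proof.
move=> Af; elim: k => [|k IH]; first by have := qdZ 1; rewrite rmorph1.
have := qdM Af IH; rewrite -exprS /qd => ->; congr (_ * _).
by congr diag_mx; apply/rowP => i; rewrite !mxE exprS.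
Qed.

(** The difference of the two sides lies in Z[w0] and has the eigenvalue 0, so it vanishes by
    [zw_det0]. Reading the matrix identity at another eigenvector is then Galois conjugation of the
    relation. *)
Lemma w0_relation a b c d :
  lam o0 ^+ a * lam o1 ^+ b = lam o0 ^+ c * lam o1 ^+ d ->
  w0 ^+ a * w1 ^+ b = w0 ^+ c * w1 ^+ d.
Proof.
move=> e; apply/eqP; rewrite -subr_eq0; set A := _ - _.
have C0 i j : w0 ^+ i * w1 ^+ j * w0 = w0 * (w0 ^+ i * w1 ^+ j).
  have C1 : w1 ^+ j * w0 = w0 * w1 ^+ j by apply/esym/commrX/w01C.
  by rewrite -mulrA C1 !mulrA -exprSr -exprS.
have [p [q [r AE]]] : exists p q r, A = zw p q r.
  by apply: comm_w0; rewrite /A mulrBl mulrBr !C0.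
pose f i := lam i ^+ a * lam (nxt i) ^+ b - lam i ^+ c * lam (nxt i) ^+ d.
have qA : qd A f.
  exact: (qdD (qdM (qdX a (Qw0 chil)) (qdX b (Qw1 chil)))
    (qdN (qdM (qdX c (Qw0 chil)) (qdX d (Qw1 chil))))).
have f0 : f o0 = 0 by rewrite /f -[nxt o0]/o1 e subrr.
have dA : \det A = 0.
  apply: (intr_inj_pchar0 ch0); rewrite -det_map_mx.
  have : \det (Q * iota A) = 0.
    by rewrite qA det_mulmx det_diag (bigD1 o0) //= mxE f0 !mul0r.
  rewrite det_mulmx => /eqP; rewrite mulf_eq0 => /orP[|/eqP //].
  by rewrite -[_ == 0]negbK -unitfE -unitmxE [Q \in _]uQ.
by move: dA; rewrite AE => /zw_det0[-> -> ->]; apply/eqP/matrixP; do 2![apply: I3P]; rewrite !mxE.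
Qed.

Lemma lam_relation_nxt a b c d : lam o0 ^+ a * lam o1 ^+ b = lam o0 ^+ c * lam o1 ^+ d ->
  lam o1 ^+ a * lam o2 ^+ b = lam o1 ^+ c * lam o2 ^+ d.
Proof.
move/w0_relation => e.
have := qdM (qdX a (Qw0 chil)) (qdX b (Qw1 chil)); rewrite e.
by move/qd_inj/(_ (qdM (qdX c (Qw0 chil)) (qdX d (Qw1 chil))))/(_ o1).
Qed.

Lemma int_nats (x : int) : exists a c : nat, x = a%:Z - c%:Z.
Proof. by case: x => k; [exists k, 0%N | exists 0%N, k.+1]; rewrite ?subr0 // NegzE sub0r. Qed.

Lemma expz_nats (s : F) (a c : nat) : s != 0 -> s ^ (a%:Z - c%:Z) = s ^+ a / s ^+ c.
Proof. by move=> s0; rewrite expfzDr // -invr_expz. Qed.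

Lemma lam_independent (x z : int) : lam o0 ^ x * lam o1 ^ z = 1 -> x = 0 /\ z = 0.
Proof.
have l0 := lam_neq0 chil o0; have l1 := lam_neq0 chil o1; have l2 := lam_neq0 chil o2.
move=> e; have e' : lam o1 ^ x * lam o2 ^ z = 1.
  have [[a [c xE]] [b [d zE]]] := (int_nats x, int_nats z).
  move: e; rewrite xE zE !expz_nats // ![_ / _ * (_ / _)]mulrACA -!invfM.
  move=> H; rewrite (lam_relation_nxt (a := a) (b := b) (c := c) (d := d)).
    by rewrite mulfV // mulf_neq0 ?expf_neq0.
  by apply: divr1_eq.
have l2E : lam o2 = (lam o0 * lam o1)^-1.
  by have := lam_prod chil; move/(canRL (mulKf _)) => -> //; rewrite ?mulr1 ?mulf_neq0.
have e2 : lam o1 ^ (x - z) * lam o0 ^ (- z) = 1.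
  move: e'; rewrite l2E exprz_inv expfzMl => <-.
  by rewrite mulrA mulrAC -expfzDr.
(* Eliminate [lam o1] between the relation and its Galois conjugate; the norm form
   x^2 - x z + z^2 of the remaining exponent is positive definite. *)
have e3 : lam o0 ^ (x * (x - z) + z * z) = 1.
  have eA : lam o0 ^ (x * (x - z)) * lam o1 ^ (z * (x - z)) = 1.
    by rewrite -!exprz_exp -expfzMl e exp1rz.
  have eB : lam o1 ^ (z * (x - z)) = lam o0 ^ (z * z).
    have : lam o1 ^ ((x - z) * z) * lam o0 ^ (- z * z) = 1.
      by rewrite -!exprz_exp -expfzMl e2 exp1rz.
    by rewrite [(x - z) * z]mulrC mulNr -invr_expz => /divr1_eq.
  by rewrite expfzDr // -eB.
have [nx|nx] := boolP ((x == 0) && (z == 0)); first by case/andP: nx => /eqP-> /eqP->.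
have n0 : 0 < x * (x - z) + z * z by move: nx; nia.
move: n0 e3; case: (x * _ + _) => // k k0 e3.
have := @w0_relation k 0 0 0; rewrite !expr0 !mulr1 => /(_ e3) /eqP.
by rewrite (negPf (w0X_neq1 _)).
Qed.

(** Having natural exponents on both sides covers the negative powers of [w0] as well. *)
Lemma w1X_indep a c m : (0 < m)%N -> w0 ^+ a * w1 ^+ m <> w0 ^+ c.
Proof.
move=> m0 e; have l0 := lam_neq0 chil o0.
have := qdM (qdX a (Qw0 chil)) (qdX m (Qw1 chil)); rewrite e.
move/qd_inj/(_ (qdX c (Qw0 chil)))/(_ o0); rewrite -[nxt o0]/o1 => e'.
have : lam o0 ^ (a%:Z - c%:Z) * lam o1 ^ m%:Z = 1.
  by rewrite expz_nats // mulrAC -exprnP e' mulfV // expf_neq0.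
by case/lam_independent => _ m1; case: m m0 m1 {e e'}.
Qed.
End Independence.

Section Rigidity.
Variables (F : fieldType) (n : nat).
Hypothesis ch0 : [pchar F] =i pred0.
Variable l : F.
Hypothesis chil : chi l = 0.
Notation M := 'M[F]_n.+1.
Notation lam := (lam l).

Let morph (phi : 'M[int]_3 -> M) := phi 1 = 1 /\
  forall g h, \det g = 1 -> \det h = 1 -> phi (g * h) = phi g * phi h.

(** The free factor [c] lets two representations with different [m] be compared at a common
    exponent. *)
Lemma w0X_weights (phi : 'M[int]_3 -> M) : morph phi ->
  exists2 V : M, V \is a GRing.unit & exists a b : 'I_n.+1 -> int, exists2 m, (0 < m)%N &
  forall c, phi w0 ^+ (m * c) = dg V (fun i => (lam o0 ^ a i * lam o1 ^ b i) ^+ (m * c)) /\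
            phi w1 ^+ (m * c) = dg V (fun i => (lam o1 ^ a i * lam o2 ^ b i) ^+ (m * c)).
Proof.
case=> phi1 phiM; have [y [ly yD yR]] := lie_rep ch0 phi1 phiM.
have [V uV [a [b [aE bE]]]] := exists_weights ch0 chil ly.
have [m m0 [e0 e1]] := w0X_rho ch0 phi1 phiM chil ly yD yR uV aE bE.
have sX (s : F) (k : int) : (s ^+ m) ^ k = (s ^ k) ^+ m.
  by rewrite -[s ^+ m]/(s ^ m%:Z) -[_ ^+ m]/((s ^ k) ^ m%:Z) !exprz_exp mulrC.
exists V => //; exists a, b, m => // c; rewrite !exprM e0 e1 !dgX //.
by split; apply: eq_dg => i; rewrite !sX -exprMn exprM.
Qed.

Lemma dg_change_basis (V V' : M) : V \is a GRing.unit -> V' \is a GRing.unit ->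
  forall f f', dg V f = dg V' f' <-> dg V f' * (V^-1 * V') = V^-1 * V' * dg V f.
Proof.
move=> uV uV' f f'; rewrite /dg; set D := diag_mx _; set D' := diag_mx _; split=> e.
  by rewrite e !mulrA !mulrK.
have {e} : V^-1 * (D' * V') = V^-1 * (V' * (V^-1 * (D * V))).
  by move: e; rewrite !mulrA mulrK.
have uV1 : V^-1 \is a GRing.unit by rewrite unitrV.
by move/(mulrI uV1) => e; rewrite -(mulrA V'^-1) e mulKr // mulrA.
Qed.

(** The change between the two weight bases intertwines the values at a power of [w0], so it links
    only indices with equal eigenvalues. By multiplicative independence such indices have equal
    weights, and therefore it intertwines the values at a power of [w1] too. *)
Theorem rigidity (phi phi' : 'M[int]_3 -> M) : morph phi -> morph phi' ->
  phi w0 = phi' w0 -> exists2 m, (0 < m)%N & phi w1 ^+ m = phi' w1 ^+ m.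
Proof.
move=> /w0X_weights[V uV [a [b [m m0 H]]]] /w0X_weights[V' uV' [a' [b' [m' m'0 H']]]] e.
have M0 : (0 < m * m')%N by rewrite muln_gt0 m0.
exists (m * m')%N => //.
have [e0 ->] := H m'; have [] := H' m; rewrite [(m' * m)%N]mulnC -e e0 => e0' ->.
apply/(dg_change_basis uV uV')/(dg_intertwine uV) => i j Y0.
have W := (dg_intertwine uV _ _ _).1 ((dg_change_basis uV uV' _ _).1 e0') i j Y0.
suff [-> ->] : a' i = a j /\ b' i = b j by [].
have L k : lam k != 0 by apply: lam_neq0.
have K (s : F) (c : int) : (s ^ c) ^+ (m * m') = s ^ (c * (m * m')%N).
  by rewrite -[LHS]/((s ^ c) ^ (m * m')%N%:Z) exprz_exp.
have [] : (a' i - a j) * (m * m')%N = 0 /\ (b' i - b j) * (m * m')%N = 0.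
  apply: (lam_independent ch0 chil); rewrite !mulrBl !expfzDr // mulrACA -!invr_expz -invfM -!K -!exprMn W.
  by rewrite mulfV // expf_neq0 // mulf_neq0 // expfz_neq0.
have M1 : ((m * m')%N%:Z == 0) = false by case: (m * m')%N M0.
by move=> /eqP + /eqP; rewrite !mulf_eq0 !M1 !orbF !subr_eq0 => /eqP -> /eqP ->.
Qed.
End Rigidity.

(** * The double *)

Section Double.
Variable n : nat.
Notation G := (SLZ n.+1).
Implicit Types a b u v w : G.

Lemma SLZ_unit a : val a \is a GRing.unit.
Proof. by rewrite unitmxE (eqP (valP a)) unitr1. Qed.

Lemma val_zpow a k : val (SLZ_zpow a k) = val a ^ k.
Proof.
have H m : val (SLZ_npow a m) = val a ^+ m.
  by elim: m => //= m IH; rewrite exprS -mulmxE -IH.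
by case: k => m; [exact: H | rewrite -[RHS]/((val a ^+ m.+1)^-1) -H].
Qed.

Lemma in_cyclicP w u : in_cyclic w u <-> exists k : int, val u = val w ^ k.
Proof.
split=> -[k e]; exists k; first by rewrite e val_zpow.
by apply: val_inj; rewrite val_zpow.
Qed.

Lemma in_cyclic_mulr w u v : in_cyclic w u -> in_cyclic w (SLZ_mul u v) <-> in_cyclic w v.
Proof.
move=> /in_cyclicP[k e]; have uw := SLZ_unit w.
split=> /in_cyclicP[c e']; apply/in_cyclicP.
  exists (- k + c); rewrite exprzDr // -e' -mulmxE mulmxA mulmxE -invr_expz e.
  by rewrite mulVr ?mul1r // -e SLZ_unit.
by exists (k + c); rewrite exprzDr // -e -e'.
Qed.

Lemma SLZ_mulA a b u : SLZ_mul a (SLZ_mul b u) = SLZ_mul (SLZ_mul a b) u.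
Proof. by apply: val_inj; apply: mulmxA. Qed.

Lemma SLZ_mul1 a : SLZ_mul (SLZ_one n.+1) a = a.
Proof. by apply: val_inj; apply: mul1mx. Qed.

Lemma SLZ_mulr1 a : SLZ_mul a (SLZ_one n.+1) = a.
Proof. by apply: val_inj; apply: mulmx1. Qed.

Section Action.
Variable w : G.

Definition in_cyclicb u : bool :=
  if excluded_middle_informative (in_cyclic w u) then true else false.

Lemma in_cyclicbP u : reflect (in_cyclic w u) (in_cyclicb u).
Proof. by rewrite /in_cyclicb; case: excluded_middle_informative => h; constructor. Qed.

Definition flip (p : G * bool) := (p.1, p.2 (+) in_cyclicb p.1).

(* The first copy acts by left multiplication on [G]; the second copy acts by the
   conjugate of this action under an involution that moves exactly the points of
   <w> * bool, so that the two actions agree on <w> and nowhere else. *)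
Definition act (c : dletter n.+1) (p : G * bool) :=
  if c.1 then flip (SLZ_mul c.2 p.1, (flip p).2) else (SLZ_mul c.2 p.1, p.2).

Lemma deq_act s t p : deq w s t -> foldr act p s = foldr act p t.
Proof.
elim=> {s t} [s t st|//|s t _ -> //|s t q _ -> _ -> //].
case: st => [i a b x y|i x y|u x y wu]; rewrite !foldr_cat /=; congr (foldr act _ x).
all: set q := foldr act p y; rewrite /act /=.
- case: i => /=; rewrite /flip /=; last by rewrite SLZ_mulA.
  by rewrite SLZ_mulA -!addbA (addbA (in_cyclicb (SLZ_mul b _))) addbb.
- by case: i; rewrite /= SLZ_mul1; [case: (q) => a i; rewrite /flip /= -addbA addbb addbF | case: (q)].
- rewrite /flip /= -addbA; set B := in_cyclicb _; set B' := in_cyclicb _.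
  have -> : B = B' by apply/in_cyclicbP/in_cyclicbP => /(in_cyclic_mulr _ wu).
  by rewrite addbb addbF.
Qed.

(** At the point [(1, false)] the first copy gives [(a, false)]. The second flips the boolean once
    at 1, and once more exactly when [a] lies in the cyclic subgroup. *)
Lemma deq_in_cyclic a : deq w [:: (false, a)] [:: (true, a)] -> in_cyclic w a.
Proof.
move/(deq_act (SLZ_one _, false)); rewrite /= /act /flip /= SLZ_mulr1 => -[].
have -> : in_cyclicb (SLZ_one _) by apply/in_cyclicbP; exists 0.
by case: in_cyclicbP.
Qed.

Lemma deq_nil a : deq w [:: (false, a)] [::] -> a = SLZ_one _.
Proof. by move/(deq_act (SLZ_one _, false)); rewrite /= /act /= SLZ_mulr1 => -[]. Qed.
End Action.
End Double.

(** * The block embedding of SL(3, Z) and maximality *)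

Section Embedding.
Variable r : nat.

Definition emb (A : 'M[int]_3) : 'M[int]_r.+3 := block_mx A 0 0 (1%:M : 'M_r).

Lemma embM A B : emb (A * B) = emb A * emb B.
Proof.
rewrite /emb -[RHS]/(block_mx A 0 0 1%:M *m block_mx B 0 0 1%:M) mulmx_block.
by rewrite !mul0mx !mulmx0 mul1mx !addr0 add0r.
Qed.

Lemma emb1 : emb 1 = 1.
Proof. by rewrite -[RHS]/(1%:M : 'M_(3 + r)) scalar_mx_block. Qed.

Lemma embX A k : emb (A ^+ k) = emb A ^+ k.
Proof. by elim: k => [|k IH]; rewrite ?emb1 // !exprS embM IH. Qed.

Lemma emb_inj : injective emb.
Proof. by move=> A B /(@eq_block_mx _ 3 r 3 r)[]. Qed.

Lemma det_emb A : \det (emb A) = \det A.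
Proof. by rewrite /emb (@det_ublock _ 3) det1 mulr1. Qed.

(** The default value of [insubd], the identity, is taken outside determinant 1. This keeps
    representations total functions on integer matrices. *)
Definition slz A : SLZ r.+3 := insubd (SLZ_one r.+3) (emb A).

Lemma val_slz A : \det A = 1 -> val (slz A) = emb A.
Proof. by move=> dA; rewrite insubdK // unfold_in det_emb dA. Qed.

Lemma slz_inj A B : \det A = 1 -> \det B = 1 -> slz A = slz B -> A = B.
Proof. by move=> dA dB e; apply: emb_inj; rewrite -!val_slz // e. Qed.

Lemma slzM A B : \det A = 1 -> \det B = 1 -> slz (A * B) = SLZ_mul (slz A) (slz B).
Proof.
move=> dA dB; apply: val_inj; rewrite /= !val_slz // ?embM //.
by rewrite det_mulmx dA dB mulr1.
Qed.

Lemma slz1 : slz 1 = SLZ_one r.+3.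
Proof. by apply: val_inj; rewrite val_slz ?det1 // emb1. Qed.

Lemma det_w0_sub1 : \det (w0 - 1) = 1.
Proof. by rewrite mx3_1r /w0 mx3N mx3D det_mx3; ring. Qed.

(** Since [w0 - 1] has determinant 1, it is invertible over the integers, and a matrix commuting
    with [emb w0] has vanishing off-diagonal blocks. Its upper left block is then a root of [w0]. *)
Lemma emb_w0_root (V : 'M[int]_r.+3) k : V * emb w0 = emb w0 * V -> V ^+ k = emb w0 -> k = 1%N.
Proof.
have [A [B [C [D ->]]]] : exists A B C D, V = (block_mx A B C D : 'M_(3 + r)).
  by exists (@ulsubmx _ 3 r 3 r V), (@ursubmx _ 3 r 3 r V), (@dlsubmx _ 3 r 3 r V), (@drsubmx _ 3 r 3 r V);
    rewrite submxK.
rewrite /emb -[_ * _]/(block_mx A B C D *m block_mx w0 0 0 1%:M).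
rewrite -[X in _ = X]/(block_mx w0 0 0 1%:M *m block_mx A B C D) !mulmx_block.
rewrite !mul0mx !mulmx0 !mul1mx !mulmx1 !addr0 !add0r => /(@eq_block_mx _ 3 r 3 r)[AE BE CE _].
have [u1 u1'] : exists u : 'M[int]_3, (w0 - 1) *m u = 1%:M /\ u *m (w0 - 1) = 1%:M.
  have uw : w0 - 1 \in unitmx by rewrite unitmxE det_w0_sub1 unitr1.
  by exists (invmx (w0 - 1)); rewrite mulmxV // mulVmx.
have B0 : B = 0.
  rewrite -[B]mul1mx -(proj2 u1') -mulmxA mulmxBl -BE.
  by rewrite -[(1 : 'M_3) *m B]/(1%:M *m B) mul1mx subrr mulmx0.
have C0 : C = 0.
  rewrite -[C]mulmx1 -(proj1 u1') mulmxA mulmxBr CE.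
  by rewrite -[C *m (1 : 'M_3)]/(C *m 1%:M) mulmx1 subrr mul0mx.
move=> e; apply: (w0_root AE).
have [D' VE] : exists D' : 'M_r, (block_mx A B C D : 'M_r.+3) ^+ k = block_mx (A ^+ k) 0 0 D'.
  elim: k {e} => [|k [D' IH]]; first by exists 1%:M; rewrite -[LHS]/(1%:M : 'M_(3 + r)) scalar_mx_block.
  exists (D *m D'); rewrite !exprS IH B0 C0 -[LHS]/(block_mx A 0 0 D *m block_mx (A ^+ k) 0 0 D').
  by rewrite mulmx_block !mul0mx !mulmx0 !addr0 add0r.
by move: e; rewrite VE => /(@eq_block_mx _ 3 r 3 r)[].
Qed.

Lemma maximal_cyclic_w0 : maximal_cyclic (slz w0).
Proof.
move=> v wv u; have uv := SLZ_unit v; set W := slz w0 in wv *.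
have /in_cyclicP[k WE] : in_cyclic v W.
  by apply: wv; apply/in_cyclicP; exists 1; rewrite expr1z.
have WvE : val W = emb w0 by rewrite val_slz ?det_w0.
have [c vE] : exists c : int, val v = val W ^ c.
  case: k WE => k WE.
    have k1 : k = 1%N.
      apply: (@emb_w0_root (val v)); last by rewrite -WvE WE.
      by rewrite -WvE WE -exprS -exprSr.
    by exists 1; rewrite WE k1 !expr1z.
  have WE' : val W = (val v)^-1 ^+ k.+1 by rewrite WE NegzE -invr_expz exprVn.
  have k1 : k.+1 = 1%N.
    apply: (@emb_w0_root (val v)^-1); last by rewrite -WvE WE'.
    by rewrite -WvE WE' -exprS -exprSr.
  by exists (-1); rewrite WE' k1 expr1 exprN1 invrK.
by case/in_cyclicP=> d uE; apply/in_cyclicP; exists (c * d); rewrite uE vE exprz_exp.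
Qed.

Lemma not_in_cyclic (F : fieldType) (l : F) m : [pchar F] =i pred0 -> chi l = 0 -> (0 < m)%N ->
  ~ in_cyclic (slz w0) (slz (w1 ^+ m)).
Proof.
move=> ch0 chil m0 /in_cyclicP[k].
rewrite !val_slz ?det_w0 //; last first.
  by elim: (m) => [|j IH]; rewrite ?det1 // exprS det_mulmx det_w1 IH mulr1.
case: k => c.
  move: (w1X_indep ch0 chil (a := 0) (c := c) m0); rewrite expr0 mul1r => H.
  by rewrite -[_ ^ _]/(_ ^+ c) -embX => /emb_inj.
move: (w1X_indep ch0 chil (a := c.+1) (c := 0) m0); rewrite expr0 => H e; apply: H; apply: emb_inj.
rewrite embM e NegzE -invr_expz -[_ ^ c.+1]/(_ ^+ c.+1) embX emb1 mulrV // unitrX //.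
by rewrite unitmxE det_emb det_w0 unitr1.
Qed.
End Embedding.

Lemma chi_root_extension (F : fieldType) :
  exists (L : fieldType) (iota : {rmorphism F -> L}) (l : L), chi l = 0.
Proof.
pose p : {poly F} := 'X^3 + 'X^2 - 2%:R *: 'X - 1.
have [] := @root_extension F p.
  suff -> : size p = 4%N by [].
  rewrite /p -!addrA size_polyDl size_polyXn //.
  apply: leq_ltn_trans (size_polyD _ _) _; rewrite gtn_max size_polyXn /=.
  apply: leq_ltn_trans (size_polyD _ _) _; rewrite gtn_max !size_polyN size_poly1 andbT.
  by apply: leq_ltn_trans (size_scale_leq _ _) _; rewrite size_polyX.
move=> L [iota [l /rootP e]]; exists L, iota, l; rewrite -[RHS]e.
rewrite /p !rmorphB rmorphD /= !map_polyXn map_polyZ map_polyX rmorph1 /=.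
by rewrite !hornerE rmorph_nat.
Qed.

(** * The contradiction from a faithful representation *)

Section NotLinear.
Variables (r : nat) (F : fieldType) (n : nat).
Variable phi : dword r.+3 -> 'M[F]_n.+1.
Hypothesis phiP : faithful_rep (slz r w0) phi.

Definition rep i (A : 'M[int]_3) := phi [:: (i, slz r A)].

Lemma rep1 i : rep i 1 = 1.
Proof.
case: phiP => deqE p1 _ _ _; rewrite -[RHS]p1 /rep slz1.
by apply: deqE; apply: rst_step; apply: (dstep_one _ _ [::]).
Qed.

Lemma repM i A B : \det A = 1 -> \det B = 1 -> rep i (A * B) = rep i A * rep i B.
Proof.
move=> dA dB; case: phiP => deqE _ pM _ _; rewrite /rep slzM // -mulmxE -pM /=.
by apply/esym/deqE; apply: rst_step; apply: (dstep_mul _ _ _ _ [::]).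
Qed.

Lemma repX i A k : \det A = 1 -> \det (A ^+ k) = 1 /\ rep i (A ^+ k) = rep i A ^+ k.
Proof.
move=> dA; elim: k => [|k [dk IH]]; first by rewrite det1 rep1.
by rewrite !exprS det_mulmx dA dk mulr1 repM // IH.
Qed.

Lemma rep_inj A : \det A = 1 -> rep false A = 1 -> A = 1.
Proof.
move=> dA; case: phiP => _ p1 _ _ inj; rewrite -[RHS]p1 => /inj /deq_nil.
by rewrite -slz1; apply: slz_inj; rewrite ?det1.
Qed.

Lemma rep_agree A : rep false A = rep true A -> in_cyclic (slz r w0) (slz r A).
Proof. by case: phiP => _ _ _ _ inj /inj /deq_in_cyclic. Qed.

Lemma rep_w0 : rep false w0 = rep true w0.
Proof.
case: phiP => deqE _ _ _ _; apply: deqE; apply: rst_step.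
by apply: (dstep_amalg [::]); apply/in_cyclicP; exists 1; rewrite expr1z.
Qed.

Lemma rep_pchar p : p \notin [pchar F].
Proof.
apply/negP => pF; have i02 : o0 != o2 by [].
have [p1 pM] := (rep1 false, @repM false).
have [m m0] := unipotent_pchar pF (E_unipotent p1 pM i02).
rewrite -(phiEX p1 pM) // => /rep_inj; rewrite det_E // => /(_ erefl).
move/matrixP/(_ o0 o2); rewrite E_mx3 // mx3_1r !mxE /=.
have : (0 < N n * m)%N by rewrite muln_gt0 m0 fact_gt0.
by case: (N n * m)%N.
Qed.

Lemma not_faithful : False.
Proof.
have ch0 : [pchar F] =i pred0 by move=> p; apply/negbTE/rep_pchar.
(* The eigenvalues of [w0] need not lie in [F], so scalars are extended; the extension map is
   injective on matrices. *)
have [L [iota [l chil]]] := chi_root_extension F.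
have ch0' : [pchar L] =i pred0 by move=> p; rewrite (fmorph_pchar iota) ch0.
pose psi i A := map_mx iota (rep i A).
have psiP i : psi i 1 = 1 /\ forall A B, \det A = 1 -> \det B = 1 -> psi i (A * B) = psi i A * psi i B.
  by split=> [|A B dA dB]; rewrite /psi ?rep1 ?map_mx1 // repM // -!mulmxE map_mxM.
have [|m m0] := rigidity ch0' chil (psiP false) (psiP true); first by rewrite /psi rep_w0.
rewrite /psi -!rmorphXn => /map_mx_inj; have [dm <-] := repX false m det_w1.
have [_ <-] := repX true m det_w1 => /rep_agree.
exact: not_in_cyclic ch0' chil m0.
Qed.
End NotLinear.

Theorem theorem1p6 :
  forall n : nat, (3 <= n)%N ->
  exists w : SLZ n, maximal_cyclic w /\ ~ double_linear w.
Proof.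
case=> [|[|[|r]]] // _; exists (slz r w0); split; first exact: maximal_cyclic_w0.
case=> F [[|d] [phi phiP]]; last exact: not_faithful phiP.
(* In dimension 0 all matrices coincide, so injectivity would identify an elementary matrix with the
   identity. *)
case: phiP => _ _ _ _ inj.
have : E o0 o1 1 = 1 :> 'M[int]_3.
  apply: (@slz_inj r); rewrite ?det_E ?det1 // slz1; apply: (@deq_nil _ (slz r w0)).
  by apply: inj; apply/matrixP => -[].
by move/matrixP/(_ o0 o1); rewrite E_mx3 // mx3_1r !mxE.
Qed.
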